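(* Let $X$ and $Y$ be bounded geometry metric spaces. Then: (1) if $\mathbb{C}_u[X]$ and $\mathbb{C}_u[Y]$ are $*$-isomorphic, then $X$ and $Y$ are coarsely equivalent; (2) if $X$ and $Y$ have property A, and if $C^*_u(X)$ and $C^*_u(Y)$ are Morita equivalent (in particular, if they are $*$-isomorphic), then $X$ and $Y$ are coarsely equivalent.
   Context: A metric space $X$ has bounded geometry if for all $R\ge 0$ there is $N_R\in\mathbb{N}$ such that every ball of radius $R$ in $X$ has at most $N_R$ elements. A (not necessarily continuous) map $f:X\to Y$ of metric spaces is uniformly expansive if for all $R>0$ there is $S>0$ such that $d(x_1,x_2)\le R$ implies $d(f(x_1),f(x_2))\le S$. Two maps $f,g:X\to Y$ are close if there is $C>0$ with $d(f(x),g(x))\le C$ for all $x\in X$. $X$ and $Y$ are coarsely equivalent if there are uniformly expansive maps $f:X\to Y$ and $g:Y\to X$ such that $f\circ g$ and $g\circ f$ are close to the identity maps on $Y$ and $X$ respectively. For an $X$-by-$X$ matrix $T=(T_{xy})_{x,y\in X}$ with entries in $\mathbb{C}$, the propagation is $\sup\{d(x,y) : T_{xy}\neq 0\}$. The algebraic uniform Roe algebra $\mathbb{C}_u[X]$ is the $*$-algebra (under the usual matrix operations) of all finite propagation matrices with uniformly bounded entries. It is faithfully represented by bounded operators on $l^2(X)$ in the obvious way, and its operator norm completion is the uniform Roe algebra $C^*_u(X)$. Morita equivalence of $C^*$-algebras is strong (Rieffel) Morita equivalence. Property A (Yu): for all $r>0$, $\epsilon>0$ there are finite subsets $A_x\subseteq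 X\times\mathbb{N}$ $(x\in X)$ with $(x,1)\in A_x$, with $|A_x\,\triangle\, A_{x'}|/|A_x\cap A_{x'}|<\epsilon$ whenever $d(x,x')\le r$, and such that there is $R>0$ with $d(y,z)\le R$ whenever $(y,m),(z,n)\in A_x$ for some $x$. For bounded geometry metric spaces it is known to be equivalent to the metric sparsification property: there is a constant $0<\kappa\le 1$ such that for all $S\ge0$ there is $D\ge0$ such that for every Borel probability measure $\mu$ on $X$ there is a subset $\Omega=\sqcup_{i\in I}\Omega_i\subseteq X$ with $\mu(\Omega)\ge\kappa$, $\mathrm{diam}(\Omega_i)\le D$ for all $i$, and $d(\Omega_i,\Omega_j)>S$ for all $i\ne j$. *)

(* Defs.v *)
From HB Require Import structures.
From mathcomp Require Import all_boot all_order all_algebra finmap.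
From mathcomp Require Import complex.
From mathcomp Require Import mathcomp_extra boolp classical_sets functions cardinality fsbigop.
From mathcomp Require Import reals ereal topology normedtype sequences metric_structure summability.
From mathcomp Require Import ring lra.
Set Implicit Arguments.
Unset Strict Implicit.
Unset Printing Implicit Defensive.
Import Order.TTheory GRing.Theory Num.Theory.
Import numFieldNormedType.Exports.
Local Open Scope classical_set_scope.
Local Open Scope ring_scope.
Local Open Scope complex_scope.

(* The library's absolute value on R[i] takes its values in R[i]; this is the
   same number as an element of R. *)
Definition modulus (R : rcfType) (z : R[i]) : R := complex.Re `|z|.

Definition norm_complete (R : rcfType) (V : zmodType) (nrm : V -> R) : Prop :=
  forall u : nat -> V,
    (forall e : R, 0 < e -> exists N, forall m n, (N <= m)%N -> (N <= n)%N ->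
       nrm (u m - u n) <= e) ->
    exists l : V, forall e : R, 0 < e -> exists N, forall n, (N <= n)%N ->
       nrm (u n - l) <= e.

(* Algebras are not required to have a unit. *)
HB.mixin Record isStarAlgebra (R : rcfType) A of GRing.Lmodule R[i] A := {
  smul : A -> A -> A;
  star : A -> A;
  smulA : associative smul;
  smulDl : left_distributive smul +%R;
  smulDr : right_distributive smul +%R;
  smulZl : forall (k : R[i]) (x y : A), smul (k *: x) y = k *: smul x y;
  smulZr : forall (k : R[i]) (x y : A), smul x (k *: y) = k *: smul x y;
  starK : involutive star;
  starD : {morph star : x y / x + y};
  starZ : forall (k : R[i]) (x : A), star (k *: x) = conjc k *: star x;
  starM : forall x y : A, star (smul x y) = smul (star y) (star x)
}.

#[short(type="starAlgType")]
HB.structure Definition StarAlgebra (R : rcfType) :=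
  { A of isStarAlgebra R A & GRing.Lmodule R[i] A }.

Definition star_isomorphic (R : rcfType) (A B : starAlgType R) : Prop :=
  exists f : {linear A -> B},
    [/\ bijective f, {morph f : x y / smul x y} & {morph f : x / star x}].

HB.mixin Record isCStarAlgebra (R : rcfType) A of StarAlgebra R A := {
  cnorm : A -> R;
  cnorm_eq0 : forall x : A, cnorm x = 0 -> x = 0;
  cnormD : forall x y : A, cnorm (x + y) <= cnorm x + cnorm y;
  cnormZ : forall (k : R[i]) (x : A), cnorm (k *: x) = modulus k * cnorm x;
  cnormM : forall x y : A, cnorm (smul x y) <= cnorm x * cnorm y;
  cstar_identity : forall x : A, cnorm (smul (star x) x) = cnorm x ^+ 2;
  cnorm_complete : norm_complete cnorm
}.

#[short(type="cstarAlgType")]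
HB.structure Definition CStarAlgebra (R : rcfType) :=
  { A of StarAlgebra R A & isCStarAlgebra R A }.

Section Morita.
Context {R : rcfType}.

(* In a C*-algebra the elements b^* b are exactly the positive ones. *)
Definition cpositive (A : cstarAlgType R) (a : A) : Prop :=
  exists b : A, a = smul (star b) b.

Section HilbertModules.
Context (A : cstarAlgType R) (E : lmodType R[i]) (ip : E -> E -> A).

Definition full_inner_product : Prop := forall (a : A) (e : R), 0 < e ->
  exists s : seq (E * E), cnorm (a - \sum_(p <- s) ip p.1 p.2) <= e.

Record left_hilbert_module (act : A -> E -> E) : Prop := {
  lhm_actDl : forall a b x, act (a + b) x = act a x + act b x;
  lhm_actDr : forall a x y, act a (x + y) = act a x + act a y;
  lhm_actZl : forall (k : R[i]) a x, act (k *: a) x = k *: act a x;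
  lhm_actZr : forall (k : R[i]) a x, act a (k *: x) = k *: act a x;
  lhm_actM : forall a b x, act (smul a b) x = act a (act b x);
  lhm_ipD : forall x y z, ip (x + y) z = ip x z + ip y z;
  lhm_ipZ : forall (k : R[i]) x y, ip (k *: x) y = k *: ip x y;
  lhm_ip_act : forall a x y, ip (act a x) y = smul a (ip x y);
  lhm_ip_star : forall x y, star (ip x y) = ip y x;
  lhm_ip_ge0 : forall x, cpositive (ip x x);
  lhm_ip_eq0 : forall x, ip x x = 0 -> x = 0;
  lhm_complete : norm_complete (fun x => Num.sqrt (cnorm (ip x x)))
}.

Record right_hilbert_module (act : E -> A -> E) : Prop := {
  rhm_actDl : forall x y a, act (x + y) a = act x a + act y a;
  rhm_actDr : forall x a b, act x (a + b) = act x a + act x b;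
  rhm_actZl : forall (k : R[i]) x a, act (k *: x) a = k *: act x a;
  rhm_actZr : forall (k : R[i]) x a, act x (k *: a) = k *: act x a;
  rhm_actM : forall x a b, act x (smul a b) = act (act x a) b;
  rhm_ipD : forall x y z, ip x (y + z) = ip x y + ip x z;
  rhm_ipZ : forall (k : R[i]) x y, ip x (k *: y) = k *: ip x y;
  rhm_ip_act : forall x y a, ip x (act y a) = smul (ip x y) a;
  rhm_ip_star : forall x y, star (ip x y) = ip y x;
  rhm_ip_ge0 : forall x, cpositive (ip x x);
  rhm_ip_eq0 : forall x, ip x x = 0 -> x = 0;
  rhm_complete : norm_complete (fun x => Num.sqrt (cnorm (ip x x)))
}.

End HilbertModules.

(* Rieffel's A-B-equivalence (imprimitivity) bimodules. [lip] is linear in its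
   first variable and [rip] in its second one. *)
Record imprimitivity_bimodule (A B : cstarAlgType R) (E : lmodType R[i])
    (lact : A -> E -> E) (ract : E -> B -> E)
    (lip : E -> E -> A) (rip : E -> E -> B) : Prop := {
  ib_left : left_hilbert_module lip lact;
  ib_right : right_hilbert_module rip ract;
  ib_lfull : full_inner_product lip;
  ib_rfull : full_inner_product rip;
  ib_actA : forall a x b, ract (lact a x) b = lact a (ract x b);
  ib_lact_adj : forall a x y, rip (lact a x) y = rip x (lact (star a) y);
  ib_ract_adj : forall b x y, lip (ract x b) y = lip x (ract y (star b));
  ib_ipA : forall x y z, lact (lip x y) z = ract x (rip y z)
}.

Definition morita_equivalent (A B : cstarAlgType R) : Prop :=
  exists (E : lmodType R[i]) (lact : A -> E -> E) (ract : E -> B -> E)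
         (lip : E -> E -> A) (rip : E -> E -> B),
    imprimitivity_bimodule lact ract lip rip.

End Morita.

HB.mixin Record isInnerProduct (R : rcfType) H of GRing.Lmodule R[i] H := {
  dot : H -> H -> R[i];
  dotDl : forall u v w : H, dot (u + v) w = dot u w + dot v w;
  dotZl : forall (k : R[i]) (u v : H), dot (k *: u) v = k * dot u v;
  dotC : forall u v : H, dot v u = conjc (dot u v);
  dot_ge0 : forall u : H, 0 <= dot u u;
  dot_eq0 : forall u : H, dot u u = 0 -> u = 0
}.

#[short(type="innerProductType")]
HB.structure Definition InnerProduct (R : rcfType) :=
  { H of isInnerProduct R H & GRing.Lmodule R[i] H }.

Definition hnorm (R : rcfType) (H : innerProductType R) (u : H) : R :=
  Num.sqrt (complex.Re (dot u u)).

HB.mixin Record isHilbert (R : rcfType) H of InnerProduct R H := {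
  hnorm_complete : norm_complete (@hnorm R H)
}.

#[short(type="hilbertType")]
HB.structure Definition Hilbert (R : rcfType) :=
  { H of InnerProduct R H & isHilbert R H }.

Lemma modulusE (R : rcfType) (z : R[i]) :
  modulus z = Num.sqrt (complex.Re z ^+ 2 + complex.Im z ^+ 2).
Proof. by case: z. Qed.

Lemma modulus_ge0 (R : rcfType) (z : R[i]) : 0 <= modulus z.
Proof. by rewrite modulusE sqrtr_ge0. Qed.

Lemma modulus_sqr (R : rcfType) (z : R[i]) :
  modulus z ^+ 2 = complex.Re z ^+ 2 + complex.Im z ^+ 2.
Proof. by rewrite modulusE sqr_sqrtr// addr_ge0// sqr_ge0. Qed.

Section InnerProductTheory.
Context {R : rcfType} {H : innerProductType R}.
Implicit Types u v w : H.
Notation Re := complex.Re.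
Notation Im := complex.Im.

Lemma dotDr u v w : dot u (v + w) = dot u v + dot u w.
Proof. by rewrite dotC dotDl rmorphD /= -!dotC. Qed.
Lemma dotZr (k : R[i]) u v : dot u (k *: v) = conjc k * dot u v.
Proof. by rewrite dotC dotZl rmorphM /= -dotC. Qed.
Lemma dotNl u v : dot (- u) v = - dot u v.
Proof. by rewrite -scaleN1r dotZl mulN1r. Qed.
Lemma dotNr u v : dot u (- v) = - dot u v.
Proof. by rewrite dotC dotNl rmorphN /= -dotC. Qed.
Lemma dot0l v : dot 0 v = 0.
Proof. by rewrite -(scale0r (0:H)) dotZl mul0r. Qed.
Lemma dot0r v : dot v 0 = 0.
Proof. by rewrite dotC dot0l rmorph0. Qed.
Lemma dotBl u v w : dot (u - v) w = dot u w - dot v w.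
Proof. by rewrite dotDl dotNl. Qed.
Lemma dotBr u v w : dot u (v - w) = dot u v - dot u w.
Proof. by rewrite dotDr dotNr. Qed.

Lemma Re_dotC u v : Re (dot v u) = Re (dot u v).
Proof. by rewrite dotC; case: (dot u v). Qed.

Lemma Re_dot_ge0 u : 0 <= Re (dot u u).
Proof. by have := dot_ge0 u; rewrite lecE => /andP[]. Qed.

Lemma Im_dot u : Im (dot u u) = 0.
Proof. by have := dot_ge0 u; rewrite lecE => /andP[/eqP]. Qed.

Lemma dotE u : dot u u = (Re (dot u u))%:C.
Proof. by have := Im_dot u; case: (dot u u) => a b /= ->. Qed.

Lemma hnorm_ge0 u : 0 <= hnorm u. Proof. exact: sqrtr_ge0. Qed.
Lemma hnorm_sqr u : hnorm u ^+ 2 = Re (dot u u).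
Proof. by rewrite sqr_sqrtr// Re_dot_ge0. Qed.
Lemma hnorm_eq0 u : hnorm u = 0 -> u = 0.
Proof.
move=> h; apply: dot_eq0; rewrite dotE -hnorm_sqr h expr0n //=.
Qed.
Lemma hnorm0 : hnorm (0 : H) = 0.
Proof. by rewrite /hnorm dot0l sqrtr0. Qed.
Lemma hnormZ k u : hnorm (k *: u) = modulus k * hnorm u.
Proof.
apply/eqP; rewrite -(@eqrXn2 _ 2)// ?hnorm_ge0// ?mulr_ge0 ?modulus_ge0 ?hnorm_ge0//.
rewrite exprMn !hnorm_sqr modulus_sqr dotZl dotZr dotE.
by case: k => a b /=; apply/eqP; ring.
Qed.
Lemma hnormN u : hnorm (- u) = hnorm u.
Proof. by rewrite /hnorm dotNl dotNr opprK. Qed.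
Lemma hdistC u v : hnorm (u - v) = hnorm (v - u).
Proof. by rewrite -hnormN opprB. Qed.

Lemma hnormD_sqr u v :
  hnorm (u + v) ^+ 2 = hnorm u ^+ 2 + hnorm v ^+ 2 + 2 * Re (dot u v).
Proof.
rewrite !hnorm_sqr dotDl !dotDr (dotC u v).
by case: (dot u u) (dot u v) (dot v v) => [? ?] [? ?] [? ?] /=; ring.
Qed.

Lemma CauchySchwarz_Re u v : Re (dot u v) <= hnorm u * hnorm v.
Proof.
have [u0|u0] := eqVneq (hnorm u) 0.
  by rewrite (hnorm_eq0 u0) dot0l hnorm0 mul0r.
have [v0|v0] := eqVneq (hnorm v) 0.
  by rewrite (hnorm_eq0 v0) dot0r hnorm0 mulr0.
have a0 : 0 < hnorm u by rewrite lt_def u0 hnorm_ge0.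
have b0 : 0 < hnorm v by rewrite lt_def v0 hnorm_ge0.
set a := hnorm u in a0 *; set b := hnorm v in b0 *.
have := sqr_ge0 (hnorm (b%:C *: u + (- a)%:C *: v)).
rewrite hnormD_sqr !hnormZ -/a -/b.
rewrite !exprMn !modulus_sqr /= dotZl dotZr.
have -> : Re (b%:C * (conjc (- a)%:C * dot u v)) = - (a * b) * Re (dot u v).
  by case: (dot u v) => x y /=; ring.
move=> h.
have : 0 <= (a * b) * (a * b - Re (dot u v)).
  by move: h; rewrite !expr0n /=; nra.
by rewrite pmulr_rge0 ?mulr_gt0// subr_ge0.
Qed.

Lemma hnormD u v : hnorm (u + v) <= hnorm u + hnorm v.
Proof.
rewrite -(ler_pXn2r (n := 2))// ?nnegrE ?addr_ge0 ?hnorm_ge0//.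
rewrite hnormD_sqr sqrrD.
by have := CauchySchwarz_Re u v; lra.
Qed.

Lemma hnorm_triangle w u v : hnorm (u - v) <= hnorm (u - w) + hnorm (w - v).
Proof. by have := hnormD (u - w) (w - v); rewrite addrA subrK. Qed.

End InnerProductTheory.

Section BoundedOperators.
Context {R : realType} {H : innerProductType R}.
Implicit Types (T S : H -> H) (u v : H).

Definition bounded_linear T : Prop :=
  linear T /\ exists M : R, forall u, hnorm (T u) <= M * hnorm u.

(* Only meaningful when T is bounded: the supremum of an unbounded set is 0. *)
Definition opnorm T : R := sup [set hnorm (T u) | u in [set u | hnorm u <= 1]].

Lemma opnorm_has_sup T : bounded_linear T ->
  has_sup [set hnorm (T u) | u in [set u | hnorm u <= 1]].
Proof.
move=> [_ [M TM]]; split.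
  by exists (hnorm (T 0)); exists 0 => //=; rewrite hnorm0.
exists (Num.max M 0) => _ [u /= u1 <-].
apply: (le_trans (TM u)).
have := hnorm_ge0 u; have : M <= Num.max M 0 by rewrite le_max lexx.
have : 0 <= Num.max M 0 by rewrite le_max lexx orbT.
nra.
Qed.

Lemma linear0' T : linear T -> T 0 = 0.
Proof. by move=> lT; have := lT (-1) 0 0; rewrite scaler0 addr0 scaleN1r addNr. Qed.
Lemma linearD' T u v : linear T -> T (u + v) = T u + T v.
Proof. by move=> lT; rewrite -[u]scale1r lT !scale1r. Qed.
Lemma linearZ' T k u : linear T -> T (k *: u) = k *: T u.
Proof. by move=> lT; rewrite -[k *: u]addr0 lT linear0'// addr0. Qed.
Lemma linearB' T u v : linear T -> T (u - v) = T u - T v.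
Proof. by move=> lT; rewrite linearD'// -scaleN1r linearZ'// scaleN1r. Qed.

Lemma opnorm_ge0 T : bounded_linear T -> 0 <= opnorm T.
Proof.
move=> bT; apply: (@le_trans _ _ (hnorm (T 0))); first exact: hnorm_ge0.
apply: ub_le_sup; first by have [] := opnorm_has_sup bT.
by exists 0 => //=; rewrite hnorm0.
Qed.

Lemma modulus_real (a : R) : 0 <= a -> modulus a%:C = a.
Proof. by move=> a0; rewrite modulusE /= expr0n /= addr0 sqrtr_sqr ger0_norm. Qed.

Lemma opnormP T u : bounded_linear T -> hnorm (T u) <= opnorm T * hnorm u.
Proof.
move=> bT; have [u0|u0] := eqVneq (hnorm u) 0.
  by rewrite (hnorm_eq0 u0) linear0' ?hnorm0 ?mulr0//; case: bT.
have a0 : 0 < hnorm u by rewrite lt_def u0 hnorm_ge0.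
rewrite -ler_pdivrMr//.
have -> : hnorm (T u) / hnorm u = hnorm (T ((hnorm u)^-1%:C *: u)).
  rewrite linearZ'; last by case: bT.
  by rewrite hnormZ modulus_real ?invr_ge0 ?hnorm_ge0// mulrC.
apply: ub_le_sup; first by have [] := opnorm_has_sup bT.
exists ((hnorm u)^-1%:C *: u) => //=.
by rewrite hnormZ modulus_real ?invr_ge0 ?hnorm_ge0// mulVf.
Qed.

Lemma opnorm_le T (M : R) : 0 <= M -> (forall u, hnorm (T u) <= M * hnorm u) ->
  opnorm T <= M.
Proof.
move=> M0 TM; apply: ge_sup.
  by exists (hnorm (T 0)); exists 0 => //=; rewrite hnorm0.
move=> _ [u /= u1 <-]; apply: (le_trans (TM u)).
by rewrite -[leRHS]mulr1 ler_wpM2l.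
Qed.

Lemma bounded_linear0 : bounded_linear (0 : H -> H).
Proof.
split=> [k u v|]; first by rewrite -[LHS]/(0 : H) -[RHS]/(k *: (0 : H) + 0) scaler0 addr0.
by exists 0 => u; rewrite -[(0 : H -> H) u]/(0 : H) hnorm0 mul0r.
Qed.

Lemma bounded_linearP (k : R[i]) T S :
  bounded_linear T -> bounded_linear S -> bounded_linear (k *: T + S).
Proof.
move=> bT bS; split.
  move=> a u v; rewrite !fctE bT.1 bS.1 !scalerDr !scalerA mulrC -!addrA.
  by congr (_ + _); rewrite addrCA.
exists (modulus k * opnorm T + opnorm S) => u; rewrite !fctE.
apply: (le_trans (hnormD _ _)); rewrite hnormZ mulrDl lerD//; last exact: opnormP.
by rewrite -mulrA ler_wpM2l ?modulus_ge0// opnormP.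
Qed.

Lemma bounded_linearN T : bounded_linear T -> bounded_linear (- T).
Proof.
move=> bT; have := bounded_linearP (-1) bT bounded_linear0.
by rewrite addr0 scaleN1r.
Qed.

Lemma bounded_linearD T S :
  bounded_linear T -> bounded_linear S -> bounded_linear (T + S).
Proof. by move=> bT bS; rewrite -[T]scale1r; exact: bounded_linearP. Qed.

Lemma bounded_linearB T S :
  bounded_linear T -> bounded_linear S -> bounded_linear (T - S).
Proof. by move=> bT bS; apply/bounded_linearD/bounded_linearN. Qed.

Lemma bounded_linear_comp T S :
  bounded_linear T -> bounded_linear S -> bounded_linear (T \o S).
Proof.
move=> bT bS; split; first by move=> k u v /=; rewrite bS.1 bT.1.
exists (opnorm T * opnorm S) => u /=.
apply: (le_trans (opnormP _ bT)); rewrite -mulrA ler_wpM2l ?opnorm_ge0//.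
exact: opnormP.
Qed.

Lemma opnorm_comp T S : bounded_linear T -> bounded_linear S ->
  opnorm (T \o S) <= opnorm T * opnorm S.
Proof.
move=> bT bS; apply: opnorm_le => [|u /=]; first by rewrite mulr_ge0 ?opnorm_ge0.
apply: (le_trans (opnormP _ bT)); rewrite -mulrA ler_wpM2l ?opnorm_ge0//.
exact: opnormP.
Qed.

Lemma opnormD T S : bounded_linear T -> bounded_linear S ->
  opnorm (T + S) <= opnorm T + opnorm S.
Proof.
move=> bT bS; apply: opnorm_le => [|u]; first by rewrite addr_ge0 ?opnorm_ge0.
by rewrite fctE mulrDl (le_trans (hnormD _ _))// lerD// opnormP.
Qed.

Lemma opnormZ k T : bounded_linear T -> opnorm (k *: T) = modulus k * opnorm T.
Proof.
move=> bT.
have le_ (c : R[i]) S : bounded_linear S -> opnorm (c *: S) <= modulus c * opnorm S.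
  move=> bS; apply: opnorm_le => [|u].
    by rewrite mulr_ge0 ?modulus_ge0 ?opnorm_ge0.
  by rewrite fctE hnormZ -mulrA ler_wpM2l ?modulus_ge0 ?opnormP.
apply/eqP; rewrite eq_le le_//=.
have [->|k0] := eqVneq k 0.
  by rewrite {1}(@modulus_real 0)// mul0r opnorm_ge0// scale0r; exact: bounded_linear0.
have bkT : bounded_linear (k *: T).
  by rewrite -[k *: T]addr0; apply/bounded_linearP/bounded_linear0.
have := le_ k^-1 _ bkT; rewrite scalerA mulVf// scale1r.
have kk : modulus k^-1 * modulus k = 1.
  have := normrM k^-1 k; rewrite mulVf// normr1 => /(congr1 (@complex.Re R)).
  rewrite /modulus; move: (ger0_Im (normr_ge0 k)) (ger0_Im (normr_ge0 k^-1)).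
  by case: (`|k|) (`|k^-1|) => a b [c d] /= -> ->; rewrite mulr0 subr0 => <-.
move=> h; have := ler_wpM2l (modulus_ge0 k) h.
by rewrite mulrA (mulrC _ (modulus k^-1)) kk mul1r.
Qed.

Lemma opnormN T : opnorm (- T) = opnorm T.
Proof.
rewrite /opnorm; congr sup; apply/seteqP.
by split=> _ [u /= u1 <-]; exists u; rewrite ?fctE ?hnormN.
Qed.

Lemma opnorm_eq0 T : bounded_linear T -> opnorm T = 0 -> T = 0.
Proof.
move=> bT T0; apply/funext => u; apply: hnorm_eq0; apply/eqP.
by rewrite eq_le hnorm_ge0 andbT (le_trans (opnormP u bT))// T0 mul0r.
Qed.


Definition adjoint_of T S : Prop := forall u v, dot (T u) v = dot u (S v).

Lemma dot_inj u v : (forall w, dot w u = dot w v) -> u = v.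
Proof.
move=> h; apply/eqP; rewrite -subr_eq0; apply/eqP/dot_eq0.
by rewrite dotBr h subrr.
Qed.

Lemma adjoint_uniq T S S' : adjoint_of T S -> adjoint_of T S' -> S = S'.
Proof.
by move=> TS TS'; apply/funext => v; apply: dot_inj => w; rewrite -TS -TS'.
Qed.

Lemma adjoint_sym T S : adjoint_of T S -> adjoint_of S T.
Proof. by move=> TS u v; rewrite dotC -TS -dotC. Qed.

Lemma adjoint_Re T S : linear T ->
  (forall u v, complex.Re (dot (T u) v) <= complex.Re (dot u (S v))) ->
  adjoint_of T S.
Proof.
move=> lT re.
have req u v : complex.Re (dot (T u) v) = complex.Re (dot u (S v)).
  apply/eqP; rewrite eq_le re /=; have := re (- u) v.
  rewrite -[- u]add0r linearB'// linear0'// !add0r !dotNl.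
  by case: (dot u (S v)) (dot (T u) v) => a b [c d] /=; lra.
move=> u v; apply/eqP; rewrite eq_complex req eqxx /=; apply/eqP.
have := req ('i *: u) v; rewrite linearZ'// !dotZl.
by case: (dot u (S v)) (dot (T u) v) => a b [c d] /=; lra.
Qed.

Lemma adjoint_comp T S T' S' : adjoint_of T T' -> adjoint_of S S' ->
  adjoint_of (T \o S) (S' \o T').
Proof. by move=> TT' SS' u v /=; rewrite TT' SS'. Qed.

Lemma adjoint_lin (k : R[i]) T S T' S' : adjoint_of T T' -> adjoint_of S S' ->
  adjoint_of (k *: T + S) (conjc k *: T' + S').
Proof.
by move=> a b u v; rewrite !fctE dotDl dotZl dotDr dotZr conjcK a b.
Qed.

Lemma adjoint_opnorm_le T S : bounded_linear T -> adjoint_of T S ->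
  forall v, hnorm (S v) <= opnorm T * hnorm v.
Proof.
move=> bT TS v; have [s0|s0] := eqVneq (hnorm (S v)) 0.
  by rewrite s0 mulr_ge0 ?opnorm_ge0 ?hnorm_ge0.
have a0 : 0 < hnorm (S v) by rewrite lt_def s0 hnorm_ge0.
rewrite -(ler_pM2l a0) -expr2 hnorm_sqr -TS.
apply: (le_trans (CauchySchwarz_Re _ _)).
rewrite mulrA ler_wpM2r ?hnorm_ge0// mulrC; exact: opnormP.
Qed.

Lemma adjoint_linear T S : adjoint_of T S -> linear S.
Proof.
move=> TS k u v; apply: dot_inj => w.
by rewrite -TS !dotDr !dotZr !TS.
Qed.

Lemma adjoint_bounded T S : bounded_linear T -> adjoint_of T S -> bounded_linear S.
Proof.
move=> bT TS; split; first exact: adjoint_linear TS.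
by exists (opnorm T); exact: adjoint_opnorm_le.
Qed.

Lemma adjoint_opnorm T S : bounded_linear T -> adjoint_of T S -> opnorm S = opnorm T.
Proof.
move=> bT TS; have bS := adjoint_bounded bT TS.
apply/eqP; rewrite eq_le; apply/andP; split.
  by apply: opnorm_le; [exact: opnorm_ge0|exact: adjoint_opnorm_le].
by apply: opnorm_le; [exact: opnorm_ge0|apply: adjoint_opnorm_le => //; exact: adjoint_sym].
Qed.

Lemma opnorm_cstar T S : bounded_linear T -> adjoint_of T S ->
  opnorm (S \o T) = opnorm T ^+ 2.
Proof.
move=> bT TS; have bS := adjoint_bounded bT TS.
apply/eqP; rewrite eq_le; apply/andP; split.
  by rewrite expr2 -{1}(adjoint_opnorm bT TS) opnorm_comp.
have bST := bounded_linear_comp bS bT.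
rewrite -[leRHS]sqr_sqrtr ?opnorm_ge0//.
rewrite ler_pXn2r ?nnegrE ?opnorm_ge0 ?sqrtr_ge0//.
apply: opnorm_le => [|u]; first exact: sqrtr_ge0.
rewrite -(ler_pXn2r (n := 2))// ?nnegrE ?mulr_ge0 ?hnorm_ge0 ?sqrtr_ge0//.
rewrite exprMn [Num.sqrt (opnorm _) ^+ 2]sqr_sqrtr ?opnorm_ge0//.
rewrite {1}hnorm_sqr TS.
apply: (le_trans (CauchySchwarz_Re _ _)).
have := opnormP u bST; rewrite /= => h.
by rewrite mulrC expr2 mulrA ler_wpM2r ?hnorm_ge0.
Qed.

End BoundedOperators.

Section OperatorClosure.
Context {R : realType}.

Lemma le_eps_pos (a b c : R) : 0 <= c ->
  (forall e : R, 0 < e -> a <= b + e * c) -> a <= b.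
Proof.
move=> c0 h; apply/ler_addgt0Pr => e e0.
have c1 : 0 < c + 1 by lra.
apply: (le_trans (h (e / (c + 1)) _)); first by rewrite divr_gt0.
by rewrite lerD2l mulrAC ler_pdivrMr// ler_pM2l//; lra.
Qed.

Lemma op_limit (H : hilbertType R) (T : nat -> H -> H) :
  (forall n, bounded_linear (T n)) ->
  (forall e : R, 0 < e -> exists N, forall m n, (N <= m)%N -> (N <= n)%N ->
     opnorm (T m - T n) <= e) ->
  exists2 L : H -> H, bounded_linear L &
    forall e : R, 0 < e -> exists N, forall n, (N <= n)%N -> opnorm (T n - L) <= e.
Proof.
move=> bT cT.
have ex u : exists l : H, forall e : R, 0 < e ->
    exists N, forall n, (N <= n)%N -> hnorm (T n u - l) <= e.
  apply: hnorm_complete => e e0.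
  have u1 : 0 < hnorm u + 1 by have := hnorm_ge0 u; lra.
  have [N NP] := cT (e / (hnorm u + 1)) (divr_gt0 e0 u1).
  exists N => m n Nm Nn.
  apply: (le_trans (opnormP u (bounded_linearB (bT m) (bT n)))).
  apply: (le_trans (ler_wpM2r (hnorm_ge0 u) (NP m n Nm Nn))).
  by rewrite mulrAC ler_pdivrMr// ler_pM2l//; lra.
have [L LP] := choice ex.
have unif e : 0 < e -> exists N, forall n, (N <= n)%N ->
    forall u, hnorm (T n u - L u) <= e * hnorm u.
  move=> e0; have [N NP] := cT e e0; exists N => n Nn u.
  apply: (@le_eps_pos _ _ 1) => // d d0; rewrite mulr1.
  have [M MP] := LP u d d0.
  apply: (le_trans (hnorm_triangle (T (maxn N M) u) _ _)); apply: lerD.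
    apply: (le_trans (opnormP u (bounded_linearB (bT n) (bT _)))).
    by rewrite ler_wpM2r ?hnorm_ge0// NP// leq_maxl.
  by apply: MP; rewrite leq_maxr.
have bL : bounded_linear L.
  split.
    move=> k u v; apply/eqP; rewrite -subr_eq0; apply/eqP/hnorm_eq0/eqP.
    rewrite eq_le hnorm_ge0 andbT.
    apply: (@le_eps_pos _ _ (hnorm (k *: u + v) + (modulus k * hnorm u + hnorm v))).
      by rewrite !addr_ge0 ?mulr_ge0 ?hnorm_ge0 ?modulus_ge0.
    move=> e e0; rewrite add0r; have [N NP] := unif e e0.
    apply: (le_trans (hnorm_triangle (T N (k *: u + v)) _ _)).
    rewrite [leRHS]mulrDr; apply: lerD; first by rewrite hdistC NP.
    rewrite (bT N).1 opprD addrACA -scalerBr.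
    apply: (le_trans (hnormD _ _)); rewrite mulrDr hnormZ lerD ?NP//.
    by rewrite mulrCA ler_wpM2l ?modulus_ge0 ?NP.
  have [N NP] := unif 1 ltr01.
  exists (opnorm (T N) + 1) => u; rewrite mulrDl.
  have -> : L u = T N u + (L u - T N u) by rewrite addrC subrK.
  by apply: (le_trans (hnormD _ _)); rewrite lerD ?opnormP// hdistC NP.
exists L => // e e0; have [N NP] := unif e e0; exists N => n Nn.
by apply: opnorm_le => [|u]; [exact: ltW|exact: NP].
Qed.

Definition in_closure (H : innerProductType R) (S : set (H -> H)) (T : H -> H) : Prop :=
  bounded_linear T /\
  forall e : R, 0 < e -> exists2 T' : H -> H, S T' & opnorm (T - T') <= e.

Record star_subalgebra (H : innerProductType R) := StarSubalgebra {
  opset :> set (H -> H);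
  opset_bounded : forall T, opset T -> bounded_linear T;
  opset0 : opset 0;
  opset_lin : forall (k : R[i]) T S, opset T -> opset S -> opset (k *: T + S);
  opset_comp : forall T S, opset T -> opset S -> opset (T \o S);
  opset_adj : forall T, opset T -> exists2 T', opset T' & adjoint_of T T'
}.

Section Closure.
Context {H : hilbertType R} (S : star_subalgebra H).

Definition closure_pred : pred (H -> H) := fun T => `[< in_closure S T >].

Lemma closure_predP T : reflect (in_closure S T) (T \in closure_pred).
Proof. exact: asboolP. Qed.

Lemma in_closure_lin (k : R[i]) T T' :
  in_closure S T -> in_closure S T' -> in_closure S (k *: T + T').
Proof.
move=> [bT aT] [bT' aT']; split=> [|e e0]; first exact: bounded_linearP.
have k1 : 0 < modulus k + 1 by have := modulus_ge0 k; lra.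
have [U SU TU] := aT _ (divr_gt0 e0 k1).
have e2 : 0 < e / (modulus k + 1) by rewrite divr_gt0.
have [U' SU' TU'] := aT' _ e2.
have bU := opset_bounded SU; have bU' := opset_bounded SU'.
exists (k *: U + U'); first exact: opset_lin.
rewrite opprD addrACA -scalerBr.
apply: (le_trans (opnormD _ (bounded_linearB bT' bU'))).
  by rewrite -[_ *: _]addr0; apply: bounded_linearP (bounded_linearB bT bU) bounded_linear0.
rewrite opnormZ; last exact: bounded_linearB.
have -> : e = modulus k * (e / (modulus k + 1)) + e / (modulus k + 1).
  by field; rewrite gt_eqF.
by rewrite lerD// ler_wpM2l ?modulus_ge0.
Qed.

Lemma in_closure0 : in_closure S 0.
Proof.
split=> [|e e0]; first exact: bounded_linear0.
exists 0; first exact: opset0.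
by rewrite subrr opnorm_le ?ltW// => u; rewrite -[(0 : H -> H) u]/(0 : H) hnorm0 mulr_ge0 ?hnorm_ge0 ?ltW.
Qed.

Lemma in_closure_comp T T' :
  in_closure S T -> in_closure S T' -> in_closure S (T \o T').
Proof.
move=> [bT aT] [bT' aT']; split=> [|e e0]; first exact: bounded_linear_comp.
have t0 := opnorm_ge0 bT; have t0' := opnorm_ge0 bT'.
set t := opnorm T in t0; set t' := opnorm T' in t0'.
have c0 : 0 < t + t' + 1 by lra.
pose d := Num.min 1 (e / (t + t' + 1)).
have d0 : 0 < d by rewrite lt_min ltr01 divr_gt0.
have [U SU TU] := aT _ d0; have [U' SU' TU'] := aT' _ d0.
have bU := opset_bounded SU; have bU' := opset_bounded SU'.
exists (U \o U'); first exact: opset_comp.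
have -> : (T \o T') - (U \o U') = ((T - U) \o U') + (T \o (T' - U')).
  apply/funext => u; rewrite !fctE /= (linearB' _ _ bT.1) ?fctE.
  by rewrite [RHS]addrC addrA subrK.
have bTU := bounded_linearB bT bU; have bTU' := bounded_linearB bT' bU'.
apply: (le_trans (opnormD (bounded_linear_comp bTU bU') (bounded_linear_comp bT bTU'))).
have d1 : d <= 1 by rewrite ge_min lexx.
have de : d * (t + t' + 1) <= e by rewrite -ler_pdivlMr// ge_min lexx orbT.
have nU' : opnorm U' <= t' + d.
  have -> : U' = T' + - (T' - U') by rewrite opprB addrC subrK.
  apply: (le_trans (opnormD bT' (bounded_linearN bTU'))).
  by rewrite opnormN lerD2l.
apply: le_trans de.
have h1 := opnorm_comp bTU bU'; have h2 := opnorm_comp bT bTU'.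
have o1 := opnorm_ge0 bU'; have o2 := opnorm_ge0 bTU; have o3 := opnorm_ge0 bTU'.
have h3 : opnorm (T - U) * opnorm U' <= d * (t' + 1).
  by apply: ler_pM => //; lra.
have h4 : opnorm T * opnorm (T' - U') <= t * d by apply: ler_pM => //; lra.
by rewrite -/t; lra.
Qed.

Lemma in_closure_adj T : in_closure S T ->
  exists2 T', in_closure S T' & adjoint_of T T'.
Proof.
move=> [bT aT].
have n0 (n : nat) : 0 < (n.+1%:R)^-1 :> R by rewrite invr_gt0.
have ex (n : nat) : exists UV : (H -> H) * (H -> H),
    [/\ opset S UV.1, opset S UV.2, adjoint_of UV.1 UV.2 & opnorm (T - UV.1) <= (n.+1%:R)^-1].
  have [U SU TU] := aT _ (n0 n); have [V SV UV] := opset_adj SU.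
  by exists (U, V).
have {ex} [W WP] := choice ex.
have small (e : R) : 0 < e -> exists N, forall n, (N <= n)%N -> (n.+1%:R)^-1 <= e.
  move=> e0; exists (Num.bound (e^-1)) => n Nn.
  rewrite -[leRHS]invrK lef_pV2 ?posrE ?invr_gt0//.
  apply: (le_trans (ltW (archi_boundP _))); first by rewrite invr_ge0 ltW.
  by rewrite ler_nat (leq_trans Nn).
have bU n : bounded_linear (W n).1 by have [/opset_bounded] := WP n.
have bV n : bounded_linear (W n).2 by have [_ /opset_bounded] := WP n.
have [|L bL LP] := @op_limit H (fun n => (W n).2) bV.
  move=> e e0; have [N NP] := small (e / 2) (divr_gt0 e0 (ltr0Sn R 1)).
  exists N => m n Nm Nn.
  have adj : adjoint_of ((W m).1 - (W n).1) ((W m).2 - (W n).2).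
    have [_ _ am _] := WP m; have [_ _ an _] := WP n => u v.
    by rewrite !fctE dotBl dotBr am an.
  rewrite (adjoint_opnorm (bounded_linearB (bU m) (bU n)) adj).
  have -> : (W m).1 - (W n).1 = - (T - (W m).1) + (T - (W n).1).
    by rewrite opprB addrA subrK.
  have bm := bounded_linearB bT (bU m); have bn := bounded_linearB bT (bU n).
  apply: (le_trans (opnormD (bounded_linearN bm) bn)); rewrite opnormN.
  have [_ _ _ hm] := WP m; have [_ _ _ hn] := WP n.
  rewrite [leRHS]splitr; exact: lerD (le_trans hm (NP m Nm)) (le_trans hn (NP n Nn)).
exists L.
  split=> // e e0; have [N NP] := LP e e0; exists (W N).2; first by have [] := WP N.
  by rewrite -opnormN opprB NP.
apply: adjoint_Re => [|u v]; first by case: bT.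
  apply: (@le_eps_pos _ _ (2 * (hnorm u * hnorm v))).
    by rewrite !mulr_ge0 ?hnorm_ge0.
  move=> e e0; have [N1 NP1] := LP e e0; have [N2 NP2] := small e e0.
  pose n := maxn N1 N2; have [_ _ adj hn] := WP n.
  have h1 : opnorm (T - (W n).1) <= e.
    by apply: (le_trans hn); apply: NP2; rewrite leq_maxr.
  have h2 : opnorm ((W n).2 - L) <= e by apply: NP1; rewrite leq_maxl.
  have E : dot (T u) v - dot u (L v) =
      dot ((T - (W n).1) u) v + dot u (((W n).2 - L) v).
    by rewrite !fctE dotBl dotBr adj addrA subrK.
  have RE (a b c d : R[i]) : a - b = c + d ->
      complex.Re a = complex.Re b + complex.Re c + complex.Re d.
    by case: a b c d => [? ?] [? ?] [? ?] [? ?] [h _]; rewrite /=; lra.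
  rewrite (RE _ _ _ _ E) -addrA lerD2l.
  have c1 := CauchySchwarz_Re ((T - (W n).1) u) v.
  have c2 := CauchySchwarz_Re u (((W n).2 - L) v).
  have p1 := opnormP u (bounded_linearB bT (bU n)).
  have p2 := opnormP v (bounded_linearB (bV n) bL).
  have q1 : hnorm ((T - (W n).1) u) * hnorm v <= e * hnorm u * hnorm v.
    by rewrite ler_wpM2r ?hnorm_ge0// (le_trans p1)// ler_wpM2r ?hnorm_ge0.
  have q2 : hnorm u * hnorm (((W n).2 - L) v) <= hnorm u * (e * hnorm v).
    by rewrite ler_wpM2l ?hnorm_ge0// (le_trans p2)// ler_wpM2r ?hnorm_ge0.
  by apply: (le_trans (lerD (le_trans c1 q1) (le_trans c2 q2))); lra.
Qed.

(* The operator-norm closure of S in the bounded operators on H. *)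
Record opclosure := OpClosure {
  closure_op :> H -> H;
  closure_opP : closure_op \in closure_pred
}.

HB.instance Definition _ := [isSub for closure_op].
HB.instance Definition _ := [Choice of opclosure by <:].

Lemma closure_submod_closed : submod_closed closure_pred.
Proof.
split; first by apply/closure_predP; exact: in_closure0.
move=> k T T' /closure_predP cT /closure_predP cT'; apply/closure_predP.
exact: in_closure_lin.
Qed.

HB.instance Definition _ :=
  GRing.isSubmodClosed.Build R[i] (H -> H) closure_pred closure_submod_closed.
HB.instance Definition _ := [SubChoice_isSubLmodule of opclosure by <:].

Lemma opclosureP (x : opclosure) : in_closure S x.
Proof. exact/closure_predP/closure_opP. Qed.

Lemma opclosure_inj (x y : opclosure) : (x : H -> H) = y -> x = y.
Proof. exact: val_inj. Qed.

Lemma opclosure_bounded (x : opclosure) : bounded_linear x.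
Proof. by have [] := opclosureP x. Qed.

Definition opclosure_mul (x y : opclosure) : opclosure :=
  OpClosure (introT (closure_predP _)
    (in_closure_comp (opclosureP x) (opclosureP y))).

Lemma opclosure_star_ex (x : opclosure) :
  exists y : opclosure, adjoint_of (x : H -> H) y.
Proof.
have [T' cT' aT'] := in_closure_adj (opclosureP x).
by exists (OpClosure (introT (closure_predP _) cT')).
Qed.

Definition opclosure_star (x : opclosure) : opclosure :=
  projT1 (cid (opclosure_star_ex x)).

Lemma opclosure_starP (x : opclosure) : adjoint_of (x : H -> H) (opclosure_star x).
Proof. exact: projT2 (cid (opclosure_star_ex x)). Qed.

Lemma opclosure_starE (x y : opclosure) :
  adjoint_of (x : H -> H) y -> opclosure_star x = y.
Proof.
by move=> xy; apply/opclosure_inj/(adjoint_uniq (opclosure_starP x)).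
Qed.

Fact opclosure_mulA : associative opclosure_mul.
Proof. by move=> x y z; exact: opclosure_inj. Qed.
Fact opclosure_mulDl : left_distributive opclosure_mul +%R.
Proof. by move=> x y z; exact: opclosure_inj. Qed.
Fact opclosure_mulDr : right_distributive opclosure_mul +%R.
Proof.
move=> x y z; apply: opclosure_inj; apply/funext => u /=.
exact: linearD' (opclosure_bounded x).1.
Qed.
Fact opclosure_mulZl (k : R[i]) (x y : opclosure) :
  opclosure_mul (k *: x) y = k *: opclosure_mul x y.
Proof. exact: opclosure_inj. Qed.
Fact opclosure_mulZr (k : R[i]) (x y : opclosure) :
  opclosure_mul x (k *: y) = k *: opclosure_mul x y.
Proof.
apply: opclosure_inj; apply/funext => u /=.
exact: linearZ' (opclosure_bounded x).1.
Qed.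
Fact opclosure_starK : involutive opclosure_star.
Proof. by move=> x; apply/opclosure_starE/adjoint_sym/opclosure_starP. Qed.
Fact opclosure_starD : {morph opclosure_star : x y / x + y}.
Proof.
move=> x y; apply: opclosure_starE => u v /=.
by rewrite !fctE dotDl dotDr !opclosure_starP.
Qed.
Fact opclosure_starZ (k : R[i]) (x : opclosure) :
  opclosure_star (k *: x) = conjc k *: opclosure_star x.
Proof.
apply: opclosure_starE => u v /=.
by rewrite !fctE dotZl dotZr conjcK opclosure_starP.
Qed.
Fact opclosure_starM (x y : opclosure) :
  opclosure_star (opclosure_mul x y) = opclosure_mul (opclosure_star y) (opclosure_star x).
Proof.
by apply: opclosure_starE; apply: adjoint_comp; exact: opclosure_starP.
Qed.

HB.instance Definition _ := isStarAlgebra.Build R opclosure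
  opclosure_mulA opclosure_mulDl opclosure_mulDr opclosure_mulZl opclosure_mulZr
  opclosure_starK opclosure_starD opclosure_starZ opclosure_starM.

Definition opclosure_norm (x : opclosure) : R := opnorm x.

Fact opclosure_norm_eq0 (x : opclosure) : opclosure_norm x = 0 -> x = 0.
Proof. by move/(opnorm_eq0 (opclosure_bounded x)) => x0; exact: opclosure_inj. Qed.
Fact opclosure_normD (x y : opclosure) :
  opclosure_norm (x + y) <= opclosure_norm x + opclosure_norm y.
Proof. by apply: opnormD; exact: opclosure_bounded. Qed.
Fact opclosure_normZ (k : R[i]) (x : opclosure) :
  opclosure_norm (k *: x) = modulus k * opclosure_norm x.
Proof. by apply: opnormZ; exact: opclosure_bounded. Qed.
Fact opclosure_normM (x y : opclosure) :
  opclosure_norm (smul x y) <= opclosure_norm x * opclosure_norm y.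
Proof. by apply: opnorm_comp; exact: opclosure_bounded. Qed.
Fact opclosure_cstar (x : opclosure) :
  opclosure_norm (smul (star x) x) = opclosure_norm x ^+ 2.
Proof.
by apply: opnorm_cstar; [exact: opclosure_bounded|exact: opclosure_starP].
Qed.
Fact opclosure_complete : norm_complete opclosure_norm.
Proof.
move=> x cx.
have [//|L bL LP] := @op_limit H (fun n => x n : H -> H) (fun n => opclosure_bounded (x n)).
have cL : in_closure S L.
  split=> // e e0.
  have e2 : 0 < e / 2 by rewrite divr_gt0.
  have [N NP] := LP _ e2; have [_ /(_ _ e2)[T ST hT]] := opclosureP (x N).
  exists T => //.
  have -> : L - T = - ((x N : H -> H) - L) + ((x N : H -> H) - T).
    by rewrite opprB addrA subrK.
  have bx := opclosure_bounded (x N).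
  apply: (le_trans (opnormD (bounded_linearN (bounded_linearB bx bL))
    (bounded_linearB bx (opset_bounded ST)))).
  by rewrite opnormN; have := NP N (leqnn _); lra.
by exists (OpClosure (introT (closure_predP _) cL)).
Qed.

HB.instance Definition _ := isCStarAlgebra.Build R opclosure
  opclosure_norm_eq0 opclosure_normD opclosure_normZ opclosure_normM
  opclosure_cstar opclosure_complete.

End Closure.
End OperatorClosure.

(* Sum of an absolutely summable family; [sum] is the limit of the finite
   partial sums along the directed set of finite subsets of X. *)
Definition csum (R : realType) (X : choiceType) (f : X -> R[i]) : R[i] :=
  sum (fun x => complex.Re (f x) : R^o) +i* sum (fun x => complex.Im (f x) : R^o).

Definition square_summable (R : realType) (X : choiceType) (u : X -> R[i]) : Prop :=
  exists M : R, forall F : {fset X}, \sum_(x <- F) modulus (u x) ^+ 2 <= M.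

#[local] Existing Instance totally_filter.

Section Sums.
Context {R : realType} {X : choiceType}.
Implicit Types (f g : X -> R) (F : {fset X}).

Definition psum f : {fset X} -> R := @partial_sum X R^o f.

Lemma psumE f F : psum f F = \sum_(x <- F) f x.
Proof. by rewrite /psum /partial_sum -(big_seq_fsetE _ _ predT f). Qed.

Lemma psum_sum f s : psum f @ totally --> s -> sum (f : X -> R^o) = s.
Proof. move=> fs; apply: (@cvg_lim R^o); [exact: Rhausdorff|exact: fs]. Qed.

Lemma psumD f g s t : psum f @ totally --> s -> psum g @ totally --> t ->
  psum (fun x => f x + g x) @ totally --> s + t.
Proof.
move=> fs gt; have -> : psum (fun x => f x + g x) = (fun F => psum f F + psum g F).
  by apply/funext => F; rewrite !psumE big_split.
exact: cvgD.
Qed.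

Lemma psumZ f s (k : R) : psum f @ totally --> s ->
  psum (fun x => k * f x) @ totally --> k * s.
Proof.
move=> fs; have -> : psum (fun x => k * f x) = (fun F => k * psum f F).
  by apply/funext => F; rewrite !psumE mulr_sumr.
exact: cvgMl_tmp.
Qed.

Lemma psum_nneg f (M : R) : (forall x, 0 <= f x) ->
  (forall F, \sum_(x <- F) f x <= M) ->
  exists s : R, psum f @ totally --> s.
Proof.
move=> f0 fM.
have hs : has_sup [set psum f F | F in [set: {fset X}]].
  split; first by exists (psum f fset0); exists fset0.
  by exists M => _ [F _ <-]; rewrite psumE.
exists (sup [set psum f F | F in [set: {fset X}]]).
apply/cvgrPdist_lt => e e0.
have [_ [F _ <-] Fe] := sup_adherent e0 hs.
exists F => // G /= FG.
have FGs : psum f F <= psum f G.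
  rewrite !psumE (big_fsetID _ (mem F) G) /=.
  have -> : [fset x in G | x \in F]%fset = F.
    by apply/fsetP => x; rewrite !inE /=; case xF: (x \in F); rewrite ?andbF// andbT (fsubsetP FG).
  by rewrite lerDl sumr_ge0.
have Gs : psum f G <= sup [set psum f F | F in [set: {fset X}]].
  by apply: ub_le_sup; [case: hs|exists G].
by rewrite ger0_norm ?subr_ge0//; lra.
Qed.

Lemma psum_dom f g (M : R) : (forall x, `|f x| <= g x) ->
  (forall F, \sum_(x <- F) g x <= M) -> exists s : R, psum f @ totally --> s.
Proof.
move=> fg gM.
have [x|s gs] := @psum_nneg g M _ gM; first by rewrite (le_trans _ (fg x)).
have [x|F|t ft] := @psum_nneg (fun x => g x + f x) (M + M).
- by have := fg x; rewrite ler_norml => /andP[]; lra.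
- rewrite big_split lerD// (le_trans _ (gM F))// ler_sum// => x _.
  by rewrite (le_trans (ler_norm _)).
exists (t + -1 * s); have -> : f = (fun x => g x + f x + -1 * g x).
  by apply/funext => x; rewrite mulN1r addrAC subrr add0r.
by apply: (@psumD (fun x => g x + f x) (fun x => -1 * g x)); [exact: ft|exact: psumZ].
Qed.

Lemma psum_le f s (M : R) : psum f @ totally --> s ->
  (forall F, \sum_(x <- F) f x <= M) -> s <= M.
Proof.
move=> fs fM; rewrite -(cvg_lim _ fs)//; apply: limr_le; first by apply/cvg_ex; exists s.
by near=> F; rewrite psumE.
Unshelve. all: by end_near. Qed.

Lemma psum_ge f s F : (forall x, 0 <= f x) -> psum f @ totally --> s ->
  \sum_(x <- F) f x <= s.
Proof.
move=> f0 fs; rewrite -(cvg_lim _ fs)//; apply: limr_ge; first by apply/cvg_ex; exists s.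
exists F => // G /= FG.
rewrite psumE (big_fsetID _ (mem F) G) /=.
have -> : [fset x in G | x \in F]%fset = F.
  by apply/fsetP => x; rewrite !inE /=; case xF: (x \in F); rewrite ?andbF// andbT (fsubsetP FG).
by rewrite lerDl sumr_ge0.
Qed.

Lemma psum_fin f F : (forall x, x \notin F -> f x = 0) ->
  psum f @ totally --> \sum_(x <- F) f x.
Proof.
move=> fF; apply: cvg_near_cst; exists F => // G /= FG.
rewrite psumE (big_fsetID _ (mem F) G) /=.
have -> : [fset x in G | x \in F]%fset = F.
  by apply/fsetP => x; rewrite !inE /=; case xF: (x \in F); rewrite ?andbF// andbT (fsubsetP FG).
rewrite [X in _ + X]big_seq_cond [X in _ + X]big1 ?addr0// => x.
by rewrite !inE /= andbT => /andP[_ /fF].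
Qed.

Definition has_csum (f : X -> R[i]) (s : R[i]) : Prop :=
  psum (fun x => complex.Re (f x)) @ totally --> complex.Re s /\
  psum (fun x => complex.Im (f x)) @ totally --> complex.Im s.

Lemma has_csumE (f : X -> R[i]) s : has_csum f s -> csum f = s.
Proof.
by move=> [/psum_sum re /psum_sum im]; rewrite /csum re im; case: s {re im}.
Qed.

Lemma has_csum_eq (f g : X -> R[i]) s : f =1 g -> has_csum f s -> has_csum g s.
Proof. by move=> /funext ->. Qed.

Lemma has_csumD (f g : X -> R[i]) s t : has_csum f s -> has_csum g t ->
  has_csum (fun x => f x + g x) (s + t).
Proof.
move=> [fr fi] [gr gi]; split.
  have -> : complex.Re (s + t) = complex.Re s + complex.Re t by case: s t {fr fi gr gi} => ? ? [].
  have -> : (fun x => complex.Re (f x + g x)) = (fun x => complex.Re (f x) + complex.Re (g x)).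
    by apply/funext => x; case: (f x) (g x) => ? ? [].
  exact: psumD.
have -> : complex.Im (s + t) = complex.Im s + complex.Im t by case: s t {fr fi gr gi} => ? ? [].
have -> : (fun x => complex.Im (f x + g x)) = (fun x => complex.Im (f x) + complex.Im (g x)).
  by apply/funext => x; case: (f x) (g x) => ? ? [].
exact: psumD.
Qed.

Lemma has_csumZ (k : R[i]) (f : X -> R[i]) s : has_csum f s -> has_csum (fun x => k * f x) (k * s).
Proof.
move=> [fr fi]; case: k => a b; split.
  have -> : complex.Re ((a +i* b) * s) = a * complex.Re s + (- b) * complex.Im s.
    by case: s {fr fi} => ? ? /=; ring.
  have -> : (fun x => complex.Re ((a +i* b) * f x)) =
            (fun x => a * complex.Re (f x) + (- b) * complex.Im (f x)).
    by apply/funext => x; case: (f x) => ? ? /=; ring.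
  by apply: psumD; exact: psumZ.
have -> : complex.Im ((a +i* b) * s) = a * complex.Im s + b * complex.Re s.
  by case: s {fr fi} => ? ? /=; ring.
have -> : (fun x => complex.Im ((a +i* b) * f x)) =
          (fun x => a * complex.Im (f x) + b * complex.Re (f x)).
  by apply/funext => x; case: (f x) => ? ? /=; ring.
by apply: psumD; exact: psumZ.
Qed.

Lemma has_csum_conj (f : X -> R[i]) s : has_csum f s -> has_csum (fun x => conjc (f x)) (conjc s).
Proof.
move=> [fr fi]; split.
  have -> : complex.Re (conjc s) = complex.Re s by case: s {fr fi}.
  have -> // : (fun x => complex.Re (conjc (f x))) = (fun x => complex.Re (f x)).
  by apply/funext => x; case: (f x).
have -> : complex.Im (conjc s) = -1 * complex.Im s by case: s {fr fi} => ? ? /=; ring.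
have -> : (fun x => complex.Im (conjc (f x))) = (fun x => -1 * complex.Im (f x)).
  by apply/funext => x; case: (f x) => ? ? /=; ring.
exact: psumZ.
Qed.

Lemma has_csum_fin (f : X -> R[i]) F : (forall x, x \notin F -> f x = 0) ->
  has_csum f (\sum_(x <- F) f x).
Proof.
move=> fF; split.
  have -> : complex.Re (\sum_(x <- F) f x) = \sum_(x <- F) complex.Re (f x).
    by apply: (big_morph (@complex.Re R)) => // -[? ?] [].
  by apply: psum_fin => x /fF ->.
have -> : complex.Im (\sum_(x <- F) f x) = \sum_(x <- F) complex.Im (f x).
  by apply: (big_morph (@complex.Im R)) => // -[? ?] [].
by apply: psum_fin => x /fF ->.
Qed.

Lemma modulusZ (k z : R[i]) : modulus (k * z) ^+ 2 = modulus k ^+ 2 * modulus z ^+ 2.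
Proof. by rewrite !modulus_sqr; case: k z => ? ? [? ?] /=; ring. Qed.

Lemma modulus_addle (a b : R[i]) :
  modulus (a + b) ^+ 2 <= 2 * modulus a ^+ 2 + 2 * modulus b ^+ 2.
Proof.
rewrite !modulus_sqr; case: a b => a a' [b b'] /=.
by have := sqr_ge0 (a - b); have := sqr_ge0 (a' - b'); lra.
Qed.

Lemma has_csum_dot (u v : X -> R[i]) : square_summable u -> square_summable v ->
  exists s, has_csum (fun x => u x * conjc (v x)) s.
Proof.
move=> [M uM] [N vN].
have dom (p : R[i] -> R) : (forall a b : R[i], `|p (a * conjc b)| <= modulus a ^+ 2 + modulus b ^+ 2) ->
    exists s : R, psum (fun x => p (u x * conjc (v x))) @ totally --> s.
  move=> pab; apply: (@psum_dom _ (fun x => modulus (u x) ^+ 2 + modulus (v x) ^+ 2) (M + N)) => [//|F].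
  by rewrite big_split lerD.
have [a b|s rs] := dom (@complex.Re R).
  rewrite !modulus_sqr ler_norml; case: a b => a a' [b b'] /=.
  have := sqr_ge0 (a - b); have := sqr_ge0 (a' - b').
  have := sqr_ge0 (a + b); have := sqr_ge0 (a' + b').
  have := sqr_ge0 a; have := sqr_ge0 a'; have := sqr_ge0 b; have := sqr_ge0 b'.
  by move=> *; apply/andP; split; lra.
have [a b|t it] := dom (@complex.Im R).
  rewrite !modulus_sqr ler_norml; case: a b => a a' [b b'] /=.
  have := sqr_ge0 (a - b'); have := sqr_ge0 (a' - b).
  have := sqr_ge0 (a + b'); have := sqr_ge0 (a' + b).
  have := sqr_ge0 a; have := sqr_ge0 a'; have := sqr_ge0 b; have := sqr_ge0 b'.
  by move=> *; apply/andP; split; lra.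
by exists (s +i* t); split.
Qed.

Definition square_summable_pred : pred (X -> R[i]) := fun u => `[< square_summable u >].

Lemma square_summable_submod : submod_closed square_summable_pred.
Proof.
split.
  apply/asboolP; exists 0 => F; rewrite big1// => x _.
  by rewrite -[(0 : X -> R[i]) x]/(0 : R[i]) modulus_sqr /= expr0n addr0.
move=> k u v /asboolP[M uM] /asboolP[N vN]; apply/asboolP.
exists (2 * (modulus k ^+ 2 * M) + 2 * N) => F.
apply: (@le_trans _ _ (\sum_(x <- F) (2 * (modulus k ^+ 2 * modulus (u x) ^+ 2) + 2 * modulus (v x) ^+ 2))).
  by apply: ler_sum => x _; rewrite !fctE -modulusZ modulus_addle.
rewrite big_split -!mulr_sumr lerD// ler_wpM2l// ler_wpM2l// sqr_ge0 //.
Qed.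

End Sums.

Section L2.
Variables (R : realType) (X : choiceType).

HB.instance Definition _ :=
  GRing.isSubmodClosed.Build R[i] (X -> R[i]) (@square_summable_pred R X) square_summable_submod.

Record l2 := L2 {
  l2_fun :> X -> R[i];
  l2_funP : l2_fun \in @square_summable_pred R X
}.

HB.instance Definition _ := [isSub for l2_fun].
HB.instance Definition _ := [Choice of l2 by <:].
HB.instance Definition _ := [SubChoice_isSubLmodule of l2 by <:].

Implicit Types (u v w : l2) (F : {fset X}).

Lemma l2P u : square_summable u. Proof. exact/asboolP/l2_funP. Qed.

Definition l2_dot u v : R[i] := csum (fun x => u x * conjc (v x)).

Lemma l2_dotP u v : has_csum (fun x => u x * conjc (v x)) (l2_dot u v).
Proof.
by have [s hs] := has_csum_dot (l2P u) (l2P v); rewrite /l2_dot (has_csumE hs).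
Qed.

Fact l2_dotDl u v w : l2_dot (u + v) w = l2_dot u w + l2_dot v w.
Proof.
apply: has_csumE; have := has_csumD (l2_dotP u w) (l2_dotP v w).
by apply: has_csum_eq => x /=; rewrite fctE mulrDl.
Qed.
Fact l2_dotZl (k : R[i]) u v : l2_dot (k *: u) v = k * l2_dot u v.
Proof.
apply: has_csumE; have := has_csumZ k (l2_dotP u v).
by apply: has_csum_eq => x /=; rewrite fctE mulrA.
Qed.
Fact l2_dotC u v : l2_dot v u = conjc (l2_dot u v).
Proof.
apply: has_csumE; have := has_csum_conj (l2_dotP u v).
by apply: has_csum_eq => x /=; rewrite rmorphM /= conjcK mulrC.
Qed.
Lemma l2_dot_Re u : psum (fun x => modulus (u x) ^+ 2) @ totally --> complex.Re (l2_dot u u).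
Proof.
have [+ _] := l2_dotP u u.
have -> // : (fun x => complex.Re (u x * conjc (u x))) = (fun x => modulus (u x) ^+ 2).
by apply/funext => x; rewrite modulus_sqr; case: (u x) => ? ? /=; ring.
Qed.
Lemma l2_dot_Im u : complex.Im (l2_dot u u) = 0.
Proof.
have := l2_dotC u u; case: (l2_dot u u) => a b [h] /=; lra.
Qed.
Lemma l2_sum_le u F : \sum_(x <- F) modulus (u x) ^+ 2 <= complex.Re (l2_dot u u).
Proof. by apply: psum_ge; [move=> x; exact: sqr_ge0|exact: l2_dot_Re]. Qed.
Fact l2_dot_ge0 u : 0 <= l2_dot u u.
Proof.
by rewrite lecE l2_dot_Im eqxx /=; have := l2_sum_le u fset0; rewrite big_nil.
Qed.
Fact l2_dot_eq0 u : l2_dot u u = 0 -> u = 0.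
Proof.
move=> u0; apply: val_inj; apply/funext => x.
have := l2_sum_le u [fset x]%fset; rewrite big_seq_fset1 u0 modulus_sqr => h.
rewrite -[RHS]/(0 : R[i]) -[LHS]/(u x); case: (u x) h => a b /= h.
have a0 := sqr_ge0 a; have b0 := sqr_ge0 b.
have /eqP : a ^+ 2 = 0 by lra.
have /eqP : b ^+ 2 = 0 by lra.
by rewrite !sqrf_eq0 => /eqP -> /eqP ->.
Qed.

HB.instance Definition _ := isInnerProduct.Build R l2
  l2_dotDl l2_dotZl l2_dotC l2_dot_ge0 l2_dot_eq0.

Lemma real_cauchy (a : nat -> R) :
  (forall e : R, 0 < e -> exists N, forall m n, (N <= m)%N -> (N <= n)%N -> `|a m - a n| <= e) ->
  exists l : R, forall e : R, 0 < e -> exists N, forall n, (N <= n)%N -> `|a n - l| <= e.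
Proof.
move=> ca.
have /cauchy_cvgP/cvg_ex[l al] : cauchy (a @ \oo).
  apply: cauchy_exP => e e0.
  have [N NP] := ca (e / 2) (divr_gt0 e0 (ltr0Sn R 1)).
  exists (a N), N => // n /= Nn; rewrite /ball /= (le_lt_trans (NP N n (leqnn N) Nn))//.
  by rewrite ltr_pdivrMr// ltr_pMr// ltr1n.
exists l => e e0; move/cvgrPdist_le: al => /(_ e e0)[N _ NP].
by exists N => n /NP; rewrite distrC.
Qed.

Lemma modulus_Re (z : R[i]) : `|complex.Re z| <= modulus z.
Proof.
by rewrite modulusE -sqrtr_sqr ler_wsqrtr// lerDl sqr_ge0.
Qed.
Lemma modulus_Im (z : R[i]) : `|complex.Im z| <= modulus z.
Proof.
by rewrite modulusE -sqrtr_sqr ler_wsqrtr// lerDr sqr_ge0.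
Qed.
Lemma modulus_le (z : R[i]) : modulus z <= `|complex.Re z| + `|complex.Im z|.
Proof.
rewrite -(ler_pXn2r (n := 2))// ?nnegrE ?modulus_ge0 ?addr_ge0//.
rewrite modulus_sqr sqrrD !real_normK ?num_real// -addrA lerD2l lerDr.
by rewrite mulrn_wge0// mulr_ge0.
Qed.

Lemma l2_sum_hnorm u F : \sum_(x <- F) modulus (u x) ^+ 2 <= hnorm u ^+ 2.
Proof. by rewrite hnorm_sqr l2_sum_le. Qed.

Lemma l2_modulus_le u x : modulus (u x) <= hnorm u.
Proof.
rewrite -(ler_pXn2r (n := 2))// ?nnegrE ?modulus_ge0 ?hnorm_ge0//.
by have := l2_sum_hnorm u [fset x]%fset; rewrite big_seq_fset1.
Qed.

Lemma l2_hnorm_le u (M : R) : 0 <= M ->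
  (forall F : {fset X}, \sum_(x <- F) modulus (u x) ^+ 2 <= M ^+ 2) -> hnorm u <= M.
Proof.
move=> M0 uM; rewrite -(ler_pXn2r (n := 2))// ?nnegrE ?hnorm_ge0//.
rewrite hnorm_sqr; apply: psum_le uM; exact: l2_dot_Re.
Qed.

Fact l2_complete : norm_complete (@hnorm R l2).
Proof.
move=> u cu.
have ex x : exists l : R[i], forall e : R, 0 < e -> exists N, forall n, (N <= n)%N ->
    modulus (u n x - l) <= e.
  have cx (e : R) : 0 < e -> exists N, forall m n, (N <= m)%N -> (N <= n)%N ->
      modulus (u m x - u n x) <= e.
    move=> e0; have [N NP] := cu e e0; exists N => m n Nm Nn.
    exact: le_trans (l2_modulus_le (u m - u n) x) (NP m n Nm Nn).
  have [|a aP] := @real_cauchy (fun n => complex.Re (u n x)).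
    move=> e /cx[N NP]; exists N => m n Nm Nn.
    apply: le_trans (NP m n Nm Nn); apply: le_trans (modulus_Re _).
    by case: (u m x) (u n x) => ? ? [].
  have [|b bP] := @real_cauchy (fun n => complex.Im (u n x)).
    move=> e /cx[N NP]; exists N => m n Nm Nn.
    apply: le_trans (NP m n Nm Nn); apply: le_trans (modulus_Im _).
    by case: (u m x) (u n x) => ? ? [].
  exists (a +i* b) => e e0; have e2 : 0 < e / 2 by rewrite divr_gt0.
  have [N NP] := aP _ e2; have [N' NP'] := bP _ e2.
  exists (maxn N N') => n; rewrite geq_max => /andP[/NP h /NP' h'].
  rewrite (le_trans (modulus_le _))// [leRHS]splitr lerD//.
    by apply: le_trans h; case: (u n x).
  by apply: le_trans h'; case: (u n x).
have [L LP] := choice ex.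
have fin (F : {fset X}) (d : R) : 0 < d -> exists M, forall n, (M <= n)%N ->
    forall x, x \in F -> modulus (u n x - L x) <= d.
  move=> d0; have [N NP] := choice (fun x => LP x d d0).
  exists (\max_(x <- F) N x)%N => n Mn x xF; apply: NP.
  by apply: leq_trans Mn; exact: leq_bigmax_seq.
have key (e : R) : 0 < e -> exists N, forall n, (N <= n)%N -> forall F : {fset X},
    \sum_(x <- F) modulus (u n x - L x) ^+ 2 <= e ^+ 2.
  move=> e0; have [N NP] := cu (e / 2) (divr_gt0 e0 (ltr0Sn R 1)).
  exists N => n Nn F.
  have c0 : 0 < e ^+ 2 / (4 * (#|` F|%:R + 1)).
    by rewrite divr_gt0 ?exprn_gt0// mulr_gt0// ltr_wpDl.
  pose d := Num.min 1 (e ^+ 2 / (4 * (#|` F|%:R + 1))).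
  have d0 : 0 < d by rewrite lt_min ltr01 c0.
  have [M MP] := fin F d d0; pose m := maxn N M.
  have h x : x \in F -> modulus (u n x - L x) ^+ 2 <= 2 * modulus ((u n - u m) x) ^+ 2 + 2 * d.
    move=> xF; have -> : u n x - L x = (u n - u m) x + (u m x - L x).
      by rewrite -[(u n - u m) x]/(u n x - u m x) addrA subrK.
    apply: (le_trans (modulus_addle _ _)); rewrite lerD2l ler_wpM2l//.
    have := MP m (leq_maxr _ _) x xF; have := modulus_ge0 (u m x - L x).
    have d1 : d <= 1 by rewrite ge_min lexx.
    by move=> p q; rewrite expr2; nra.
  apply: (@le_trans _ _ (\sum_(x <- F) (2 * modulus ((u n - u m) x) ^+ 2 + 2 * d))).
    by rewrite big_seq [leRHS]big_seq; apply: ler_sum => x /h.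
  rewrite big_split -!mulr_sumr /=.
  have s1 := l2_sum_hnorm (u n - u m) F.
  have s2 : hnorm (u n - u m) ^+ 2 <= (e / 2) ^+ 2.
    have le1 : hnorm (u n - u m) <= e / 2 by apply: NP => //; exact: leq_maxl.
    by apply: lerXn2r le1; rewrite nnegrE ?hnorm_ge0// ltW// divr_gt0.
  have s3 : \sum_(x <- F) d <= e ^+ 2 / 4.
    rewrite big_const_seq count_predT iter_addr_0 -[d *+ _]mulr_natr.
    have q0 : 0 < #|` F|%:R + 1 :> R by rewrite ltr_wpDl.
    have dq : d * (#|` F|%:R + 1) <= e ^+ 2 / 4.
      rewrite -ler_pdivlMr// ge_min; apply/orP; right.
      by rewrite invfM mulrA.
    by apply: le_trans dq; rewrite mulrDr mulr1 lerDl ltW.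
  have E : (e / 2) ^+ 2 = e ^+ 2 / 4 by field.
  by rewrite E in s2; lra.
have [N NP] := key 1 ltr01.
have sL : square_summable L.
  exists (2 * hnorm (u N) ^+ 2 + 2) => F.
  apply: (@le_trans _ _ (\sum_(x <- F) (2 * modulus (u N x) ^+ 2 + 2 * modulus (u N x - L x) ^+ 2))).
    apply: ler_sum => x _.
    have -> : modulus (u N x - L x) = modulus (L x - u N x).
      by rewrite !modulusE; case: (L x) (u N x) => ? ? [? ?] /=; congr Num.sqrt; ring.
    have E : L x = u N x + (L x - u N x) by rewrite addrC subrK.
    by rewrite {1}E modulus_addle.
  rewrite big_split -!mulr_sumr /= lerD ?ler_wpM2l ?l2_sum_hnorm//.
  by have := NP N (leqnn N) F; rewrite expr1n; lra.
exists (L2 (introT (asboolP _) sL)) => e e0.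
have [K KP] := key e e0; exists K => n Kn; apply: l2_hnorm_le; first exact: ltW.
by move=> F; exact: KP.
Qed.

HB.instance Definition _ := isHilbert.Build R l2 l2_complete.

End L2.

Definition bounded_geometry (R : realType) (X : metricType R) : Prop :=
  forall r : R, 0 <= r ->
    exists N : nat, forall x : X, ([set y | mdist x y <= r] #<= `I_N)%card.

(* The zero matrix has propagation -oo. *)
Definition propagation (R : realType) (X : metricType R) (T : X -> X -> R[i]) : \bar R :=
  ereal_sup [set (mdist p.1 p.2)%:E | p in [set p : X * X | T p.1 p.2 != 0]].

Definition in_alg_roe (R : realType) (X : metricType R) (T : X -> X -> R[i]) : Prop :=
  (propagation T < +oo)%E /\
  exists M : R, forall x y : X, modulus (T x y) <= M.

(* [\sum_(y \in A)] is the sum over the finite support of the summand; for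
   bounded geometry the rows of a matrix of finite propagation are finite, so
   these are the usual matrix product and the usual action on columns. *)
Definition matrix_mul (R : realType) (X : metricType R) (S T : X -> X -> R[i])
  : X -> X -> R[i] :=
  fun x z => \sum_(y \in [set: X]) S x y * T y z.

Definition matrix_adj (R : realType) (X : metricType R) (T : X -> X -> R[i])
  : X -> X -> R[i] := fun x y => conjc (T y x).

Definition matrix_act (R : realType) (X : metricType R) (T : X -> X -> R[i])
  (u : X -> R[i]) : X -> R[i] :=
  fun x => \sum_(y \in [set: X]) T x y * u y.

Lemma modulus0 (R : rcfType) : modulus (0 : R[i]) = 0.
Proof. by rewrite modulusE /= expr0n addr0 sqrtr0. Qed.

Lemma modulusM (R : rcfType) (a b : R[i]) : modulus (a * b) = modulus a * modulus b.
Proof.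
rewrite /modulus normrM; move: (ger0_Im (normr_ge0 a)) (ger0_Im (normr_ge0 b)).
by case: (`|a|) (`|b|) => x y [z w] /= -> ->; rewrite mulr0 subr0.
Qed.

Lemma modulusD (R : rcfType) (a b : R[i]) : modulus (a + b) <= modulus a + modulus b.
Proof.
have := ler_normD a b; rewrite /modulus lecE => /andP[_].
by case: (`|a|) (`|b|) => x y [].
Qed.

Lemma modulus_sum (R : rcfType) (I : Type) (r : seq I) (f : I -> R[i]) :
  modulus (\sum_(i <- r) f i) <= \sum_(i <- r) modulus (f i).
Proof.
elim: r => [|i r ih]; first by rewrite !big_nil modulus0.
by rewrite !big_cons (le_trans (modulusD _ _))// lerD2l.
Qed.

Lemma modulus_conj (R : rcfType) (a : R[i]) : modulus (conjc a) = modulus a.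
Proof. by rewrite !modulusE; case: a => ? ? /=; rewrite sqrrN. Qed.

Lemma sum_sqr_le (R : realDomainType) (I : Type) (r : seq I) (a : I -> R) :
  (\sum_(i <- r) a i) ^+ 2 <= (size r)%:R * \sum_(i <- r) a i ^+ 2.
Proof.
elim: r => [|i r ih]; first by rewrite !big_nil expr0n mulr0.
rewrite !big_cons /=.
set S := \sum_(j <- r) a j in ih *; set Q := \sum_(j <- r) a j ^+ 2 in ih *.
have h : 2 * a i * S <= (size r)%:R * a i ^+ 2 + Q.
  rewrite /S /Q mulr_sumr.
  have -> : (size r)%:R * a i ^+ 2 = \sum_(j <- r) a i ^+ 2.
    by rewrite big_const_seq count_predT iter_addr_0 mulr_natl.
  rewrite -big_split; apply: ler_sum => j _ /=.
  by have := sqr_ge0 (a i - a j); nra.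
by rewrite -natr1; nra.
Qed.

Section FinitePropagation.
Context {R : realType} {X : metricType R}.
Implicit Types (S T : X -> X -> R[i]) (x y z : X).

Lemma propagationP T : (propagation T < +oo)%E <->
  exists2 r : R, 0 <= r & forall x y, T x y != 0 -> mdist x y <= r.
Proof.
split=> [|[r r0 rT]].
  have ub x y : T x y != 0 -> ((mdist x y)%:E <= propagation T)%E.
    by move=> Txy; apply: ereal_sup_ubound; exists (x, y).
  case: (propagation T) ub => [r| |] // ub _.
    exists (Num.max 0 r) => [|x y /ub]; first by rewrite le_max lexx.
    by rewrite lee_fin le_max => ->; rewrite orbT.
  by exists 0 => // x y /ub.
apply: (@le_lt_trans _ _ r%:E); last exact: ltry.
by apply: ge_ereal_sup => _ [p /= pT <-]; rewrite lee_fin rT.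
Qed.

Lemma in_alg_roe_lin (k : R[i]) S T : in_alg_roe S -> in_alg_roe T -> in_alg_roe (k *: S + T).
Proof.
move=> [/propagationP[r r0 rS] [M SM]] [/propagationP[s s0 sT] [N TN]]; split.
  apply/propagationP; exists (r + s) => [|x y]; first exact: addr_ge0.
  rewrite !fctE; have [->|/rS xr _] := eqVneq (S x y) 0.
    by rewrite scaler0 add0r => /sT; lra.
  by lra.
exists (modulus k * M + N) => x y; rewrite !fctE.
apply: (le_trans (modulusD _ _)); rewrite lerD//.
by rewrite [modulus (_ *: _)]modulusM ler_wpM2l ?modulus_ge0.
Qed.

Lemma in_alg_roe0 : in_alg_roe (0 : X -> X -> R[i]).
Proof.
split; first by apply/propagationP; exists 0 => // x y /eqP.
by exists 0 => x y; rewrite -[(0 : X -> X -> R[i]) x y]/(0 : R[i]) modulus0.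
Qed.

Lemma in_alg_roe_adj T : in_alg_roe T -> in_alg_roe (matrix_adj T).
Proof.
move=> [/propagationP[r r0 rT] [M TM]]; split.
  apply/propagationP; exists r => // x y; rewrite /matrix_adj conjc_eq0 => /rT.
  by rewrite metric_sym.
by exists M => x y; rewrite /matrix_adj modulus_conj.
Qed.

Hypothesis hX : bounded_geometry X.

Lemma bounded_geometry_balls (r : R) : 0 <= r ->
  exists2 B : X -> {fset X}, (forall x y, (y \in B x) = (mdist x y <= r)) &
    exists N : nat, forall x, (#|` B x| <= N)%N.
Proof.
move=> r0; have [N NP] := hX r0.
have fin x : finite_set [set y | mdist x y <= r].
  by apply: card_le_finite (NP x) _; exact: finite_II.
exists (fun x => fset_set [set y | mdist x y <= r]).
  by move=> x y; rewrite in_fset_set//; apply/idP/idP; rewrite inE.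
by exists N => x; apply: geq_card_fset_set.
Qed.

Lemma in_alg_roe_rows T : in_alg_roe T ->
  exists2 B : X -> {fset X}, (forall x y, (y \in B x) = (x \in B y)) &
    exists2 N : nat, (forall x, (#|` B x| <= N)%N) &
      forall x y, y \notin B x -> T x y = 0.
Proof.
move=> [/propagationP[r r0 rT] _].
have [B BP [N BN]] := bounded_geometry_balls r0.
exists B; first by move=> x y; rewrite !BP metric_sym.
exists N => // x y yB; apply/eqP; apply: contraNT yB => /rT.
by rewrite BP.
Qed.

Lemma fsum_assoc (f h : X -> R[i]) (g : X -> X -> R[i]) (B C : {fset X}) :
  (forall y, y \notin B -> f y = 0) ->
  (forall y z, y \in B -> z \notin C -> g y z = 0) ->
  \sum_(z \in [set: X]) (\sum_(y \in [set: X]) f y * g y z) * h z =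
  \sum_(y \in [set: X]) f y * (\sum_(z \in [set: X]) g y z * h z).
Proof.
move=> fB gC.
have E z : \sum_(y \in [set: X]) f y * g y z = \sum_(y <- B) f y * g y z.
  by rewrite (fsbigTE B)// => y /fB ->; rewrite mul0r.
rewrite (fsbigTE C) => [|z zC]; last first.
  by rewrite E big_seq big1 ?mul0r// => y yB; rewrite gC// mulr0.
rewrite (fsbigTE B) => [|y /fB ->]; last by rewrite mul0r.
under eq_bigr do rewrite E mulr_suml.
rewrite exchange_big /= big_seq [RHS]big_seq; apply: eq_bigr => y yB.
rewrite (fsbigTE C) => [|z zC]; last by rewrite gC// mul0r.
by rewrite mulr_sumr; apply: eq_bigr => z _; rewrite mulrA.
Qed.

Definition rowsU (B : X -> {fset X}) (F : {fset X}) : {fset X} :=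
  (\bigcup_(y <- F) B y)%fset.

Lemma rowsUP (B : X -> {fset X}) (F : {fset X}) y z :
  y \in F -> z \notin rowsU B F -> z \notin B y.
Proof. by move=> yF; apply: contra => zB; apply/bigfcupP; exists y; rewrite ?yF. Qed.

Lemma matrix_mulA_roe S T U : in_alg_roe S -> in_alg_roe T ->
  matrix_mul (matrix_mul S T) U = matrix_mul S (matrix_mul T U).
Proof.
move=> /in_alg_roe_rows[B _ [N _ BS]] /in_alg_roe_rows[C _ [N' _ CT]].
apply/funext => x; apply/funext => w; rewrite /matrix_mul.
apply: (@fsum_assoc _ _ _ (B x) (rowsU C (B x))) => [y /BS//|y z yB zC].
exact/CT/(rowsUP yB zC).
Qed.

Lemma matrix_act_mul S T u : in_alg_roe S -> in_alg_roe T ->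
  matrix_act (matrix_mul S T) u = matrix_act S (matrix_act T u).
Proof.
move=> /in_alg_roe_rows[B _ [N _ BS]] /in_alg_roe_rows[C _ [N' _ CT]].
apply/funext => x; rewrite /matrix_act /matrix_mul.
apply: (@fsum_assoc _ _ _ (B x) (rowsU C (B x))) => [y /BS//|y z yB zC].
exact/CT/(rowsUP yB zC).
Qed.

Lemma in_alg_roe_mul S T : in_alg_roe S -> in_alg_roe T -> in_alg_roe (matrix_mul S T).
Proof.
move=> aS aT; have [B _ [K BK BS]] := in_alg_roe_rows aS.
have [/propagationP[r r0 rS] [M SM]] := aS; have [/propagationP[s s0 sT] [N TN]] := aT.
split.
  apply/propagationP; exists (r + s) => [|x z]; first exact: addr_ge0.
  move=> ne; apply: contraNT ne => xz; rewrite /matrix_mul fsbig1// => y _.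
  have [->|/rS xy] := eqVneq (S x y) 0; first by rewrite mul0r.
  have [->|/sT yz] := eqVneq (T y z) 0; first by rewrite mulr0.
  by case/negP: xz; rewrite (le_trans (metric_triangle x y z))// lerD.
exists (K%:R * (`|M| * `|N|)) => x z.
rewrite /matrix_mul (fsbigTE (B x)) => [|y /BS ->]; last by rewrite mul0r.
apply: (le_trans (modulus_sum _ _)).
apply: (@le_trans _ _ (\sum_(y <- B x) `|M| * `|N|)).
  apply: ler_sum => y _; rewrite modulusM ler_pM ?modulus_ge0//.
    exact: le_trans (SM x y) (ler_norm _).
  exact: le_trans (TN y z) (ler_norm _).
rewrite big_const_seq count_predT iter_addr_0 -[_ *+ size _]mulr_natl.
by rewrite ler_wpM2r ?mulr_ge0// ler_nat BK.
Qed.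

Lemma matrix_act_bound T : in_alg_roe T -> exists2 C : R, 0 <= C &
  forall (u : X -> R[i]) (F : {fset X}), exists G : {fset X},
    \sum_(x <- F) modulus (matrix_act T u x) ^+ 2 <=
    C ^+ 2 * \sum_(y <- G) modulus (u y) ^+ 2.
Proof.
move=> aT; have [B Bsym [N BN BT]] := in_alg_roe_rows aT; have [_ [M TM]] := aT.
exists (N%:R * `|M|) => [|u F]; first by rewrite mulr_ge0.
exists (rowsU B F).
pose c := N%:R * M ^+ 2.
have c0 : 0 <= c by rewrite mulr_ge0 ?sqr_ge0.
have row x : modulus (matrix_act T u x) ^+ 2 <= c * \sum_(y <- B x) modulus (u y) ^+ 2.
  rewrite /matrix_act (fsbigTE (B x)) => [|y /BT ->]; last by rewrite mul0r.
  apply: (@le_trans _ _ ((\sum_(y <- B x) modulus (T x y * u y)) ^+ 2)).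
    by rewrite lerXn2r ?nnegrE ?modulus_ge0 ?sumr_ge0 ?modulus_sum// => ? _; exact: modulus_ge0.
  apply: (le_trans (sum_sqr_le _ _)); rewrite /c -mulrA.
  apply: ler_pM; [by []|by apply: sumr_ge0 => ? _; exact: sqr_ge0|by rewrite ler_nat BN|].
  rewrite mulr_sumr; apply: ler_sum => y _; rewrite modulusM exprMn ler_wpM2r ?sqr_ge0//.
  rewrite -[M ^+ 2]real_normK ?num_real// lerXn2r ?nnegrE ?modulus_ge0//.
  exact: le_trans (TM x y) (ler_norm _).
apply: (le_trans (ler_sum _ (fun x _ => row x))).
rewrite -mulr_sumr.
have -> : (N%:R * `|M|) ^+ 2 = c * N%:R.
  by rewrite exprMn real_normK ?num_real// /c; ring.
rewrite -mulrA ler_wpM2l//.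
have E x : x \in F -> \sum_(y <- B x) modulus (u y) ^+ 2 =
    \sum_(y <- rowsU B F) (if y \in B x then modulus (u y) ^+ 2 else 0).
  move=> xF; rewrite -big_mkcond -big_filter; apply: perm_big.
  apply: uniq_perm; rewrite ?filter_uniq ?fset_uniq// => y.
  rewrite mem_filter; case yB: (y \in B x) => //=.
  by apply/esym/bigfcupP; exists x; rewrite ?xF.
rewrite big_seq (eq_bigr _ E) -big_seq exchange_big /= mulr_sumr.
apply: ler_sum => y _.
under eq_bigr do rewrite Bsym.
rewrite -big_mkcond -big_filter big_const_seq count_predT iter_addr_0 -[_ *+ size _]mulr_natl.
rewrite ler_wpM2r ?sqr_ge0// ler_nat; apply: leq_trans (BN y).
apply: uniq_leq_size; first by rewrite filter_uniq ?fset_uniq.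
by move=> x; rewrite mem_filter => /andP[].
Qed.

End FinitePropagation.

Definition alg_roe_pred (R : realType) (X : metricType R) : pred (X -> X -> R[i]) :=
  fun T => `[< in_alg_roe T >].

Lemma alg_roe_submod (R : realType) (X : metricType R) :
  submod_closed (@alg_roe_pred R X).
Proof.
split; first by apply/asboolP; exact: in_alg_roe0.
by move=> k S T /asboolP aS /asboolP aT; apply/asboolP; exact: in_alg_roe_lin.
Qed.

HB.instance Definition _ (R : realType) (X : metricType R) :=
  GRing.isSubmodClosed.Build R[i] (X -> X -> R[i]) (@alg_roe_pred R X)
    (@alg_roe_submod R X).

(* The hypothesis [hX] is a parameter because the product of two finite
   propagation matrices need not make sense without it. *)
Record alg_uniform_roe (R : realType) (X : metricType R) (hX : bounded_geometry X) :=
  AlgUniformRoe {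
    roe_matrix :> X -> X -> R[i];
    roe_matrixP : roe_matrix \in @alg_roe_pred R X
  }.

Section AlgUniformRoe.
Context {R : realType} {X : metricType R} (hX : bounded_geometry X).
Local Notation Cu := (alg_uniform_roe hX).

HB.instance Definition _ := [isSub for @roe_matrix R X hX].
HB.instance Definition _ := [Choice of Cu by <:].
HB.instance Definition _ := [SubChoice_isSubLmodule of Cu by <:].

Implicit Types S T U : Cu.

Lemma roeP T : in_alg_roe (T : X -> X -> R[i]).
Proof. exact/asboolP/roe_matrixP. Qed.

Definition MkRoe (T : X -> X -> R[i]) (aT : in_alg_roe T) : Cu :=
  AlgUniformRoe hX (introT (asboolP _) aT).

Lemma roe_inj S T : (S : X -> X -> R[i]) = T -> S = T.
Proof. exact: val_inj. Qed.

Definition roe_mul S T : Cu := MkRoe (in_alg_roe_mul hX (roeP S) (roeP T)).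
Definition roe_star T : Cu := MkRoe (in_alg_roe_adj (roeP T)).

Fact roe_mulA : associative roe_mul.
Proof.
move=> S T U; apply: roe_inj => /=.
by rewrite (matrix_mulA_roe hX _ (roeP S) (roeP T)).
Qed.
Fact roe_mulDr : right_distributive roe_mul +%R.
Proof.
move=> S T U; apply: roe_inj; apply/funext => x; apply/funext => z /=.
have [B _ [N _ BS]] := in_alg_roe_rows hX (roeP S).
rewrite !fctE /matrix_mul !(fsbigTE (B x)); try by move=> y /BS ->; rewrite mul0r.
by rewrite -big_split; apply: eq_bigr => y _; rewrite !fctE mulrDr.
Qed.
Fact roe_mulZr (k : R[i]) S T : roe_mul S (k *: T) = k *: roe_mul S T.
Proof.
apply: roe_inj; apply/funext => x; apply/funext => z /=.
have [B _ [N _ BS]] := in_alg_roe_rows hX (roeP S).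
rewrite !fctE /matrix_mul !(fsbigTE (B x)); try by move=> y /BS ->; rewrite mul0r.
by rewrite [RHS]mulr_sumr; apply: eq_bigr => y _; rewrite !fctE mulrCA.
Qed.
Fact roe_starK : involutive roe_star.
Proof.
move=> T; apply: roe_inj; apply/funext => x; apply/funext => y /=.
by rewrite /matrix_adj conjcK.
Qed.
Fact roe_starD : {morph roe_star : S T / S + T}.
Proof.
move=> S T; apply: roe_inj; apply/funext => x; apply/funext => y /=.
by rewrite /matrix_adj !fctE rmorphD.
Qed.
Fact roe_starZ (k : R[i]) T : roe_star (k *: T) = conjc k *: roe_star T.
Proof.
apply: roe_inj; apply/funext => x; apply/funext => y /=.
rewrite /matrix_adj !fctE; exact: rmorphM.
Qed.
Fact roe_starM S T : roe_star (roe_mul S T) = roe_mul (roe_star T) (roe_star S).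
Proof.
apply: roe_inj; apply/funext => x; apply/funext => z /=.
have [B Bs [N _ BS]] := in_alg_roe_rows hX (roeP S).
rewrite /matrix_adj /matrix_mul !(fsbigTE (B z)).
- by rewrite rmorph_sum; apply: eq_bigr => y _; rewrite rmorphM /= mulrC.
- by move=> y /BS ->; rewrite conjc0 mulr0.
- by move=> y /BS ->; rewrite mul0r.
Qed.
Fact roe_mulDl : left_distributive roe_mul +%R.
Proof.
move=> S T U; apply: (can_inj roe_starK).
by rewrite roe_starM !roe_starD roe_mulDr !roe_starM.
Qed.
Fact roe_mulZl (k : R[i]) S T : roe_mul (k *: S) T = k *: roe_mul S T.
Proof.
apply: (can_inj roe_starK).
by rewrite roe_starM !roe_starZ roe_mulZr roe_starM.
Qed.

HB.instance Definition _ := isStarAlgebra.Build R Cu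
  roe_mulA roe_mulDl roe_mulDr roe_mulZl roe_mulZr
  roe_starK roe_starD roe_starZ roe_starM.

Lemma act_square_summable T (u : l2 R X) :
  matrix_act T u \in @square_summable_pred R X.
Proof.
apply/asboolP; have [C C0 CT] := matrix_act_bound hX (roeP T).
exists (C ^+ 2 * hnorm u ^+ 2) => F; have [G FG] := CT u F.
apply: (le_trans FG); rewrite ler_wpM2l ?sqr_ge0//; exact: l2_sum_hnorm.
Qed.

Definition roe_op T (u : l2 R X) : l2 R X := L2 (act_square_summable T u).

Lemma roe_op_linear T : linear (roe_op T).
Proof.
move=> k u v; apply: val_inj; apply/funext => x /=.
have [B _ [N _ BT]] := in_alg_roe_rows hX (roeP T).
rewrite !fctE /matrix_act !(fsbigTE (B x)); try by move=> y /BT ->; rewrite mul0r.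
rewrite [k *: _]mulr_sumr -big_split; apply: eq_bigr => y _.
by rewrite -[k *: u y]/(k * u y) mulrDr mulrCA.
Qed.

Lemma roe_op_bounded T : bounded_linear (roe_op T).
Proof.
split; first exact: roe_op_linear.
have [C C0 CT] := matrix_act_bound hX (roeP T); exists C => u.
apply: l2_hnorm_le; first by rewrite mulr_ge0 ?hnorm_ge0.
move=> F; have [G FG] := CT u F; apply: (le_trans FG).
by rewrite exprMn ler_wpM2l ?sqr_ge0 ?l2_sum_hnorm.
Qed.

Lemma roe_op_lin (k : R[i]) S T : roe_op (k *: S + T) = k *: roe_op S + roe_op T.
Proof.
apply/funext => u; apply: val_inj; apply/funext => x /=.
have [B _ [N _ BS]] := in_alg_roe_rows hX (roeP S).
have [C _ [N' _ CT]] := in_alg_roe_rows hX (roeP T).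
have inl y : y \notin (B x `|` C x)%fset -> S x y = 0.
  by rewrite in_fsetU negb_or => /andP[/BS].
have inr y : y \notin (B x `|` C x)%fset -> T x y = 0.
  by rewrite in_fsetU negb_or => /andP[_ /CT].
rewrite !fctE /matrix_act !(fsbigTE (B x `|` C x)%fset).
- rewrite [X in _ = X + _]mulr_sumr -big_split; apply: eq_bigr => y _ /=.
  by rewrite -[(k *: S x + T x) y]/(k * S x y + T x y) mulrDl mulrA.
- by move=> y /inr ->; rewrite mul0r.
- by move=> y /inl ->; rewrite mul0r.
- move=> y yN; rewrite -[(k *: S x + T x) y]/(k * S x y + T x y).
  by rewrite inl// inr// mulr0 addr0 mul0r.
Qed.

Lemma roe_op0 : roe_op 0 = 0.
Proof.
apply/funext => u; apply: val_inj; apply/funext => x /=.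
by rewrite /matrix_act fsbig1// => y _; exact: mul0r.
Qed.

Lemma roe_op_mul S T : roe_op (smul S T) = roe_op S \o roe_op T.
Proof.
apply/funext => u; apply: val_inj => /=.
exact: (matrix_act_mul hX _ (roeP S) (roeP T)).
Qed.

Lemma l2_dense (u : l2 R X) (e : R) : 0 < e -> exists (F : {fset X}) (w : l2 R X),
  (forall x, x \notin F -> w x = 0) /\ hnorm (u - w) <= e.
Proof.
move=> e0; have /cvgrPdist_le /(_ (e ^+ 2) (exprn_gt0 2 e0)) [F _ FP] := @l2_dot_Re R X u.
pose w x := if x \in F then u x else 0.
have sw : square_summable w.
  exists (hnorm u ^+ 2) => G; apply: le_trans (l2_sum_hnorm u G).
  apply: ler_sum => x _; rewrite /w; case: ifP => // _.
  by rewrite modulus0 expr0n sqr_ge0.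
exists F, (L2 (introT (asboolP _) sw)); split=> [x /negbTE xF|].
  by rewrite /= /w xF.
apply: l2_hnorm_le; first exact: ltW.
move=> G.
have := l2_sum_hnorm u (F `|` G)%fset; rewrite hnorm_sqr.
have := FP F (fsubset_refl F); rewrite psumE.
have -> : \sum_(x <- G) modulus ((u - L2 (introT (asboolP _) sw)) x) ^+ 2 =
   \sum_(x <- (G `\` F)%fset) modulus (u x) ^+ 2.
  rewrite (big_fsetID _ (mem F) G) /= [X in X + _]big_seq [X in X + _]big1 ?add0r.
    have -> : [fset x in G | x \notin F]%fset = (G `\` F)%fset.
      by apply/fsetP => x; rewrite !inE /= andbC.
    rewrite big_seq [RHS]big_seq; apply: eq_bigr => x; rewrite in_fsetD => /andP[/negbTE xF _].
    by rewrite !fctE /= /w xF subr0.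
  move=> x; rewrite !inE /= => /andP[_ xF].
  by rewrite !fctE /= /w xF subrr modulus0 expr0n.
have -> : \sum_(x <- (F `|` G)%fset) modulus (u x) ^+ 2 =
    \sum_(x <- F) modulus (u x) ^+ 2 + \sum_(x <- (G `\` F)%fset) modulus (u x) ^+ 2.
  rewrite (big_fsetID _ (mem F)) /=; congr (_ + _); apply: congr_big => //.
    by congr enum_fset; apply/fsetP => x; rewrite !inE /=; case: (x \in F); rewrite ?andbF.
  by congr enum_fset; apply/fsetP => x; rewrite !inE /=; case: (x \in F); rewrite ?andbF ?andbT.
by move=> /(le_trans (ler_norm _)); lra.
Qed.

Lemma l2_dot_fin (u v : l2 R X) (F : {fset X}) : (forall x, x \notin F -> u x = 0) ->
  dot u v = \sum_(x <- F) u x * conjc (v x).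
Proof.
by move=> uF; apply/has_csumE/has_csum_fin => x /uF ->; rewrite mul0r.
Qed.

Lemma roe_op_adj_fin T (w v : l2 R X) (F : {fset X}) :
  (forall x, x \notin F -> w x = 0) -> dot (roe_op T w) v = dot w (roe_op (star T) v).
Proof.
move=> wF; have [B Bs [N _ BT]] := in_alg_roe_rows hX (roeP T).
have E x : roe_op T w x = \sum_(y <- F) T x y * w y.
  by apply: fsbigTE => y /wF ->; rewrite mulr0.
rewrite (l2_dot_fin _ wF) (@l2_dot_fin _ _ (rowsU B F)) => [|x xF]; last first.
  by rewrite E big_seq big1// => y /rowsUP/(_ xF); rewrite -Bs => /BT ->; rewrite mul0r.
under eq_bigr do rewrite E mulr_suml.
rewrite exchange_big /= big_seq [RHS]big_seq; apply: eq_bigr => y yF.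
have -> : matrix_act (matrix_adj T) v y = \sum_(x <- rowsU B F) conjc (T x y) * v x.
  apply: fsbigTE => x /(rowsUP yF); rewrite -Bs => /BT; rewrite /matrix_adj => ->.
  by rewrite conjc0 mul0r.
rewrite rmorph_sum mulr_sumr; apply: eq_bigr => x _ /=.
by rewrite rmorphM /= conjcK mulrCA mulrA.
Qed.

Lemma roe_op_adj T : adjoint_of (roe_op T) (roe_op (star T)).
Proof.
apply: adjoint_Re => [|u v]; first exact: roe_op_linear.
have bT := roe_op_bounded T.
pose C := opnorm (roe_op T) * hnorm v + hnorm (roe_op (star T) v).
apply: (@le_eps_pos _ _ _ C) => [|e e0].
  by rewrite addr_ge0 ?mulr_ge0 ?hnorm_ge0 ?opnorm_ge0.
have [F [w [wF uw]]] := l2_dense u e0.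
have E := roe_op_adj_fin T v wF.
have -> : u = (u - w) + w by rewrite subrK.
move: (u - w) uw => d dw.
rewrite (linearD' _ _ bT.1) !dotDl E.
have RD (a b : R[i]) : complex.Re (a + b) = complex.Re a + complex.Re b.
  by case: a b => ? ? [].
rewrite !RD.
have h1 := CauchySchwarz_Re (roe_op T d) v.
have h2 := CauchySchwarz_Re (- d) (roe_op (star T) v).
rewrite dotNl hnormN in h2.
have h3 : hnorm (roe_op T d) * hnorm v <= opnorm (roe_op T) * e * hnorm v.
  rewrite ler_wpM2r ?hnorm_ge0// (le_trans (opnormP _ bT))//.
  by rewrite ler_wpM2l ?opnorm_ge0.
have h4 : hnorm d * hnorm (roe_op (star T) v) <= e * hnorm (roe_op (star T) v).
  by rewrite ler_wpM2r ?hnorm_ge0.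
have h5 : complex.Re (- dot d (roe_op (star T) v)) = - complex.Re (dot d (roe_op (star T) v)).
  by case: (dot _ _).
rewrite h5 in h2; rewrite /C; lra.
Qed.

Definition roe_operators : star_subalgebra (l2 R X).
Proof.
refine (@StarSubalgebra R (l2 R X) (range roe_op) _ _ _ _ _).
- by move=> _ [T _ <-]; exact: roe_op_bounded.
- by exists 0 => //; exact: roe_op0.
- by move=> k _ _ [S _ <-] [T _ <-]; exists (k *: S + T) => //; exact: roe_op_lin.
- by move=> _ _ [S _ <-] [T _ <-]; exists (smul S T) => //; exact: roe_op_mul.
- by move=> _ [T _ <-]; exists (roe_op (star T)); [exists (star T)|exact: roe_op_adj].
Defined.

(* The completion of C_u[X] for the operator norm, realized as the closure of
   its image in the bounded operators on l^2(X). *)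
Definition uniform_roe : cstarAlgType R := opclosure roe_operators.

End AlgUniformRoe.

Section CoarseGeometry.
Context {R : realType}.
Implicit Types X Y : metricType R.

Definition uniformly_expansive X Y (f : X -> Y) : Prop :=
  forall r : R, 0 < r -> exists2 s : R, 0 < s &
    forall x1 x2, mdist x1 x2 <= r -> mdist (f x1) (f x2) <= s.

Definition close (X : Type) Y (f g : X -> Y) : Prop :=
  exists2 C : R, 0 < C & forall x, mdist (f x) (g x) <= C.

Definition coarsely_equivalent X Y : Prop :=
  exists (f : X -> Y) (g : Y -> X),
    [/\ uniformly_expansive f, uniformly_expansive g,
        close (f \o g) id & close (g \o f) id].

(* [x / 0 = 0] in the library, whereas an empty intersection has to make the
   quotient infinite, hence the explicit non-emptiness. *)
Definition property_A X : Prop :=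
  forall r e : R, 0 < r -> 0 < e -> exists A : X -> {fset X * nat},
    [/\ forall x, (x, 1%N) \in A x,
        forall x x', mdist x x' <= r -> (A x `&` A x' != fset0)%fset /\
          (#|` (A x `\` A x') `|` (A x' `\` A x)|%fset)%:R /
          (#|` A x `&` A x'|%fset)%:R < e &
        exists2 s : R, 0 < s & forall x y z (m n : nat),
          (y, m) \in A x -> (z, n) \in A x -> mdist y z <= s].

End CoarseGeometry.

(* Main.v *)
(** Both parts reduce to one statement about an equivalence bimodule E between
    two *-algebras A, B of operators on l^2(X), l^2(Y) that contain the matrix
    units e_xx', f_yy'; an isomorphism gives such a bimodule, namely E = B.
    Cutting E by e_x0 and f_y0 yields a vector u with <u,u>_A = e_x0 and
    <u,u>_B = f_y0, and e_x0 E f_y0 = C u. Hence every z in E has matrix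
    coefficients z_xy, given by e_x0x z f_yy0 = z_xy u, and the inner products
    are z' z^* and z'^* z for these matrices.

    For a 0-1 matrix v of finite propagation, z'^* v z is an element of B, so it
    is (almost) of finite propagation, whatever the support of v. A gliding hump
    makes this uniform: the operators z'^* e_x'x z with d(x,x') <= r are
    approximable by operators of finite propagation uniformly in x and x'.
    Therefore the relation |z_xy| >= delta between x and y, with z in a finite
    set, is coarse in both directions. It remains to see that every x is related
    to some y, and conversely. Fullness bounds the norm of the row of x from below
    for some z. If B is an algebraic Roe algebra then the supports of the rows have
    uniformly bounded diameter, by the same hump argument; under property A the
    Schur multipliers attached to the sets A_y show that a definite part of the
    mass of each row lies in a ball of fixed radius. In both cases one entry of
    the row is bounded below. *)
Require Import Defs.
From mathcomp Require Import all_boot all_order all_algebra finmap.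
From mathcomp Require Import complex.
From mathcomp Require Import mathcomp_extra boolp classical_sets functions cardinality fsbigop.
From mathcomp Require Import reals metric_structure.
From mathcomp Require Import ring lra.
Set Implicit Arguments.
Unset Strict Implicit.
Unset Printing Implicit Defensive.
Import Order.TTheory GRing.Theory Num.Theory.
Local Open Scope classical_set_scope.
Local Open Scope ring_scope.
Local Open Scope complex_scope.

(** * Gliding hump *)

Section GlidingHump.
Context {R : realType}.

Definition null_seq (u : nat -> R[i]) : Prop :=
  forall e : R, 0 < e -> exists N, forall n, (N <= n)%N -> modulus (u n) <= e.

(** Each [g n] is a finitely additive complex measure on all subsets of [P], nearly carried by a
    finite set. In the spirit of the Vitali-Hahn-Saks theorem, setwise convergence to 0 becomes
    uniform over points. *)
Context (P : choiceType) (g : nat -> set P -> R[i]).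
Hypothesis g_add : forall n (S T : set P), [disjoint S & T] ->
  g n (S `|` T) = g n S + g n T.
Hypothesis g_tail : forall n (e : R), 0 < e -> exists F : {fset P},
  forall S : set P, (forall p, S p -> p \notin F) -> modulus (g n S) <= e.
Hypothesis g_null : forall S : set P, null_seq (g ^~ S).

(** A finite set has finitely many subsets, so the largest of their thresholds serves all of
    them. *)
Let g_null_fin (F : {fset P}) (e : R) : 0 < e -> exists N, forall n, (N <= n)%N ->
  forall S : set P, (forall p, S p -> p \in F) -> modulus (g n S) <= e.
Proof.
move=> e0; have [N NP] := choice (fun T : {fset P} => g_null [set` T] e0).
exists (\max_(T <- fpowerset F) N T)%N => n Nn S SF.
pose T := [fset x in F | `[< S x >]]%fset.
have -> : S = [set` T].
  apply/seteqP; split=> p /=; rewrite !inE /= => h.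
    by rewrite SF//=; apply/asboolP.
  by case/andP: h => _ /asboolP.
apply/NP/(leq_trans _ Nn); apply: leq_bigmax_seq => //.
by rewrite fpowersetE; apply/fsubsetP => p; rewrite !inE => /andP[].
Qed.

(* Inductively pick n_k, p_k and finite F_k such that g n_k is large at p_k in
   F_k, but small on all subsets of F_(k-1) and on all sets avoiding F_k; then
   g n_k is large on the set of all p_k. *)
Lemma gliding_hump (e : R) : 0 < e ->
  exists N, forall n, (N <= n)%N -> forall p, modulus (g n [set p]) <= e.
Proof.
move=> e0; apply/not_existsP => bad.
have e4 : 0 < e / 4 by rewrite divr_gt0.
(* The state [c] is the pair of [F_(k-1)] and [n_(k-1)]; the successor [d] consists of [F_k], [n_k]
   and the new point [p_k]. *)
have step (c : {fset P} * nat) : exists d : {fset P} * nat * P,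
    [/\ (c.1 `<=` d.1.1)%fset, (c.2 < d.1.2)%N & d.2 \in d.1.1] /\
    [/\ d.2 \notin c.1, e < modulus (g d.1.2 [set d.2]),
     forall S : set P, (forall p, S p -> p \in c.1) -> modulus (g d.1.2 S) <= e / 4
     & forall S : set P, (forall p, S p -> p \notin d.1.1) -> modulus (g d.1.2 S) <= e / 4].
  case: c => F N /=; have [M MP] := g_null_fin F e4.
  have /existsNP[n /not_implyP[Mn /existsNP[p /negP]]] := bad (maxn N.+1 M).
  rewrite -ltNge => ep; have [F' F'P] := g_tail n e4.
  rewrite geq_max in Mn; have /andP[Nn Mn'] := Mn.
  exists (F `|` (p |` F'), n, p)%fset => /=; split; split.
  - exact: fsubsetUl.
  - exact: Nn.
  - by rewrite !inE eqxx orbT.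
  - apply/negP => pF.
    have h : modulus (g n [set p]) <= e / 4 by apply: MP => // q ->.
    by move: ep; rewrite ltNge (le_trans h)// ler_pdivrMr// ler_pMr// ler1n.
  - exact: ep.
  - by move=> S SF; apply: MP.
  - move=> S SF; apply: F'P => q /SF; apply: contra => qF.
    by rewrite !inE qF !orbT.
have [nx nxP] := choice step.
pose c k := iter k (fun c => (nx c).1) (fset0, 0%N) : {fset P} * nat.
pose p k := (nx (c k)).2.
have cP k : [/\ ((c k).1 `<=` (c k.+1).1)%fset, ((c k).2 < (c k.+1).2)%N & p k \in (c k.+1).1].
  by have [h _] := nxP (c k).
have pP k : [/\ p k \notin (c k).1, e < modulus (g (c k.+1).2 [set p k]),
     forall S : set P, (forall p, S p -> p \in (c k).1) -> modulus (g (c k.+1).2 S) <= e / 4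
     & forall S : set P, (forall p, S p -> p \notin (c k.+1).1) -> modulus (g (c k.+1).2 S) <= e / 4].
  by have [_ h] := nxP (c k).
have cmono j k : (j <= k)%N -> ((c j).1 `<=` (c k).1)%fset.
  move=> /subnK <-; elim: (k - j)%N => // i ih.
  by apply: (fsubset_trans ih); have [] := cP (i + j)%N.
have pin j k : (j < k)%N -> p j \in (c k).1.
  by move=> /cmono/fsubsetP; apply; have [] := cP j.
have pout j k : (k <= j)%N -> p j \notin (c k).1.
  move=> /cmono/fsubsetP h; apply/negP => /h; apply/negP.
  by have [] := pP j.
pose S : set P := range p.
have c2 k : (k <= (c k).2)%N.
  by elim: k => // k ih; apply: (leq_ltn_trans ih); have [] := cP k.
have [N NP] := g_null S e4.
(* The indices grow at least like [k], so the measure chosen at stage [N] is late enough to be small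
   on [S]. *)
have {NP} := NP (c N.+1).2 (ltnW (leq_trans (ltnSn N) (c2 _))).
have [_ big inF outF] := pP N.
(* Points chosen before and after stage [N]. The measure of this stage is at most [e / 4] on [S1],
   on [S3] and on all of [S], hence at most [3 * e / 4] at [p N], against the choice of [p N]. *)
pose S1 := p @` [set j | (j < N)%N]; pose S3 := p @` [set j | (N < j)%N].
have -> : S = S1 `|` ([set p N] `|` S3).
  apply/seteqP; split=> [_ [j _ <-]|q].
    case: (ltngtP j N) => jN; [by left; exists j|by right; right; exists j|].
    by right; left; rewrite jN.
  by move=> [[j _ <-]|[->|[j _ <-]]]; [exists j|exists N|exists j].
have D1 : [disjoint S1 & [set p N] `|` S3].
  apply/disj_setPS => q [[j /= jN <-] []].
    by move=> /= E; have := pin _ _ jN; rewrite E; apply/negP; apply: pout.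
  by move=> [i /= Ni E]; have := pin _ _ jN; rewrite -E; apply/negP; apply/pout/ltnW.
have D2 : [disjoint [set p N] & S3].
  apply/disj_setPS => q [/= -> [i /= Ni E]].
  by have := pin _ _ (ltnSn N); rewrite -E; apply/negP; apply/pout.
rewrite (g_add _ D1) (g_add _ D2).
have h1 : modulus (g (c N.+1).2 S1) <= e / 4 by apply: inF => _ [j jN <-]; apply: pin.
have h3 : modulus (g (c N.+1).2 S3) <= e / 4 by apply: outF => _ [j jN <-]; apply: pout.
move: h1 h3 big; move: (g _ S1) (g _ S3) (g _ [set p N]) => a b z ha hb hz h.
have E : z = (a + (z + b)) + ((- a) + (- b)).
  by rewrite [a + (z + b)]addrCA -addrA addrACA subrr add0r subrr addr0.
have mN (t : R[i]) : modulus (- t) = modulus t by rewrite !modulusE; case: t => ? ? /=; rewrite !sqrrN.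
have := modulusD (a + (z + b)) ((- a) + (- b)); rewrite -E.
have := modulusD (- a) (- b); rewrite !mN; lra.
Qed.

End GlidingHump.

(** * Operators on l^2 and band matrices *)

Section Basis.
Context {R : realType} {X : choiceType}.
Implicit Types (x y : X) (u v : l2 R X).

Lemma modulus_natr (b : bool) : modulus (b%:R : R[i]) = b%:R.
Proof. by case: b; rewrite ?modulus0// (@modulus_real R 1). Qed.

Lemma modulus1 : modulus (1 : R[i]) = 1.
Proof. exact: (modulus_natr true). Qed.

Lemma basis_subproof x : (fun y => (y == x)%:R) \in @square_summable_pred R X.
Proof.
apply/asboolP; exists 1 => F; have [xF|xF] := boolP (x \in F).
  rewrite (big_fsetD1 x) //= eqxx modulus_natr expr1n big_seq big1 ?addr0// => y.
  by rewrite !inE => /andP[/negbTE -> _]; rewrite modulus0 expr0n.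
rewrite big_seq big1 // => y yF; have /negbTE -> : y != x by apply: contraNneq xF => <-.
by rewrite modulus0 expr0n.
Qed.

Definition basis x : l2 R X := L2 (basis_subproof x).

Lemma dot_basis u x : dot u (basis x) = u x.
Proof.
have -> : dot u (basis x) = \sum_(y <- [fset x]%fset) u y * conjc (basis x y).
  apply/has_csumE/has_csum_fin => y; rewrite inE /= => /negbTE ->.
  by rewrite conjc0 mulr0.
by rewrite big_seq_fset1 /= eqxx rmorph1 mulr1.
Qed.

Lemma basis_dot u x : dot (basis x) u = conjc (u x).
Proof. by rewrite dotC dot_basis. Qed.

Lemma basis_diag x : dot (basis x) (basis x) = 1 :> R[i].
Proof. by rewrite dot_basis /= eqxx. Qed.

Lemma hnorm_basis x : hnorm (basis x) = 1.
Proof. by rewrite /hnorm basis_diag sqrtr1. Qed.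

(** The coordinate of [T' v] at [x] is the conjugate of [dot (T (basis x)) v], so values on the
    basis determine the adjoint, and the adjoint determines the operator. *)
Lemma adjoint_ext (T S T' S' : l2 R X -> l2 R X) : adjoint_of T T' -> adjoint_of S S' ->
  (forall x, T (basis x) = S (basis x)) -> T = S.
Proof.
move=> TT SS h; suff E : T' = S'.
  by apply: (adjoint_uniq (adjoint_sym TT)); rewrite E; exact: adjoint_sym.
apply/funext => v; apply: val_inj; apply/funext => x.
by rewrite -[LHS](conjcK (T' v x)) -[RHS](conjcK (S' v x)) -!basis_dot -TT -SS h.
Qed.

Lemma hnorm_dot u : dot u u = (hnorm u ^+ 2)%:C.
Proof. by rewrite hnorm_sqr -dotE. Qed.

Lemma modulus_dot_le (H : innerProductType R) (u v : H) :
  modulus (dot u v) <= hnorm u * hnorm v.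
Proof.
have [->|d0] := eqVneq (dot u v) 0.
  by rewrite modulus0 mulr_ge0 ?hnorm_ge0.
pose m := modulus (dot u v).
have m0 : 0 < m.
  rewrite lt_def modulus_ge0 andbT; apply: contra d0 => /eqP m0.
  have := modulus_sqr (dot u v); rewrite -/m m0 expr0n /=.
  case: (dot u v) => a b /= h; have a0 := sqr_ge0 a; have b0 := sqr_ge0 b.
  have /eqP : a ^+ 2 = 0 by lra.
  have /eqP : b ^+ 2 = 0 by lra.
  by rewrite !sqrf_eq0 => /eqP -> /eqP ->.
(* Multiplying [u] by the conjugate of [dot u v] makes the inner product real, which reduces the
   claim to the bound for real parts. *)
have := CauchySchwarz_Re (conjc (dot u v) *: u) v.
rewrite dotZl hnormZ modulus_conj -/m.
have -> : complex.Re (conjc (dot u v) * dot u v) = m ^+ 2.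
  by rewrite modulus_sqr; case: (dot u v) => a b /=; ring.
by rewrite -mulrA expr2 ler_pM2l.
Qed.

End Basis.

Section IndicatorMatrices.
Context {R : realType} {X : metricType R}.
Implicit Types (S T : set (X * X)) (x y : X) (u v : l2 R X).

Definition indicator_matrix S : X -> X -> R[i] := fun x y => (`[< S (x, y) >])%:R.

(** The entourages of the bounded coarse structure. *)
Definition controlled S : Prop :=
  exists2 r : R, 0 <= r & forall x y, S (x, y) -> mdist x y <= r.

Lemma in_alg_roe_indicator S : controlled S -> in_alg_roe (indicator_matrix S).
Proof.
move=> [r r0 rS]; split.
  apply/propagationP; exists r => // x y; rewrite /indicator_matrix.
  by case: asboolP => [/rS//|_]; rewrite eqxx.
by exists 1 => x y; rewrite modulus_natr lern1 leq_b1.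
Qed.

Lemma controlled_sub S T : S `<=` T -> controlled T -> controlled S.
Proof. by move=> ST [r r0 rT]; exists r => // x y /ST/rT. Qed.

Lemma controlled1 x y : controlled [set (x, y)].
Proof. by exists (mdist x y); rewrite ?mdist_ge0 // => a b [-> ->]. Qed.

Lemma controlled_diag : controlled [set p | p.1 = p.2].
Proof. by exists 0 => // a b /= ->; rewrite mdistxx. Qed.

Context (hX : bounded_geometry X).

Lemma roe_op_coef (M : alg_uniform_roe hX) x y : roe_op M (basis y) x = M x y.
Proof.
rewrite /= /matrix_act (fsbigTE [fset y]%fset) ?big_seq_fset1 /= ?eqxx ?mulr1//.
by move=> z; rewrite inE => /negbTE ->; rewrite mulr0.
Qed.

Lemma roe_op_inj : injective (@roe_op R X hX).
Proof.
move=> M N MN; apply: roe_inj; apply/funext => x; apply/funext => y.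
by rewrite -!roe_op_coef MN.
Qed.

Definition indicator S (cS : controlled S) : alg_uniform_roe hX :=
  MkRoe hX (in_alg_roe_indicator cS).

Definition unit_matrix x y : alg_uniform_roe hX := indicator (controlled1 x y).
Definition identity_matrix : alg_uniform_roe hX := indicator controlled_diag.

Lemma roe_op_identity : roe_op identity_matrix = id.
Proof.
apply/funext => u; apply: val_inj; apply/funext => x /=.
rewrite /matrix_act (fsbigTE [fset x]%fset) ?big_seq_fset1 /= /indicator_matrix.
  by rewrite asboolT // mul1r.
by move=> z; rewrite inE => zx; rewrite asboolF ?mul0r// => /= E; rewrite E eqxx in zx.
Qed.

Lemma roe_op_unit x y u : roe_op (unit_matrix x y) u = u y *: basis x.
Proof.
apply: val_inj; apply/funext => z /=.
rewrite /matrix_act (fsbigTE [fset y]%fset) ?big_seq_fset1 /= /indicator_matrix.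
  rewrite -[RHS]/(u y * (z == x)%:R) mulrC; congr (_ * _); congr ((nat_of_bool _)%:R).
  by apply/idP/idP => [/asboolP[->]//|/eqP ->]; apply/asboolP.
by move=> t; rewrite inE => ty; rewrite asboolF ?mul0r// => -[_ E]; rewrite E eqxx in ty.
Qed.

Lemma star_unit x y : star (unit_matrix x y) = unit_matrix y x.
Proof.
apply: roe_inj; apply/funext => a; apply/funext => b /=.
rewrite /matrix_adj /indicator_matrix rmorph_nat; congr (_%:R).
by apply: congr1; apply: asbool_equiv_eq; split=> -[-> ->].
Qed.

End IndicatorMatrices.

Section UniformBound.
Context {R : realType} {X : metricType R} (hX : bounded_geometry X).
Implicit Types (u v w : l2 R X) (r : R).

Definition band r : set (X * X) := [set p | mdist p.1 p.2 <= r].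

Lemma controlled_band r : 0 <= r -> controlled (band r).
Proof. by move=> r0; exists r. Qed.

Lemma l2_abs_subproof u : (fun x => (modulus (u x))%:C) \in @square_summable_pred R X.
Proof.
apply/asboolP; exists (hnorm u ^+ 2) => F; apply: le_trans (l2_sum_hnorm u F).
by apply: ler_sum => x _; rewrite modulus_real ?modulus_ge0.
Qed.

Definition l2_abs u : l2 R X := L2 (l2_abs_subproof u).

Lemma hnorm_le_pointwise u v : (forall x, modulus (u x) <= modulus (v x)) ->
  hnorm u <= hnorm v.
Proof.
move=> uv; apply: l2_hnorm_le; first exact: hnorm_ge0.
move=> F; apply: le_trans (l2_sum_hnorm v F); apply: ler_sum => x _.
by rewrite lerXn2r ?nnegrE ?modulus_ge0.
Qed.

Lemma hnorm_abs u : hnorm (l2_abs u) <= hnorm u.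
Proof. by apply: hnorm_le_pointwise => x /=; rewrite modulus_real ?modulus_ge0. Qed.

Context (r : R) (r0 : 0 <= r).

Lemma controlled_bandI (S : set (X * X)) : controlled (S `&` band r).
Proof. exact: controlled_sub (@subIsetr _ _ _) (controlled_band r0). Qed.

(** Cutting down to the band admits every subset [S] of [X * X], so that the operators form a
    finitely additive measure to which the gliding hump applies. *)
Definition band_indicator (S : set (X * X)) : alg_uniform_roe hX :=
  indicator hX (controlled_bandI S).

(** Pointwise, the image of [u] is dominated by the full band matrix applied to [l2_abs u]; hence
    one constant for all [S]. *)
Lemma band_indicator_bound : exists2 C : R, 0 <= C &
  forall (S : set (X * X)) u, hnorm (roe_op (band_indicator S) u) <= C * hnorm u.
Proof.
have [B BP [N BN]] := bounded_geometry_balls hX r0.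
pose D := band_indicator setT; have bD := roe_op_bounded D.
exists (opnorm (roe_op D)) => [|S u]; first exact: opnorm_ge0.
apply: (@le_trans _ _ (hnorm (roe_op D (l2_abs u)))); last first.
  apply: (le_trans (opnormP _ bD)); rewrite ler_wpM2l ?opnorm_ge0//; exact: hnorm_abs.
apply: hnorm_le_pointwise => x; rewrite /= /matrix_act !(fsbigTE (B x)); last 2 first.
- move=> y; rewrite BP => yB; rewrite /indicator_matrix asboolF ?mul0r// => -[_].
  by rewrite /band /=; apply/negP.
- move=> y; rewrite BP => yB; rewrite /indicator_matrix asboolF ?mul0r// => -[_].
  by rewrite /band /=; apply/negP.
apply: (@le_trans _ _ (\sum_(y <- B x) modulus (u y))).
  apply: (le_trans (modulus_sum _ _)); apply: ler_sum => y _.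
  rewrite modulusM /indicator_matrix modulus_natr -[leRHS]mul1r.
  by rewrite ler_wpM2r ?modulus_ge0// lern1 leq_b1.
apply: le_trans (modulus_Re _); apply: le_trans (ler_norm _).
have -> : complex.Re (\sum_(y <- B x)
    indicator_matrix (setT `&` band r) x y * (modulus (u y))%:C) =
    \sum_(y <- B x) modulus (u y); last by [].
rewrite (big_morph (@complex.Re R) (id1 := 0) (op1 := +%R)) //; last by move=> [? ?] [].
apply: eq_big_seq => y; rewrite BP => xy.
by rewrite /indicator_matrix asboolT // mul1r.
Qed.

(** Replace [u] by a finitely supported [w]. Only finitely many positions of the band meet the
    support of [w]; a set avoiding them kills [w], and [u - w] is controlled uniformly in [S]. *)
Lemma band_indicator_tail u v (e : R) : 0 < e -> exists F : {fset X * X},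
  forall S : set (X * X), (forall p, S p -> p \notin F) ->
    modulus (dot (roe_op (band_indicator S) u) v) <= e.
Proof.
move=> e0; have [C C0 CP] := band_indicator_bound.
have [B BP [N BN]] := bounded_geometry_balls hX r0.
have c0 : 0 < C * hnorm v + 1 by rewrite ltr_wpDl// mulr_ge0// hnorm_ge0.
have [F1 [w [wF uw]]] := l2_dense u (divr_gt0 e0 c0).
exists (rowsU B F1 `*` F1)%fset => S SF.
have -> : roe_op (band_indicator S) u = roe_op (band_indicator S) (u - w).
  rewrite (linearB' _ _ (roe_op_linear _)); apply/eqP; rewrite -subr_eq0 opprB addrC subrK.
  apply/eqP; apply: val_inj; apply/funext => x /=.
  rewrite /matrix_act fsbig1// => y _; have [yF|/wF ->] := boolP (y \in F1); last by rewrite mulr0.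
  rewrite /indicator_matrix asboolF ?mul0r// => -[/SF /negP xyF]; rewrite /band /= => xy.
  apply: xyF; rewrite inE /= yF andbT; apply: contraTT xy => /(rowsUP yF).
  by rewrite BP metric_sym.
apply: (le_trans (modulus_dot_le _ _)).
apply: (@le_trans _ _ (C * (e / (C * hnorm v + 1)) * hnorm v)).
  rewrite ler_wpM2r ?hnorm_ge0//; apply: (le_trans (CP _ _)).
  by rewrite ler_wpM2l.
have -> : C * (e / (C * hnorm v + 1)) * hnorm v = e * ((C * hnorm v) / (C * hnorm v + 1)).
  by field; rewrite gt_eqF.
by rewrite ler_piMr ?ltW// ltr_pdivrMr// mul1r ltrDl.
Qed.

Lemma band_indicatorU (S T : set (X * X)) : [disjoint S & T] ->
  roe_op (band_indicator (S `|` T)) = roe_op (band_indicator S) + roe_op (band_indicator T).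
Proof.
move=> /disj_setPS ST.
rewrite -[roe_op (band_indicator S)]scale1r -roe_op_lin; congr roe_op.
apply: roe_inj; apply/funext => x; apply/funext => y.
rewrite -[RHS]/(1 * indicator_matrix (S `&` band r) x y + indicator_matrix (T `&` band r) x y).
rewrite mul1r /= /indicator_matrix -natrD; congr (_ %:R).
case: (asboolP ((S `&` band r) (x, y))) => [[s b]|sb].
  rewrite asboolT; last by split => //; left.
  by rewrite asboolF // => -[t _]; apply: (ST (x, y)).
congr nat_of_bool; apply: asbool_equiv_eq; split=> [[[s|t] b]|[t b]]; last by split=> //; right.
  by case: sb.
by [].
Qed.

Lemma band_indicator1 x y u : mdist x y <= r ->
  roe_op (band_indicator [set (x, y)]) u = u y *: basis x.
Proof.
move=> xy; rewrite -(roe_op_unit hX); congr (roe_op _ u); apply: roe_inj.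
congr indicator_matrix; apply/seteqP.
by split=> p; [case|move=> ->].
Qed.

End UniformBound.

(** * Matrices conjugating one Roe algebra into another *)

Section HalfCoupling.
Context {R : realType} {X Y : metricType R} (hX : bounded_geometry X).
Context (E : Type) (col : E -> Y -> l2 R X) (ops : set (l2 R Y -> l2 R Y)).
(** If [z] stands for the matrix with columns [col z y], the right side is the entry of [z'^* T z]
    at [(y', y)]: conjugation carries finite propagation matrices into [ops]. *)
Hypothesis coupling : forall (T : alg_uniform_roe hX) (z z' : E),
  exists2 b, ops b & forall y y',
    dot (b (basis y)) (basis y') = dot (roe_op T (col z y)) (col z' y').

(** The gliding hump turns convergence for each operator into convergence uniform over [x] and [x']:
    the products in the conclusion are the entries of [z'^* e_x'x z]. *)
Lemma uniform_null (Q : nat -> seq (Y * Y)) (c : nat -> Y * Y -> R[i]) :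
  (forall b, ops b -> null_seq (fun n =>
     \sum_(q <- Q n) c n q * dot (b (basis q.1)) (basis q.2))) ->
  forall (r : R) (z z' : E) (e : R), 0 <= r -> 0 < e ->
  exists N, forall n, (N <= n)%N -> forall x x', mdist x' x <= r ->
    modulus (\sum_(q <- Q n) c n q * (col z q.1 x * conjc (col z' q.2 x'))) <= e.
Proof.
move=> opsQ r z z' e r0 e0.
(* For each set [S], [coupling] yields a single operator in [ops] whose weighted entry sums are
   [g n S]; this is what makes [g] null on every [S]. *)
pose g n S := \sum_(q <- Q n)
  c n q * dot (roe_op (band_indicator hX r0 S) (col z q.1)) (col z' q.2).
have [|n d d0|S|N NP] := @gliding_hump R (X * X)%type g _ _ _ e e0.
- move=> n S T ST; rewrite /g -big_split; apply: eq_bigr => q _.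
  by rewrite (band_indicatorU hX r0 ST) fctE dotDl mulrDr.
- have s0 : 0 < 1 + \sum_(q <- Q n) modulus (c n q).
    by rewrite ltr_pwDl// sumr_ge0// => ? _; exact: modulus_ge0.
  have [F FP] := choice (fun q : Y * Y =>
    band_indicator_tail hX r0 (col z q.1) (col z' q.2) (divr_gt0 d0 s0)).
  exists (\bigcup_(q <- Q n) F q)%fset => S SF.
  rewrite /g; apply: (le_trans (modulus_sum _ _)).
  apply: (@le_trans _ _ (\sum_(q <- Q n) modulus (c n q) * (d / (1 + \sum_(q <- Q n) modulus (c n q))))).
    rewrite big_seq [leRHS]big_seq; apply: ler_sum => q qQ; rewrite modulusM ler_wpM2l ?modulus_ge0//.
    apply: FP => p /SF; apply: contra => pF; apply/bigfcupP; exists q; rewrite ?qQ//.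
  rewrite -mulr_suml mulrCA ler_piMr ?ltW// ltr_pdivrMr// mul1r.
  by rewrite ltrDr.
- have [b bO bE] := coupling (band_indicator hX r0 S) z z'.
  have := opsQ b bO; congr null_seq; apply/funext => n; rewrite /g.
  by apply: eq_bigr => q _; rewrite bE.
exists N => n Nn x x' xx'; have := NP n Nn (x', x); rewrite /g.
rewrite (eq_bigr (fun q => c n q * (col z q.1 x * conjc (col z' q.2 x')))) //.
by move=> q _; rewrite band_indicator1// dotZl basis_dot.
Qed.

Context (hY : bounded_geometry Y).
Hypothesis ops_closure : ops `<=` in_closure (@roe_operators R Y hY).

Lemma entry_far (b : l2 R Y -> l2 R Y) : in_closure (@roe_operators R Y hY) b ->
  forall e : R, 0 < e -> exists s : R, forall y y', s < mdist y y' ->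
    modulus (dot (b (basis y)) (basis y')) <= e.
Proof.
move=> [bb bS] e e0; have [_ [T _ <-] bT] := bS e e0.
have [/propagationP[s _ sP] _] := roeP T; exists s => y y' syy'.
have -> : dot (b (basis y)) (basis y') = dot ((b - roe_op T) (basis y)) (basis y').
  rewrite fctE dotBl [dot (roe_op T _) _]dot_basis roe_op_coef.
  have [->|/sP] := eqVneq (T y' y) 0; first by rewrite subr0.
  by rewrite metric_sym leNgt syy'.
apply: (le_trans (modulus_dot_le _ _)); rewrite hnorm_basis mulr1.
apply: (le_trans (opnormP _ (bounded_linearB bb (roe_op_bounded T)))).
by rewrite hnorm_basis mulr1.
Qed.

(** Otherwise there are pairs [(y, y')] at distances tending to infinity with large products. Each
    operator in [ops] has null entries along these pairs, so [uniform_null], with one pair per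
    index, makes the products small. *)
Lemma coupling_expansive (r : R) (z z' : E) (e : R) : 0 <= r -> 0 < e ->
  exists s : R, forall x x' y y', mdist x x' <= r ->
    e < modulus (col z y x) * modulus (col z' y' x') -> mdist y y' <= s.
Proof.
move=> r0 e0; apply/not_existsP => bad.
have {bad} bad (n : nat) : exists q : (X * X) * (Y * Y),
    [/\ mdist q.1.1 q.1.2 <= r,
        e < modulus (col z q.2.1 q.1.1) * modulus (col z' q.2.2 q.1.2) &
        n%:R < mdist q.2.1 q.2.2].
  have := bad n%:R; move=> /existsNP[x /existsNP[x' /existsNP[y /existsNP[y']]]].
  move=> /not_implyP[xx' /not_implyP[exy /negP]]; rewrite -ltNge => ny.
  by exists ((x, x'), (y, y')).
have [q qP] := choice bad.
have [|N NP] := @uniform_null (fun n => [:: (q n).2]) (fun _ _ => 1) _ r z z' e r0 e0.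
  move=> b /ops_closure/entry_far bfar d d0; have [s sP] := bfar d d0.
  exists (Num.bound `|s|) => n sn; rewrite big_seq1 mul1r; apply: sP.
  have [_ _] := qP n; apply: le_lt_trans; apply: le_trans (ler_norm s) _.
  by apply: (le_trans (ltW (archi_boundP (normr_ge0 s)))); rewrite ler_nat.
have [qr eq _] := qP N.
have := NP N (leqnn N) (q N).1.1 (q N).1.2; rewrite metric_sym => /(_ qr).
by rewrite big_seq1 mul1r modulusM modulus_conj leNgt eq.
Qed.

End HalfCoupling.

(** * Schur multipliers from property A *)

Lemma sum_supported_le (R : realType) (T : choiceType) (F B : {fset T}) (f : T -> R) (d : R) :
  0 <= d -> (forall y, y \in B -> f y <= d) -> (forall y, y \notin B -> f y <= 0) ->
  \sum_(y <- F) f y <= #|` B|%:R * d.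
Proof.
move=> d0 fB fN; apply: (@le_trans _ _ (\sum_(y <- F) (if y \in B then d else 0))).
  by apply: ler_sum => y _; case: ifPn => [/fB|/fN].
rewrite -big_mkcond -big_filter big_const_seq count_predT iter_addr_0 -[_ *+ size _]mulr_natl.
rewrite ler_wpM2r// ler_nat; apply: uniq_leq_size; first by rewrite filter_uniq ?fset_uniq.
by move=> y; rewrite mem_filter => /andP[].
Qed.

Section Schur.
Context {R : realType} {Y : choiceType}.
Implicit Types (F : {fset Y}) (t : Y -> R[i]).

Definition combination F t : l2 R Y := \sum_(y <- F) t y *: basis y.

Lemma dot_suml (u : Y -> l2 R Y) F v :
  dot (\sum_(y <- F) u y) v = \sum_(y <- F) dot (u y) v.
Proof. by apply: (big_morph (fun w => dot w v)) => [a b|]; rewrite ?dotDl ?dot0l. Qed.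

Lemma dot_sumr (u : Y -> l2 R Y) F v :
  dot v (\sum_(y <- F) u y) = \sum_(y <- F) dot v (u y).
Proof. by apply: (big_morph (fun w => dot v w)) => [a b|]; rewrite ?dotDr ?dot0r. Qed.

Lemma dot_combination (T : l2 R Y -> l2 R Y) F t : linear T ->
  dot (T (combination F t)) (combination F t) =
  \sum_(y <- F) \sum_(y' <- F) t y * conjc (t y') * dot (T (basis y)) (basis y').
Proof.
move=> lT; have -> : T (combination F t) = \sum_(y <- F) t y *: T (basis y).
  rewrite /combination; elim: (enum_fset F) => [|y s ih]; first by rewrite !big_nil linear0'.
  by rewrite !big_cons linearD'// linearZ'// ih.
rewrite dot_suml; apply: eq_bigr => y _; rewrite dotZl dot_sumr mulr_sumr.
by apply: eq_bigr => y' _; rewrite dotZr mulrA.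
Qed.

Lemma hnorm_combination F t : hnorm (combination F t) ^+ 2 = \sum_(y <- F) modulus (t y) ^+ 2.
Proof.
have lid : linear (id : l2 R Y -> l2 R Y) by [].
have := dot_combination F t lid; rewrite hnorm_dot => /(congr1 (@complex.Re R)) /= ->.
rewrite (big_morph (@complex.Re R) (id1 := 0) (op1 := +%R)) //; last by move=> [? ?] [].
apply: eq_big_seq => y yF; rewrite (big_fsetD1 y) //= big_seq big1 => [|y'].
  by rewrite basis_diag addr0 mulr1 modulus_sqr; case: (t y) => a b /=; ring.
rewrite !inE => /andP[/negbTE yy _].
by rewrite dot_basis /= yy mulr0.
Qed.

(** Schur multiplication by the Gram matrix of vectors of norm at most 1 is contractive: the form
    splits as the sum over [j] of [dot (T (v j)) (v j)], and the squared norms of the [v j] add up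
    to at most that of [t]. *)
Lemma schur_bound (T : l2 R Y -> l2 R Y) (J : choiceType) (G : {fset J}) (D : J -> Y -> R)
    F t : bounded_linear T -> (forall y, y \in F -> \sum_(j <- G) D j y ^+ 2 <= 1) ->
  modulus (\sum_(y <- F) \sum_(y' <- F) (\sum_(j <- G) D j y * D j y')%:C *
     (t y * conjc (t y') * dot (T (basis y)) (basis y'))) <=
  opnorm T * \sum_(y <- F) modulus (t y) ^+ 2.
Proof.
move=> bT D1; pose v j := combination F (fun y => (D j y)%:C * t y).
have -> : \sum_(y <- F) \sum_(y' <- F) (\sum_(j <- G) D j y * D j y')%:C *
     (t y * conjc (t y') * dot (T (basis y)) (basis y')) = \sum_(j <- G) dot (T (v j)) (v j).
  have lT := bT.1; under [RHS]eq_bigr do rewrite (dot_combination _ _ lT).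
  rewrite [RHS]exchange_big; apply: eq_bigr => y _.
  rewrite [RHS]exchange_big; apply: eq_bigr => y' _.
  rewrite (raddf_sum (@real_complex R)) mulr_suml; apply: eq_bigr => j _ /=.
  rewrite [(_ * _)%:C]rmorphM rmorphM /= oppr0.
  by rewrite -!mulrA; congr (_ * _); rewrite mulrCA; congr (_ * _); rewrite mulrCA.
apply: (le_trans (modulus_sum _ _)).
apply: (@le_trans _ _ (\sum_(j <- G) opnorm T * hnorm (v j) ^+ 2)).
  apply: ler_sum => j _; apply: (le_trans (modulus_dot_le _ _)).
  by rewrite expr2 mulrA ler_wpM2r ?hnorm_ge0// opnormP.
rewrite -mulr_sumr ler_wpM2l ?opnorm_ge0//.
under eq_bigr do rewrite hnorm_combination.
rewrite exchange_big /= big_seq [leRHS]big_seq; apply: ler_sum => y yF.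
under eq_bigr do rewrite modulusZ.
rewrite -mulr_suml ler_piMl ?sqr_ge0//.
under eq_bigr do rewrite modulusE /= expr0n addr0 sqrtr_sqr real_normK ?num_real//.
exact: D1.
Qed.

Lemma schur_bound1 (T : l2 R Y -> l2 R Y) F t : bounded_linear T ->
  modulus (\sum_(y <- F) \sum_(y' <- F) t y * conjc (t y') * dot (T (basis y)) (basis y')) <=
  opnorm T * \sum_(y <- F) modulus (t y) ^+ 2.
Proof.
move=> bT; rewrite -dot_combination; last by case: bT.
apply: (le_trans (modulus_dot_le _ _)); rewrite -hnorm_combination expr2 mulrA.
by rewrite ler_wpM2r ?hnorm_ge0// opnormP.
Qed.

End Schur.

Section Kernels.
Context {R : realType} {Y : metricType R}.

(* Up to the test vector t, the sum is the quadratic form of the Schur product of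
   k and T. *)
Definition schur_kernel (k : Y -> Y -> R) : Prop :=
  forall (T : l2 R Y -> l2 R Y) (F : {fset Y}) (t : Y -> R[i]), bounded_linear T ->
    modulus (\sum_(y <- F) \sum_(y' <- F) (k y y')%:C *
      (t y * conjc (t y') * dot (T (basis y)) (basis y'))) <=
    opnorm T * \sum_(y <- F) modulus (t y) ^+ 2.

(** The standard passage from property A to positive definite kernels of finite propagation;
    positivity enters through [schur_bound]. *)
Lemma property_A_kernel (r e : R) : property_A Y -> 0 < r -> 0 < e ->
  exists k : Y -> Y -> R, [/\ forall y y', 0 <= k y y' <= 1,
    forall y y', mdist y y' <= r -> 1 - k y y' <= e,
    exists2 s : R, 0 <= s & forall y y', s < mdist y y' -> k y y' = 0 &
    schur_kernel k].
Proof.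
move=> pA r0 e0; have [A [A1 Ar [s s0 As]]] := pA r e r0 e0.
(* The kernel is the Gram matrix of the normalized indicators of the sets A y. *)
pose a y : R := (#|` A y|)%:R.
have a0 y : 0 < a y.
  by rewrite ltr0n cardfs_gt0; apply/fset0Pn; exists (y, 1%N).
pose m y y' : R := (#|` A y `&` A y'|)%fset%:R.
have ma y y' : m y y' <= a y /\ m y y' <= a y'.
  by rewrite !ler_nat !fsubset_leq_card// ?fsubsetIl ?fsubsetIr.
have m0 y y' : 0 <= m y y' by [].
pose D (j : Y * nat) y : R := (j \in A y)%:R / Num.sqrt (a y).
have sa y : 0 < Num.sqrt (a y) by rewrite sqrtr_gt0.
have sa2 y : Num.sqrt (a y) ^+ 2 = a y by rewrite sqr_sqrtr// ltW.
have DE (G : {fset Y * nat}) y y' : (A y `<=` G)%fset ->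
    \sum_(j <- G) D j y * D j y' = m y y' / (Num.sqrt (a y) * Num.sqrt (a y')).
  move=> AG; rewrite (eq_bigr (fun j => if (j \in A y) && (j \in A y')
      then (Num.sqrt (a y) * Num.sqrt (a y'))^-1 else 0)) => [|j _]; last first.
    rewrite /D; case: (j \in A y); case: (j \in A y'); rewrite /= ?mul0r ?mulr0//.
    by rewrite !mul1r invfM.
  rewrite -big_mkcond -big_filter big_const_seq count_predT iter_addr_0 -[_ *+ _]mulr_natl.
  congr (_%:R * _); apply/perm_size/uniq_perm; rewrite ?filter_uniq ?fset_uniq// => j.
  rewrite mem_filter inE; case jA: (j \in A y) => //=.
  by rewrite (fsubsetP AG)// andbT.
exists (fun y y' => m y y' / (Num.sqrt (a y) * Num.sqrt (a y'))); split.
- move=> y y'; rewrite divr_ge0 ?mulr_ge0 ?sqrtr_ge0//= ler_pdivrMr ?mulr_gt0// mul1r.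
  have [h h'] := ma y y'; rewrite -(ler_pXn2r (n := 2))// ?nnegrE ?mulr_ge0 ?sqrtr_ge0//.
  by rewrite exprMn !sa2 expr2 ler_pM.
- move=> y y' yy'; have [mn0 /ltW] := Ar y y' yy'.
  have mp : 0 < m y y' by rewrite ltr0n cardfs_gt0.
  rewrite ler_pdivrMr// => sd.
  have cU := cardfsUI (A y `\` A y')%fset (A y' `\` A y)%fset.
  have I0 : ((A y `\` A y') `&` (A y' `\` A y) = fset0)%fset.
    by apply/fsetP => j; rewrite !inE; case: (j \in A y); rewrite ?andbF.
  rewrite I0 cardfs0 addn0 in cU; rewrite cU natrD in sd.
  have Ey : a y = m y y' + (#|` A y `\` A y'|)%fset%:R by rewrite -natrD cardfsID.
  have Ey' : a y' = m y y' + (#|` A y' `\` A y|)%fset%:R.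
    by rewrite -natrD /m fsetIC cardfsID.
  have e1 : 0 < 1 + e by lra.
  (* The symmetric difference has at most [e * m y y'] points, so [a y] and [a y'] are both at most
     [(1 + e) * m y y']. The claim then follows from [(1 - e) * (1 + e) <= 1]. *)
  have h : Num.sqrt (a y) * Num.sqrt (a y') <= (1 + e) * m y y'.
    have h0 : 0 <= (1 + e) * m y y' by rewrite mulr_ge0// ltW.
    rewrite -(ler_pXn2r (n := 2))// ?nnegrE ?mulr_ge0 ?sqrtr_ge0// exprMn !sa2.
    have n1 : 0 <= (#|` A y `\` A y'|)%fset%:R :> R by [].
    have n2 : 0 <= (#|` A y' `\` A y|)%fset%:R :> R by [].
    have em : 0 < e * m y y' by rewrite mulr_gt0.
    by rewrite expr2; apply: ler_pM; rewrite ?(ltW (a0 _))//; lra.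
  rewrite lerBlDr -lerBlDl ler_pdivlMr ?mulr_gt0//.
  have : (1 - e) * (Num.sqrt (a y) * Num.sqrt (a y')) <= m y y'; last by [].
  have [e1'|e1'] := leP 1 e.
    by apply: le_trans (m0 _ _); rewrite mulr_le0_ge0 ?mulr_ge0 ?sqrtr_ge0// subr_le0.
  apply: (@le_trans _ _ ((1 - e) * ((1 + e) * m y y'))); first by rewrite ler_wpM2l// subr_ge0 ltW.
  rewrite mulrA -[leRHS]mul1r ler_wpM2r//.
  by have := sqr_ge0 e; lra.
(* A common point of [A y] and [A y'] has first component within [s] of both [y] and [y'], because
   [(y, 1)] lies in [A y]. *)
- exists (s + s) => [|y y' syy']; first by rewrite addr_ge0 ?ltW.
  suff -> : m y y' = 0 by rewrite mul0r.
  rewrite /m; have [->|/fset0Pn[[z n]]] := eqVneq (A y `&` A y')%fset fset0.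
    by rewrite cardfs0.
  rewrite inE => /andP[zy zy'].
  have := metric_triangle y z y'; have := As _ _ _ _ _ (A1 y) zy.
  by have := As _ _ _ _ _ zy' (A1 y'); lra.
- move=> T F t bT; pose G := (\bigcup_(y <- F) A y)%fset.
  have AG y : y \in F -> (A y `<=` G)%fset.
    by move=> yF; apply/fsubsetP => j jy; apply/bigfcupP; exists y; rewrite ?yF.
  rewrite (_ : \sum_(y <- F) _ = \sum_(y <- F) \sum_(y' <- F)
      (\sum_(j <- G) D j y * D j y')%:C * (t y * conjc (t y') * dot (T (basis y)) (basis y'))).
    apply: schur_bound => // y yF; under eq_bigr do rewrite expr2.
    rewrite (DE G y y (AG y yF)) /m fsetIid -expr2 sa2 divff//.
    by rewrite gt_eqF ?a0.
  by apply: eq_big_seq => y yF; apply: eq_bigr => y' _; rewrite (DE G y y' (AG y yF)).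
Qed.

End Kernels.

Section KernelLimit.
Context {R : realType} {Y : metricType R} (hY : bounded_geometry Y).

Lemma archi_inv (e : R) : 0 < e -> exists N, forall n, (N <= n)%N -> (n.+1%:R)^-1 <= e.
Proof.
move=> e0; exists (Num.bound (e^-1)) => n Nn.
rewrite -[leRHS]invrK lef_pV2 ?posrE ?invr_gt0//.
apply: (le_trans (ltW (archi_boundP _))); first by rewrite invr_ge0 ltW.
by rewrite ler_nat (leq_trans Nn).
Qed.

Lemma archi_ge (s : R) : exists N, forall n, (N <= n)%N -> s <= n%:R.
Proof.
exists (Num.bound `|s|) => n sn; apply: le_trans (ler_norm s) _.
by apply: (le_trans (ltW (archi_boundP (normr_ge0 s)))); rewrite ler_nat.
Qed.

Lemma band_sum_le (B : Y -> {fset Y}) (N : nat) (F : {fset Y}) (a : Y -> R) :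
  (forall x y, (y \in B x) = (x \in B y)) -> (forall x, (#|` B x| <= N)%N) ->
  (forall y, 0 <= a y) ->
  \sum_(y <- F) \sum_(y' <- F) (if y' \in B y then a y + a y' else 0) <=
  2 * N%:R * \sum_(y <- F) a y.
Proof.
move=> Bsym BN a0.
have h : \sum_(y <- F) \sum_(y' <- F) (if y' \in B y then a y else 0) <= N%:R * \sum_(y <- F) a y.
  rewrite mulr_sumr; apply: ler_sum => y _.
  apply: (@le_trans _ _ (#|` B y|%:R * a y)); last by rewrite ler_wpM2r// ler_nat.
  by apply: sum_supported_le => // y'; [move=> ->|move=> /negbTE ->].
rewrite (_ : 2 * _ * _ = N%:R * \sum_(y <- F) a y + N%:R * \sum_(y <- F) a y); last by ring.
apply: le_trans (lerD h h); rewrite [X in _ <= _ + X]exchange_big /= -big_split.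
apply: ler_sum => y _ /=; rewrite -big_split; apply: ler_sum => y' _ /=.
by rewrite (Bsym y'); case: ifP; rewrite ?addr0.
Qed.

Context (k : nat -> Y -> Y -> R).
Hypothesis k01 : forall n y y', 0 <= k n y y' <= 1.
Hypothesis k1 : forall n y y', mdist y y' <= n.+1%:R -> 1 - k n y y' <= (n.+1%:R)^-1.
Hypothesis k_schur : forall n, schur_kernel (k n).
Context (F : nat -> {fset Y}) (t : nat -> Y -> R[i]).
Hypothesis t1 : forall n, \sum_(y <- F n) modulus (t n y) ^+ 2 <= 1.

(** At the test vector [t n], the quadratic form of [b] minus its Schur product with [k n]. *)
Let form n (b : l2 R Y -> l2 R Y) := \sum_(y <- F n) \sum_(y' <- F n)
  (1 - k n y y')%:C * (t n y * conjc (t n y') * dot (b (basis y)) (basis y')).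

Let form_bound n b : bounded_linear b -> modulus (form n b) <= 2 * opnorm b.
Proof.
move=> bb; have -> : form n b =
  \sum_(y <- F n) \sum_(y' <- F n) t n y * conjc (t n y') * dot (b (basis y)) (basis y') +
  (-1) * \sum_(y <- F n) \sum_(y' <- F n)
    (k n y y')%:C * (t n y * conjc (t n y') * dot (b (basis y)) (basis y')).
  rewrite mulr_sumr -big_split; apply: eq_bigr => y _ /=.
  rewrite mulr_sumr -big_split; apply: eq_bigr => y' _ /=.
  by rewrite rmorphB rmorph1; ring.
have m1 : modulus (-1 : R[i]) = 1.
  by rewrite modulusE /= oppr0 sqrrN expr1n expr0n addr0 sqrtr1.
apply: (le_trans (modulusD _ _)); rewrite modulusM m1 mul1r mulrDl mul1r.
have o0 := opnorm_ge0 bb.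
apply: lerD.
  by apply: (le_trans (schur_bound1 _ _ bb)); rewrite ler_piMr.
by apply: (le_trans (k_schur n _ _ bb)); rewrite ler_piMr.
Qed.

Let form_roe (T : alg_uniform_roe hY) : null_seq (fun n => form n (roe_op T)).
Proof.
move=> e e0; have [/propagationP[s s0 sT] [M TM]] := roeP T.
have [B BP [N BN]] := bounded_geometry_balls hY s0.
have c0 : 0 < `|M| * N%:R + 1 by rewrite ltr_wpDl// mulr_ge0.
have [n1 n1P] := archi_inv (divr_gt0 e0 c0); have [n2 n2P] := archi_ge s.
exists (maxn n1 n2) => n; rewrite geq_max => /andP[/n1P en /n2P sn].
have i0 : 0 <= n.+1%:R^-1 :> R by rewrite invr_ge0.
pose a y := modulus (t n y) ^+ 2.
(* The factor 1/2 comes from bounding a product of two moduli by half the sum of their squares; it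
   cancels the 2 of [band_sum_le]. *)
pose c := n.+1%:R^-1 * `|M| / 2.
have c0' : 0 <= c by rewrite divr_ge0// mulr_ge0.
apply: (le_trans (modulus_sum _ _)).
apply: (@le_trans _ _ (\sum_(y <- F n) \sum_(y' <- F n)
    (c * if y' \in B y then a y + a y' else 0))).
  apply: ler_sum => y _; apply: (le_trans (modulus_sum _ _)); apply: ler_sum => y' _.
  rewrite dot_basis roe_op_coef BP.
  have [->|Tn0] := eqVneq (T y' y) 0.
    rewrite !mulr0 modulus0 mulr_ge0//; case: ifP => // _; rewrite addr_ge0//; exact: sqr_ge0.
  have yy' := sT _ _ Tn0; rewrite metric_sym yy'.
  have [kge kle] := andP (k01 n y y').
  rewrite !modulusM modulus_conj modulus_real ?subr_ge0//.
  have h1 : 1 - k n y y' <= n.+1%:R^-1.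
    by apply: k1; rewrite metric_sym (le_trans yy')// (le_trans sn)// ler_nat.
  have h2 : modulus (T y' y) <= `|M| by apply: le_trans (TM _ _) (ler_norm _).
  have h3 : modulus (t n y) * modulus (t n y') <= (a y + a y') / 2.
    by rewrite /a; have := sqr_ge0 (modulus (t n y) - modulus (t n y')); lra.
  rewrite /c (_ : _ / 2 * _ = n.+1%:R^-1 * ((a y + a y') / 2 * `|M|)); last by ring.
  apply: ler_pM => //; [by rewrite subr_ge0|by rewrite !mulr_ge0 ?modulus_ge0|].
  by apply: ler_pM; rewrite ?mulr_ge0 ?modulus_ge0.
under eq_bigr do rewrite -mulr_sumr.
rewrite -mulr_sumr; apply: (@le_trans _ _ (c * (2 * N%:R * \sum_(y <- F n) a y))).
  rewrite ler_wpM2l//; apply: band_sum_le => // [x y|y]; last exact: sqr_ge0.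
  by rewrite !BP metric_sym.
apply: (@le_trans _ _ (c * (2 * N%:R * 1))); first by rewrite ler_wpM2l// ler_wpM2l ?mulr_ge0// t1.
have -> : c * (2 * N%:R * 1) = n.+1%:R^-1 * (`|M| * N%:R) by rewrite /c; move: (_^-1) `|M| => i m; field.
apply: (@le_trans _ _ (n.+1%:R^-1 * (`|M| * N%:R + 1))); first by rewrite ler_wpM2l// lerDl.
by rewrite -ler_pdivlMr.
Qed.

(** The forms are bounded uniformly in [n] and null on finite propagation matrices, hence null on
    the closure. The rate depends on [b]; [uniform_null] will remove this dependence. *)
Lemma kernel_null (b : l2 R Y -> l2 R Y) : in_closure (@roe_operators R Y hY) b ->
  null_seq (fun n => \sum_(q <- [seq (y, y') | y <- F n, y' <- F n])
    ((1 - k n q.1 q.2)%:C * (t n q.1 * conjc (t n q.2))) * dot (b (basis q.1)) (basis q.2)).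
Proof.
(* [form_bound] doubles the approximation error, hence [e / 4]. *)
move=> [bb bS] e e0; have e4 : 0 < e / 4 by rewrite divr_gt0.
have e2 : 0 < e / 2 by rewrite divr_gt0.
have [_ [T _ <-] bT] := bS _ e4; have [N NP] := form_roe T e2.
exists N => n /NP Tn; have bd := bounded_linearB bb (roe_op_bounded T).
have -> : \sum_(q <- [seq (y, y') | y <- F n, y' <- F n])
    ((1 - k n q.1 q.2)%:C * (t n q.1 * conjc (t n q.2))) * dot (b (basis q.1)) (basis q.2) =
    form n (b - roe_op T) + form n (roe_op T).
  rewrite big_allpairs /form -big_split; apply: eq_bigr => y _ /=.
  rewrite -big_split; apply: eq_bigr => y' _ /=.
  rewrite -[X in _ = _ * (_ * dot X _) + _]/(b (basis y) - roe_op T (basis y)).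
  by rewrite -mulrDr -mulrDr -dotDl subrK -[LHS]mulrA.
apply: (le_trans (modulusD _ _)); have := form_bound n bd; lra.
Qed.

End KernelLimit.

(** * Lower bounds for single entries *)

Lemma l2_mass (R : realType) (Y : choiceType) (u : l2 R Y) (c : R) : 0 < c -> c <= hnorm u ->
  exists F : {fset Y}, c ^+ 2 / 2 <= \sum_(y <- F) modulus (u y) ^+ 2.
Proof.
move=> c0 cu; apply/not_existsP => small.
have c2 : 0 < c ^+ 2 by rewrite exprn_gt0.
have : hnorm u <= Num.sqrt (c ^+ 2 / 2).
  apply: l2_hnorm_le => [|F]; first exact: sqrtr_ge0.
  rewrite sqr_sqrtr ?divr_ge0 ?ltW//.
  by have /negP := small F; rewrite -ltNge.
move=> /(le_trans cu); rewrite -(ler_pXn2r (n := 2)) ?nnegrE ?sqrtr_ge0 ?(ltW c0)//.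
have c2' : 0 <= c ^+ 2 / 2 by rewrite divr_ge0// ltW.
by rewrite sqr_sqrtr//; lra.
Qed.

Section Concentration.
Context {R : realType} {X Y : metricType R}.
Context (hX : bounded_geometry X) (hY : bounded_geometry Y).
Context (E : Type) (col : E -> Y -> l2 R X) (row : E -> X -> l2 R Y).
Context (ops : set (l2 R Y -> l2 R Y)).
Hypothesis col_row : forall z x y, col z y x = conjc (row z x y).
Hypothesis coupling : forall (T : alg_uniform_roe hX) (z z' : E),
  exists2 b, ops b & forall y y',
    dot (b (basis y)) (basis y') = dot (roe_op T (col z y)) (col z' y').

(** A converse, uniform in [x], to the bound of an entry by the norm of its row. *)
Definition concentrated (z : E) : Prop := forall c : R, 0 < c ->
  exists2 d : R, 0 < d & forall x, c <= hnorm (row z x) ->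
    exists y, d <= modulus (col z y x).

(** Non-zero entries of row [x] at [y] and [y'] give a non-zero entry of [z^* e_xx z] whose position
    is [mdist y y'] away from the diagonal. Weighted by its inverse it equals 1, while
    [uniform_null] would bound it by 1/2. *)
Lemma finite_propagation_supports (z : E) : ops `<=` range (@roe_op R Y hY) ->
  exists2 s : R, 0 <= s & forall x y y', row z x y != 0 -> row z x y' != 0 -> mdist y y' <= s.
Proof.
move=> opsR.
suff [s sP] : exists s : R, forall x y y', row z x y != 0 -> row z x y' != 0 -> mdist y y' <= s.
  exists (Num.max 0 s) => [|x y y' h h']; first by rewrite le_max lexx.
  by rewrite le_max (sP x y y')// orbT.
apply/not_existsP => bad.
have {bad} bad (n : nat) : exists q : X * (Y * Y),
    [/\ row z q.1 q.2.1 != 0, row z q.1 q.2.2 != 0 & n%:R < mdist q.2.1 q.2.2].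
  have /existsNP[x /existsNP[y /existsNP[y']]] := bad n%:R.
  move=> /not_implyP[xy /not_implyP[xy' /negP]]; rewrite -ltNge => ny.
  by exists (x, (y, y')).
have [q qP] := choice bad.
(* Entries of finite propagation operators far from the diagonal vanish, so they
   form a null sequence even after an arbitrary rescaling. *)
pose l n := (col z (q n).2.1 (q n).1 * conjc (col z (q n).2.2 (q n).1))^-1.
have half0 : 0 < 2^-1 :> R by rewrite invr_gt0.
have [|N NP] := @uniform_null R X Y hX E col ops coupling
    (fun n => [:: (q n).2]) (fun n _ => l n) _ 0 z z _ (lexx 0) half0.
  move=> b /opsR[T _ <-] e e0.
  have [/propagationP[s _ sT] _] := roeP T; have [n0 n0P] := archi_ge s.
  exists n0 => n /n0P sn; have [_ _ nq] := qP n.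
  rewrite big_seq1 dot_basis roe_op_coef.
  have [->|/sT] := eqVneq (T (q n).2.2 (q n).2.1) 0; first by rewrite mulr0 modulus0 ltW.
  by rewrite metric_sym leNgt (le_lt_trans sn).
have [r1 r2 _] := qP N; have := NP N (leqnn N) (q N).1 (q N).1; rewrite mdistxx => /(_ (lexx 0)).
rewrite big_seq1 /l mulVf; last by rewrite mulf_neq0// ?conjc_eq0 col_row conjc_eq0.
by rewrite modulus1; lra.
Qed.

Lemma concentrated_alg (z : E) : ops `<=` range (@roe_op R Y hY) -> concentrated z.
Proof.
move=> /(finite_propagation_supports z)[s s0 sP] c c0.
have [B BP [N BN]] := bounded_geometry_balls hY s0.
have N0 : 0 < N.+1%:R :> R by [].
(* The row lives on at most [N] points; dividing by [N.+1] makes the final comparison strict. *)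
pose d2 := c ^+ 2 / 2 / N.+1%:R.
have d20 : 0 < d2 by rewrite !divr_gt0 ?exprn_gt0.
exists (Num.sqrt d2) => [|x cx]; first by rewrite sqrtr_gt0.
have [F FP] := l2_mass c0 cx; apply/not_existsP => small.
have p y : modulus (row z x y) ^+ 2 <= d2.
  have /negP := small y; rewrite -ltNge col_row modulus_conj => /ltW h.
  by rewrite -[d2]sqr_sqrtr ?(ltW d20)// lerXn2r ?nnegrE ?modulus_ge0 ?sqrtr_ge0.
have [y yF y0] : exists2 y, y \in F & row z x y != 0.
  apply/not_exists2P => z0; move: FP; rewrite big_seq big1.
    by rewrite leNgt divr_gt0 ?exprn_gt0.
  move=> y yF; have [//|/negP/negPn/eqP ->] := z0 y.
  by rewrite modulus0 expr0n.
have : \sum_(y <- F) modulus (row z x y) ^+ 2 <= #|` B y|%:R * d2.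
  apply: sum_supported_le => [|//|y']; first exact: ltW.
  rewrite BP; have [->|y'0] := eqVneq (row z x y') 0; first by rewrite modulus0 expr0n.
  by rewrite (sP x).
move=> /(le_trans FP); apply/negP; rewrite -ltNge.
apply: (@le_lt_trans _ _ (N%:R * d2)); first by rewrite ler_wpM2r ?ler_nat ?(ltW d20).
have -> : c ^+ 2 / 2 = N.+1%:R * d2 by rewrite [RHS]mulrC /d2 divfK// gt_eqF.
by rewrite ltr_pM2r// ltr_nat.
Qed.

(** The squared mass of a row is a double sum over pairs [(y, y')]. One kernel of finite propagation
    retains at least half of it for all rows of norm at least [c], so some ball of fixed radius
    carries a definite mass, and bounded geometry leaves a large entry. *)
Lemma concentrated_A (z : E) (C : R) : property_A Y ->
  ops `<=` in_closure (@roe_operators R Y hY) ->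
  (forall x, hnorm (row z x) <= C) -> concentrated z.
Proof.
move=> pA opsC rowC c c0.
pose C1 := Num.max C 1.
have C10 : 0 < C1 by rewrite lt_max ltr01 orbT.
have rowC1 x : hnorm (row z x) <= C1 by rewrite le_max rowC.
have kex (n : nat) : exists k : Y -> Y -> R, [/\ forall y y', 0 <= k y y' <= 1,
    forall y y', mdist y y' <= n.+1%:R -> 1 - k y y' <= n.+1%:R^-1,
    exists2 s : R, 0 <= s & forall y y', s < mdist y y' -> k y y' = 0 &
    schur_kernel k].
  by apply: property_A_kernel => //; rewrite invr_gt0.
have [k kP] := choice kex.
pose p x y := modulus (row z x y) ^+ 2.
have p0 x y : 0 <= p x y by exact: sqr_ge0.
(* Below, a finite part of the row has mass [m >= c ^+ 2 / 2]. If all entries were small, the kernel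
   part of [m ^+ 2] would be less than [m * c ^+ 2 / 4], leaving more than [eps] for the rest. *)
pose eps := c ^+ 2 ^+ 2 / 8.
have eps0 : 0 < eps by rewrite divr_gt0 ?exprn_gt0.
have [n nP] : exists n, forall x (F : {fset Y}),
    \sum_(y <- F) \sum_(y' <- F) (1 - k n y y') * (p x y * p x y') <= eps.
  apply/not_existsP => bad.
  have {bad} bad (n : nat) : exists xF : X * {fset Y}, eps <
      \sum_(y <- xF.2) \sum_(y' <- xF.2) (1 - k n y y') * (p xF.1 y * p xF.1 y').
    have /existsNP[x /existsNP[F /negP]] := bad n; rewrite -ltNge => h.
    by exists (x, F).
  have [q qP] := choice bad.
  pose x n := (q n).1; pose F n := (q n).2.
  (* The test vector is the row itself, scaled into the unit ball. Its phases cancel those of the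
     entries, so the weighted sum is [C1 ^- 2] times the real double sum above. *)
  pose t n y := C1^-1%:C * row z (x n) y.
  have t1 n : \sum_(y <- F n) modulus (t n y) ^+ 2 <= 1.
    under eq_bigr do rewrite modulusZ.
    rewrite -mulr_sumr modulus_real ?invr_ge0 ?(ltW C10)//.
    have h : \sum_(y <- F n) modulus (row z (x n) y) ^+ 2 <= C1 ^+ 2.
      apply: (le_trans (l2_sum_hnorm _ _)); rewrite lerXn2r ?nnegrE ?hnorm_ge0 ?(ltW C10)//.
    apply: (le_trans (ler_wpM2l (sqr_ge0 _) h)).
    by rewrite -exprMn mulVf ?gt_eqF// expr1n.
  have e0 : 0 < eps / C1 ^+ 2 by rewrite divr_gt0 ?exprn_gt0.
  have [|N NP] := @uniform_null R X Y hX E col ops coupling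
      (fun n => [seq (y, y') | y <- F n, y' <- F n])
      (fun n q => (1 - k n q.1 q.2)%:C * (t n q.1 * conjc (t n q.2))) _ 0 z z _ (lexx 0) e0.
    move=> b /opsC bC; apply: kernel_null bC => // m.
    - by have [] := kP m.
    - by have [] := kP m.
    - by have [] := kP m.
  have := NP N (leqnn N) (x N) (x N); rewrite mdistxx => /(_ (lexx 0)).
  apply/negP; rewrite -ltNge big_allpairs /=.
  have -> : \sum_(y <- F N) \sum_(y' <- F N)
      (1 - k N y y')%:C * (t N y * conjc (t N y')) * (col z y (x N) * conjc (col z y' (x N))) =
      (C1 ^- 2 * \sum_(y <- F N) \sum_(y' <- F N) (1 - k N y y') * (p (x N) y * p (x N) y'))%:C.
    rewrite mulr_sumr (raddf_sum (@real_complex R)); apply: eq_bigr => y _.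
    rewrite mulr_sumr (raddf_sum (@real_complex R)); apply: eq_bigr => y' _ /=.
    rewrite !col_row /t /p !modulus_sqr -exprVn.
    case: (row z (x N) y) (row z (x N) y') => a b [a' b'].
    by apply/eqP; rewrite eq_complex /=; apply/andP; split; apply/eqP; ring.
  apply: lt_le_trans (modulus_Re _); apply: lt_le_trans (ler_norm _) => /=.
  by rewrite [ltRHS]mulrC ltr_pM2r ?invr_gt0 ?exprn_gt0// qP.
have [k01 _ [s s0 ks] _] := kP n.
have [B BP [N BN]] := bounded_geometry_balls hY s0.
have N0 : 0 < N.+1%:R :> R by [].
pose d2 := c ^+ 2 / 4 / N.+1%:R.
have d20 : 0 < d2 by rewrite !divr_gt0 ?exprn_gt0.
exists (Num.sqrt d2) => [|x cx]; first by rewrite sqrtr_gt0.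
have [F FP] := l2_mass c0 cx; apply/not_existsP => small.
have pd y : p x y <= d2.
  have /negP := small y; rewrite -ltNge col_row modulus_conj => /ltW h.
  by rewrite -[d2]sqr_sqrtr ?(ltW d20)// lerXn2r ?nnegrE ?modulus_ge0 ?sqrtr_ge0.
set m := \sum_(y <- F) modulus _ ^+ 2 in FP.
have split_sum : m ^+ 2 = \sum_(y <- F) \sum_(y' <- F) (1 - k n y y') * (p x y * p x y') +
    \sum_(y <- F) \sum_(y' <- F) k n y y' * (p x y * p x y').
  rewrite expr2 {1}/m mulr_suml -big_split; apply: eq_bigr => y _ /=.
  rewrite /m mulr_sumr -big_split; apply: eq_bigr => y' _ /=.
  by rewrite /p; ring.
have kle : \sum_(y <- F) \sum_(y' <- F) k n y y' * (p x y * p x y') <= m * (N%:R * d2).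
  rewrite /m mulr_suml; apply: ler_sum => y _.
  have -> : \sum_(y' <- F) k n y y' * (p x y * p x y') = p x y * \sum_(y' <- F) k n y y' * p x y'.
    by rewrite mulr_sumr; apply: eq_bigr => y' _; rewrite mulrCA.
  rewrite ler_wpM2l//; apply: (@le_trans _ _ (#|` B y|%:R * d2)).
    apply: sum_supported_le => [|y' _|y']; first exact: ltW.
      have [k0 k1] := andP (k01 y y').
      by apply: le_trans (pd y'); rewrite ler_piMl.
    by rewrite BP -ltNge => /ks ->; rewrite mul0r.
  by rewrite ler_wpM2r ?ler_nat ?(ltW d20).
have Nd : N%:R * d2 < c ^+ 2 / 4.
  have -> : c ^+ 2 / 4 = N.+1%:R * d2 by rewrite [RHS]mulrC /d2 divfK// gt_eqF.
  by rewrite ltr_pM2r// ltr_nat.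
have := nP x F; rewrite /eps; have c2 : 0 < c ^+ 2 by rewrite exprn_gt0.
move: split_sum kle FP Nd c2.
move: (\sum_(y <- F) _) (\sum_(y <- F) _) (N%:R * d2) (c ^+ 2) => s1 s2 nd cc.
rewrite /m /=; nra.
Qed.

End Concentration.

(** * Matrix coefficients of a bimodule *)

Lemma smulr0 (R : rcfType) (A : starAlgType R) (a : A) : smul a 0 = 0.
Proof. by rewrite -{1}(scale0r (0 : A)) smulZr scale0r. Qed.

Section Representations.
Context {R : realType} {X : metricType R} (hX : bounded_geometry X).

(** Treats the algebraic Roe algebra and its closure at once: [pi] is a faithful representation, and
    [iota] supplies the matrix units. *)
Record roe_representation (A : starAlgType R) (pi : A -> l2 R X -> l2 R X)
    (iota : alg_uniform_roe hX -> A) : Prop := RoeRepresentation {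
  rep_lin : forall (k : R[i]) a b, pi (k *: a + b) = k *: pi a + pi b;
  rep_mul : forall a b, pi (smul a b) = pi a \o pi b;
  rep_star : forall a, adjoint_of (pi a) (pi (star a));
  rep_inj : injective pi;
  rep_bounded : forall a, bounded_linear (pi a);
  rep_roe : forall T, pi (iota T) = roe_op T
}.

Lemma roe_op_representation : roe_representation (@roe_op R X hX) id.
Proof.
split=> //; [exact: roe_op_lin|exact: roe_op_mul|exact: roe_op_adj|exact: roe_op_inj|].
exact: roe_op_bounded.
Qed.

Fact uniform_roe_of_subproof (T : alg_uniform_roe hX) :
  roe_op T \in closure_pred (roe_operators hX).
Proof.
apply/closure_predP; split; first exact: roe_op_bounded.
move=> e e0; exists (roe_op T); first by exists T.
rewrite subrr; apply: opnorm_le => [|u]; first exact: ltW.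
by rewrite hnorm0 mulr_ge0 ?hnorm_ge0 ?ltW.
Qed.

Definition uniform_roe_of (T : alg_uniform_roe hX) : uniform_roe hX :=
  OpClosure (uniform_roe_of_subproof T).

Lemma closure_op_representation :
  @roe_representation (uniform_roe hX) (fun a => closure_op a) uniform_roe_of.
Proof.
split=> //; [exact: opclosure_starP|exact: opclosure_inj|exact: opclosure_bounded].
Qed.

Context (A : starAlgType R) (pi : A -> l2 R X -> l2 R X).
Context (iota : alg_uniform_roe hX -> A).
Hypothesis rep : roe_representation pi iota.

Lemma repZ (k : R[i]) a : pi (k *: a) = k *: pi a.
Proof.
have pi0 : pi 0 = 0.
  by have := rep_lin rep (-1) 0 0; rewrite scaler0 addr0 scaleN1r addNr.
by rewrite -[k *: a]addr0 (rep_lin rep) pi0 addr0.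
Qed.

Lemma rep_dot_star a u v : dot (pi (star a) u) v = dot u (pi a v).
Proof. by rewrite (rep_star rep) starK. Qed.

Lemma rep_corner a x1 x x' x2 :
  smul (iota (unit_matrix hX x1 x)) (smul a (iota (unit_matrix hX x' x2))) =
  dot (pi a (basis x')) (basis x) *: iota (unit_matrix hX x1 x2).
Proof.
apply: (rep_inj rep); rewrite repZ !(rep_mul rep) !(rep_roe rep).
apply/funext => u /=; rewrite !fctE !roe_op_unit dot_basis.
by rewrite (linearZ' _ _ (rep_bounded rep a).1) -scalerA scalerA mulrC -scalerA.
Qed.

Lemma rep_unit_mul x y z :
  smul (iota (unit_matrix hX x y)) (iota (unit_matrix hX y z)) = iota (unit_matrix hX x z).
Proof.
apply: (rep_inj rep); rewrite (rep_mul rep) !(rep_roe rep).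
apply/funext => u; rewrite [LHS]/comp !roe_op_unit.
by rewrite -[LHS]/((u z * (y == y)%:R) *: basis x) eqxx mulr1.
Qed.

Lemma rep_unit_star x y : star (iota (unit_matrix hX x y)) = iota (unit_matrix hX y x).
Proof.
apply: (rep_inj rep); apply: (adjoint_uniq (rep_star rep _)).
by rewrite !(rep_roe rep); have := roe_op_adj (unit_matrix hX x y); rewrite star_unit.
Qed.

(** The diagonal entry of [a^* a] at [x] is the squared norm of the column of [a] at [x]. *)
Lemma rep_square_diag (a : A) : (forall x, dot (pi (smul (star a) a) (basis x)) (basis x) = 0) ->
  a = 0.
Proof.
move=> a0; apply: (rep_inj rep); apply: (adjoint_ext (rep_star rep a) (rep_star rep 0)).
move=> x; have := a0 x; rewrite (rep_mul rep) /= rep_dot_star => /dot_eq0 ->.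
have := rep_lin rep (-1) 0 0; rewrite scaler0 addr0 scaleN1r addNr.
by move=> ->.
Qed.

End Representations.

(* What remains of an imprimitivity bimodule without norms and completeness. *)
Record pre_bimodule (R : rcfType) (A B : starAlgType R) (E : lmodType R[i])
    (lact : A -> E -> E) (ract : E -> B -> E)
    (lip : E -> E -> A) (rip : E -> E -> B) : Prop := PreBimodule {
  lactM : forall a b x, lact (smul a b) x = lact a (lact b x);
  ractM : forall x a b, ract x (smul a b) = ract (ract x a) b;
  lactZl : forall (k : R[i]) a x, lact (k *: a) x = k *: lact a x;
  ractZl : forall (k : R[i]) x b, ract (k *: x) b = k *: ract x b;
  lactZr : forall (k : R[i]) a x, lact a (k *: x) = k *: lact a x;
  ractZr : forall (k : R[i]) x b, ract x (k *: b) = k *: ract x b;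
  lip_act : forall a x y, lip (lact a x) y = smul a (lip x y);
  rip_act : forall x y a, rip x (ract y a) = smul (rip x y) a;
  lip_star : forall x y, star (lip x y) = lip y x;
  rip_star : forall x y, star (rip x y) = rip y x;
  lipZ : forall (k : R[i]) x y, lip (k *: x) y = k *: lip x y;
  ripZ : forall (k : R[i]) x y, rip x (k *: y) = k *: rip x y;
  lip_ge0 : forall x, exists b, lip x x = smul (star b) b;
  rip_ge0 : forall x, exists b, rip x x = smul (star b) b;
  lip_eq0 : forall x, lip x x = 0 -> x = 0;
  rip_eq0 : forall x, rip x x = 0 -> x = 0;
  actA : forall a x b, ract (lact a x) b = lact a (ract x b);
  lact_adj : forall a x y, rip (lact a x) y = rip x (lact (star a) y);
  ract_adj : forall b x y, lip (ract x b) y = lip x (ract y (star b));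
  ipA : forall x y z, lact (lip x y) z = ract x (rip y z)
}.

Lemma imprimitivity_pre_bimodule (R : rcfType) (A B : cstarAlgType R) (E : lmodType R[i])
    (lact : A -> E -> E) (ract : E -> B -> E) lip rip :
  imprimitivity_bimodule lact ract lip rip -> pre_bimodule lact ract lip rip.
Proof. by case=> -[] ? ? ? ? ? ? ? ? ? ? ? ? -[] *; split. Qed.

(** [B] is a bimodule over itself, and its left structure is transported to [A] along [f] and [g].
    The last hypothesis gives definiteness on the right, and on the left when applied to
    [star x]. *)
Lemma isomorphism_pre_bimodule (R : rcfType) (A B : starAlgType R) (f : {linear A -> B}) (g : B -> A) :
  cancel f g -> cancel g f -> {morph f : x y / smul x y} -> {morph f : x / star x} ->
  (forall b : B, smul (star b) b = 0 -> b = 0) ->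
  @pre_bimodule R A B B (fun a => smul (f a)) (@smul R B)
    (fun x y => g (smul x (star y))) (fun x y => smul (star x) y).
Proof.
move=> fK gK fM fS b0.
have gM x y : g (smul x y) = smul (g x) (g y) by apply: (can_inj fK); rewrite fM !gK.
have gS x : g (star x) = star (g x) by apply: (can_inj fK); rewrite fS !gK.
have gZ k x : g (k *: x) = k *: g x by apply: (can_inj fK); rewrite linearZ !gK.
split=> //.
- by move=> a b x; rewrite fM smulA.
- by move=> x a b; rewrite smulA.
- by move=> k a x; rewrite linearZ smulZl.
- by move=> k x b; rewrite smulZl.
- by move=> k a x; rewrite smulZr.
- by move=> k x b; rewrite smulZr.
- by move=> a x y; rewrite -smulA gM fK.
- by move=> x y a; rewrite smulA.
- by move=> x y; rewrite -gS starM starK.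
- by move=> x y; rewrite starM starK.
- by move=> k x y; rewrite smulZl gZ.
- by move=> k x y; rewrite smulZr.
- by move=> x; exists (g (star x)); rewrite gM gS starK.
- by move=> x; exists x.
- move=> x /(congr1 f); rewrite gK linear0 => x0.
  have sx0 : star x = 0 by apply: b0; rewrite starK.
  by rewrite -[x]starK sx0 -{1}(scale0r (0 : B)) starZ conjc0 scale0r.
- by move=> a x b; rewrite smulA.
- by move=> a x y; rewrite starM fS smulA.
- by move=> b x y; rewrite starM starK smulA.
- by move=> x y z; rewrite gK smulA.
Qed.

Section BimoduleMatrices.
Context {R : realType} {X Y : metricType R}.
Context (hX : bounded_geometry X) (hY : bounded_geometry Y).
Context (A B : starAlgType R).
Context (piA : A -> l2 R X -> l2 R X) (iotaA : alg_uniform_roe hX -> A).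
Context (piB : B -> l2 R Y -> l2 R Y) (iotaB : alg_uniform_roe hY -> B).
Hypothesis repA : roe_representation piA iotaA.
Hypothesis repB : roe_representation piB iotaB.
Context (E : lmodType R[i]) (lact : A -> E -> E) (ract : E -> B -> E).
Context (lip : E -> E -> A) (rip : E -> E -> B).
Hypothesis bim : pre_bimodule lact ract lip rip.

Notation e x x' := (iotaA (unit_matrix hX x x')).
Notation f y y' := (iotaB (unit_matrix hY y y')).

Let scale_e x k k' : k *: e x x = k' *: e x x -> k = k'.
Proof.
move=> /(congr1 (fun a => dot (piA a (basis x)) (basis x))).
by rewrite !(repZ repA) !(rep_roe repA) !fctE !dotZl roe_op_unit dotZl basis_diag /= eqxx !mulr1.
Qed.

Let scale_f y k k' : k *: f y y = k' *: f y y -> k = k'.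
Proof.
move=> /(congr1 (fun a => dot (piB a (basis y)) (basis y))).
by rewrite !(repZ repB) !(rep_roe repB) !fctE !dotZl roe_op_unit dotZl basis_diag /= eqxx !mulr1.
Qed.

Lemma ripZl k z z' : rip (k *: z) z' = conjc k *: rip z z'.
Proof. by rewrite -(rip_star bim) (ripZ bim) starZ (rip_star bim). Qed.

Lemma rip0l z : rip 0 z = 0.
Proof. by rewrite -{1}(scale0r (0 : E)) ripZl conjc0 scale0r. Qed.

Lemma lip0l z : lip 0 z = 0.
Proof. by rewrite -{1}(scale0r (0 : E)) (lipZ bim) scale0r. Qed.

Lemma rip_actl z b z' : rip (ract z b) z' = smul (star b) (rip z z').
Proof. by rewrite -(rip_star bim) (rip_act bim) starM (rip_star bim). Qed.

Lemma lip_actr z a z' : lip z (lact a z') = smul (lip z z') (star a).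
Proof. by rewrite -(lip_star bim) (lip_act bim) starM (lip_star bim). Qed.

Lemma rip_unit z y : rip (ract z (f y y)) (ract z (f y y)) =
  dot (piB (rip z z) (basis y)) (basis y) *: f y y.
Proof. by rewrite rip_actl (rip_act bim) (rep_unit_star repB) (rep_corner repB). Qed.

Lemma lip_unit z x : lip (lact (e x x) z) (lact (e x x) z) =
  dot (piA (lip z z) (basis x)) (basis x) *: e x x.
Proof. by rewrite (lip_act bim) lip_actr (rep_unit_star repA) (rep_corner repA). Qed.

Lemma nonzero_rip_diag (z : E) : z != 0 -> exists y, dot (piB (rip z z) (basis y)) (basis y) != 0.
Proof.
move=> z0; apply: contrapT => /forallNP h.
have [b bE] := rip_ge0 bim z; case/eqP: z0; apply: (rip_eq0 bim).
rewrite bE (rep_square_diag repB (a := b)) => [|y]; first exact: smulr0.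
by have /negP/negPn/eqP := h y; rewrite bE.
Qed.

Lemma nonzero_lip_diag (z : E) : z != 0 -> exists x, dot (piA (lip z z) (basis x)) (basis x) != 0.
Proof.
move=> z0; apply: contrapT => /forallNP h.
have [b bE] := lip_ge0 bim z; case/eqP: z0; apply: (lip_eq0 bim).
rewrite bE (rep_square_diag repA (a := b)) => [|x]; first exact: smulr0.
by have /negP/negPn/eqP := h x; rewrite bE.
Qed.

(* e z f has inner products in C f and C e, and rescaling one to f makes the other
   an idempotent multiple of e, since <u,u>_A u = u <u,u>_B. *)
Lemma rank_one_generator (z : E) : z != 0 -> exists (x0 : X) (y0 : Y) (u : E),
  [/\ lip u u = e x0 x0, rip u u = f y0 y0, lact (e x0 x0) u = u & ract u (f y0 y0) = u].
Proof.
move=> /nonzero_rip_diag[y0 zy].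
have v0 : ract z (f y0 y0) != 0.
  apply: contra zy => /eqP v0; have := rip_unit z y0.
  rewrite v0 rip0l -{1}(scale0r (f y0 y0)).
  by move=> /scale_f <-.
have [x0 vx] := nonzero_lip_diag v0.
pose w := lact (e x0 x0) (ract z (f y0 y0)).
have w0 : w != 0.
  apply: contra vx => /eqP w0; have := lip_unit (ract z (f y0 y0)) x0.
  rewrite -/w w0 lip0l -{1}(scale0r (e x0 x0)).
  by move=> /scale_e <-.
have wE : w = ract (lact (e x0 x0) z) (f y0 y0) by rewrite (actA bim).
have [b bE] := rip_ge0 bim w.
have := rip_unit (lact (e x0 x0) z) y0; rewrite -wE.
have wf : ract w (f y0 y0) = w by rewrite wE -(ractM bim) (rep_unit_mul repB).
have ew : lact (e x0 x0) w = w by rewrite /w -(lactM bim) (rep_unit_mul repA).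
move: (dot _ _) => nu wnu.
(* Positivity of [rip w w] makes [nu] the square of a real norm, so [w] can be rescaled by its
   inverse. *)
have nuE : nu = (hnorm (piB b (basis y0)) ^+ 2)%:C.
  apply: (@scale_f y0); rewrite -wnu -hnorm_dot -(rep_dot_star repB).
  have -> : piB (star b) (piB b (basis y0)) = piB (rip w w) (basis y0).
    by rewrite bE (rep_mul repB).
  by rewrite -(rep_corner repB) -{1}(rep_unit_star repB) -(rip_act bim) -rip_actl wf.
pose n := hnorm (piB b (basis y0)).
have n0 : n != 0.
  apply: contra w0 => /eqP n0; apply/eqP/(rip_eq0 bim).
  by rewrite wnu nuE -/n n0 expr0n /= scale0r.
pose u := (n^-1)%:C *: w.
have uu : rip u u = f y0 y0.
  rewrite ripZl (ripZ bim) wnu !scalerA nuE -/n.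
  rewrite (_ : _ * _ = 1) ?scale1r//.
  by apply/eqP; rewrite eq_complex /=; apply/andP; split; apply/eqP; [field|ring].
have eu : lact (e x0 x0) u = u by rewrite (lactZr bim) ew.
have uf : ract u (f y0 y0) = u by rewrite (ractZl bim) wf.
exists x0, y0, u; split=> //.
have := lip_unit u x0; rewrite eu; move: (dot _ _) => mu uE.
have u0 : u != 0.
  rewrite scaler_eq0 negb_or w0 andbT; apply/eqP => /(congr1 (@complex.Re R)) /= h.
  by move: n0; rewrite -invr_eq0 h eqxx.
have /eqP := ipA bim u u u; rewrite uu uf uE (lactZl bim) eu.
rewrite -[X in _ == X]scale1r -subr_eq0 -scalerBl scaler_eq0 (negbTE u0) orbF subr_eq0.
by move=> /eqP ->; rewrite scale1r.
Qed.

Context (x0 : X) (y0 : Y) (u : E).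
Hypothesis lip_u : lip u u = e x0 x0.
Hypothesis rip_u : rip u u = f y0 y0.
Hypothesis lact_u : lact (e x0 x0) u = u.
Hypothesis ract_u : ract u (f y0 y0) = u.

(* If the matrix coefficients z_xy of z are given by e x0 x z f y y0 = z_xy u, then
   bim_col z y is the column y of z and bim_row z x is the conjugate of the row x. *)
Definition bim_col z y : l2 R X := piA (lip (ract z (f y y0)) u) (basis x0).
Definition bim_row z x : l2 R Y := piB (rip (lact (e x0 x) z) u) (basis y0).

(** Since [rip u u] is [f y0 y0], multiplying by it exhibits the column [z f_yy0] as an element of
    [A] applied to [u]. *)
Let ract_factor z y : ract z (f y y0) = lact (lip (ract z (f y y0)) u) u.
Proof. by rewrite (ipA bim) rip_u -(ractM bim) (rep_unit_mul repB). Qed.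

Let lact_factor z x : lact (e x0 x) z = ract u (rip u (lact (e x0 x) z)).
Proof. by rewrite -(ipA bim) lip_u -(lactM bim) (rep_unit_mul repA). Qed.

(** As [u] is fixed by [e x0 x0], only the corner of [a] at [x0] contributes. *)
Lemma rip_corner_u a : rip u (lact a u) = dot (piA a (basis x0)) (basis x0) *: f y0 y0.
Proof.
rewrite -{1}lact_u (lact_adj bim) (rep_unit_star repA) -[X in lact a X]lact_u.
by rewrite -!(lactM bim) -smulA (rep_corner repA) (lactZl bim) lact_u (ripZ bim) rip_u.
Qed.

Lemma lip_corner_u b : lip (ract u b) u = dot (piB b (basis y0)) (basis y0) *: e x0 x0.
Proof.
rewrite -[X in lip _ X]ract_u -{1}(rep_unit_star repB) -(ract_adj bim).
rewrite -[X in ract X b]ract_u -!(ractM bim) (rep_corner repB).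
by rewrite (ractZr bim) ract_u (lipZ bim) lip_u.
Qed.

(** The vector [v] = [e_x0x z f_yy0] is a scalar multiple of [u]. Pairing with [u] on the left gives
    this scalar, and on the right its conjugate, [rip] being conjugate linear in its first
    variable. *)
Lemma bim_col_row z x y : bim_col z y x = conjc (bim_row z x y).
Proof.
pose v := lact (e x0 x) (ract z (f y y0)).
have lu : lip v u = bim_col z y x *: e x0 x0.
  rewrite (lip_act bim) -{1}lact_u lip_actr (rep_unit_star repA) (rep_corner repA).
  by rewrite dot_basis.
have vE : v = bim_col z y x *: u.
  rewrite -{1}lact_u -(lactZl bim) -lu (ipA bim) rip_u /v.
  by rewrite (actA bim) -!(ractM bim) (rep_unit_mul repB).
have ru : rip v u = bim_row z x y *: f y0 y0.
  rewrite /v -(actA bim) rip_actl (rep_unit_star repB) -[X in smul _ (rip _ X)]ract_u.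
  by rewrite (rip_act bim) (rep_corner repB) dot_basis.
apply: (can_inj (@conjcK _)); rewrite conjcK; apply: (@scale_f y0).
by rewrite -ru vE ripZl rip_u.
Qed.

(** This is [<z',z>_B = z'^* z] for the coefficient matrices: a corner of the inner product pairs
    two columns, each of the form [a u], and [rip_corner_u] evaluates it. *)
Lemma bim_rip_dot z z' y y' :
  dot (piB (rip z' z) (basis y)) (basis y') = dot (bim_col z y) (bim_col z' y').
Proof.
apply: (@scale_f y0).
rewrite -(rep_corner repB) -(rip_act bim) -(rep_unit_star repB y' y0) -rip_actl.
rewrite (ract_factor z) (ract_factor z') (lact_adj bim) -(lactM bim) rip_corner_u.
by rewrite (rep_mul repA) /= (rep_dot_star repA).
Qed.

Lemma bim_lip_dot z z' x x' :
  dot (piA (lip z z') (basis x')) (basis x) = dot (bim_row z' x') (bim_row z x).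
Proof.
apply: (@scale_e x0).
rewrite -(rep_corner repA) -(rep_unit_star repA x0 x') -lip_actr -(lip_act bim).
rewrite (lact_factor z) (lact_factor z') -[X in lip _ (ract _ X)]starK -(ract_adj bim).
rewrite -(ractM bim) lip_corner_u !(rip_star bim) (rep_mul repB) /=.
by rewrite -{1}(rip_star bim) -(rep_dot_star repB) (rip_star bim).
Qed.

Lemma bim_col_act a z y : bim_col (lact a z) y = piA a (bim_col z y).
Proof. by rewrite /bim_col (actA bim) (lip_act bim) (rep_mul repA). Qed.

Lemma bim_row_act b z x : bim_row (ract z b) x = piB (star b) (bim_row z x).
Proof. by rewrite /bim_row -(actA bim) rip_actl (rep_mul repB). Qed.

End BimoduleMatrices.

(** * Rigidity *)

Lemma seq_upper_bound (R : realType) (T : eqType) (s : seq T) (h : T -> R) :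
  exists2 M : R, 0 < M & forall z, z \in s -> h z <= M.
Proof.
exists (1 + \sum_(z <- s) `|h z|) => [|z zs]; first by rewrite ltr_pwDl// sumr_ge0.
apply: (le_trans (ler_norm _)); rewrite (big_rem z)//= addrCA lerDl.
by rewrite addr_ge0// sumr_ge0.
Qed.

Lemma seq_lower_bound (R : realType) (T : eqType) (s : seq T) (h : T -> R) :
  (forall z, 0 < h z) -> exists2 m : R, 0 < m & forall z, z \in s -> m <= h z.
Proof.
move=> h0; have [M M0 MP] := seq_upper_bound s (fun z => (h z)^-1).
exists M^-1 => [|z zs]; first by rewrite invr_gt0.
by rewrite -[leRHS]invrK lef_pV2 ?posrE ?invr_gt0// MP.
Qed.

Section CoarseMap.
Context {R : realType} {X Y : metricType R}.
Context (hX : bounded_geometry X) (hY : bounded_geometry Y).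
Context (E : eqType) (col : E -> Y -> l2 R X).
Context (ops : set (l2 R Y -> l2 R Y)).
Hypothesis coupling : forall (T : alg_uniform_roe hX) (z z' : E),
  exists2 b, ops b & forall y y',
    dot (b (basis y)) (basis y') = dot (roe_op T (col z y)) (col z' y').
Hypothesis ops_closure : ops `<=` in_closure (@roe_operators R Y hY).

Lemma coupling_relation_expansive (zs : seq E) (d r : R) : 0 < d -> 0 <= r ->
  exists2 s : R, 0 < s & forall z z' x x' y y', z \in zs -> z' \in zs ->
    d <= modulus (col z y x) -> d <= modulus (col z' y' x') ->
    mdist x x' <= r -> mdist y y' <= s.
Proof.
(* [coupling_expansive] asks for a strict lower bound on a product that is at least [d ^+ 2]. *)
move=> d0 r0; have e0 : 0 < d ^+ 2 / 2 by rewrite divr_gt0 ?exprn_gt0.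
have ex (z : E * E) := coupling_expansive coupling ops_closure z.1 z.2 r0 e0.
have [s sP] := choice ex.
have [M M0 MP] := seq_upper_bound [seq (z, z') | z <- zs, z' <- zs] s.
exists M => // z z' x x' y y' zz zz' dz dz' xx'.
apply: (@le_trans _ _ (s (z, z'))); last by apply/MP/allpairsP; exists (z, z').
apply: (sP (z, z') x x') => //=; apply: (@lt_le_trans _ _ (d * d)).
  by rewrite -expr2 ltr_pdivrMr// ltr_pMr ?exprn_gt0// ltr1n.
by rewrite ler_pM// ltW.
Qed.

End CoarseMap.

Section Assembly.
Context {R : realType} {X Y : metricType R}.
Context (hX : bounded_geometry X) (hY : bounded_geometry Y).

(** [f] and [g] pick partners for the relation that some [z] in [zs] has an entry of modulus at
    least [d] at [(x, y)]. Finiteness of [zs] gives a common [d] and common expansion constants. *)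
Lemma coarse_of_coupling (E : eqType) (col : E -> Y -> l2 R X) (row : E -> X -> l2 R Y)
    (opsX : set (l2 R X -> l2 R X)) (opsY : set (l2 R Y -> l2 R Y))
    (zs : seq E) (c : R) :
  (forall z x y, col z y x = conjc (row z x y)) ->
  (forall (T : alg_uniform_roe hX) (z z' : E), exists2 b, opsY b & forall y y',
    dot (b (basis y)) (basis y') = dot (roe_op T (col z y)) (col z' y')) ->
  (forall (T : alg_uniform_roe hY) (z z' : E), exists2 b, opsX b & forall x x',
    dot (b (basis x)) (basis x') = dot (roe_op T (row z x)) (row z' x')) ->
  opsX `<=` in_closure (@roe_operators R X hX) ->
  opsY `<=` in_closure (@roe_operators R Y hY) ->
  (forall z, concentrated col row z) -> (forall z, concentrated row col z) ->
  0 < c -> (forall x, exists2 z, z \in zs & c <= hnorm (row z x)) ->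
  (forall y, exists2 z, z \in zs & c <= hnorm (col z y)) ->
  coarsely_equivalent X Y.
Proof.
move=> cr cplY cplX opX opY concY concX c0 rowc colc.
have rc z x y : modulus (row z x y) = modulus (col z y x) by rewrite cr modulus_conj.
have dY z : exists d : R, 0 < d /\ forall x, c <= hnorm (row z x) -> exists y, d <= modulus (col z y x).
  by have [d d0 dP] := concY z c c0; exists d.
have dX z : exists d : R, 0 < d /\ forall y, c <= hnorm (col z y) -> exists x, d <= modulus (row z x y).
  by have [d d0 dP] := concX z c c0; exists d.
have [DY DYP] := choice dY; have [DX DXP] := choice dX.
have [d1 d10 d1P] := seq_lower_bound zs (fun z => (DYP z).1).
have [d2 d20 d2P] := seq_lower_bound zs (fun z => (DXP z).1).
pose d := Num.min d1 d2; have d0 : 0 < d by rewrite lt_min d10.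
have fex x : exists y, exists2 z, z \in zs & d <= modulus (col z y x).
  have [z zz cz] := rowc x; have [y yP] := (DYP z).2 x cz.
  by exists y, z => //; rewrite (le_trans _ yP)// (le_trans _ (d1P z zz))// ge_min lexx.
have gex y : exists x, exists2 z, z \in zs & d <= modulus (row z x y).
  have [z zz cz] := colc y; have [x xP] := (DXP z).2 y cz.
  by exists x, z => //; rewrite (le_trans _ xP)// (le_trans _ (d2P z zz))// ge_min lexx orbT.
have [f fP] := choice fex; have [g gP] := choice gex.
have KY := coupling_relation_expansive cplY opY zs d0.
have KX := coupling_relation_expansive cplX opX zs d0.
exists f, g; split.
- move=> r /ltW r0; have [s s0 sP] := KY r r0; exists s => // x1 x2.
  by have [z zz dz] := fP x1; have [z' zz' dz'] := fP x2; exact: sP dz dz'.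
- move=> r /ltW r0; have [s s0 sP] := KX r r0; exists s => // y1 y2.
  by have [z zz dz] := gP y1; have [z' zz' dz'] := gP y2; exact: sP dz dz'.
(* Both [f (g y)] and [y] are related to [g y], so closeness is the case of distance 0 of
   expansiveness. *)
- have [s s0 sP] := KY 0 (lexx 0); exists s => // y.
  have [z zz dz] := fP (g y); have [z' zz' dz'] := gP y; rewrite rc in dz'.
  by apply: sP dz dz' _; rewrite ?mdistxx.
- have [s s0 sP] := KX 0 (lexx 0); exists s => // x.
  have [z zz dz] := gP (f x); have [z' zz' dz'] := fP x; rewrite -rc in dz'.
  by apply: sP dz dz' _; rewrite ?mdistxx.
Qed.

Lemma coarse_empty : (X -> False) -> (Y -> False) -> coarsely_equivalent X Y.
Proof.
move=> X0 Y0; exists (fun x => False_rect Y (X0 x)), (fun y => False_rect X (Y0 y)).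
split.
- by move=> r _; exists 1 => // x; case: (X0 x).
- by move=> r _; exists 1 => // y; case: (Y0 y).
- by exists 1 => // y; case: (Y0 y).
- by exists 1 => // x; case: (X0 x).
Qed.

End Assembly.

(** The alternatives are the conditions on [ops] in [concentrated_alg] and [concentrated_A]. *)
Definition localizing (R : realType) (X : metricType R) (hX : bounded_geometry X)
    (ops : set (l2 R X -> l2 R X)) : Prop :=
  ops `<=` range (@roe_op R X hX) \/
  property_A X /\ ops `<=` in_closure (@roe_operators R X hX).

(** What is kept of fullness. One list serves all [x], which makes the lower bounds on rows
    uniform. *)
Definition approximately_full (R : realType) (X : metricType R) (A : starAlgType R)
    (pi : A -> l2 R X -> l2 R X) (E : Type) (ip : E -> E -> A) : Prop :=
  exists s : seq (E * E), forall x : X,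
    modulus (1 - \sum_(p <- s) dot (pi (ip p.1 p.2) (basis x)) (basis x)) <= 2^-1.

Lemma localizing_closure (R : realType) (X : metricType R) (hX : bounded_geometry X)
    (ops : set (l2 R X -> l2 R X)) : localizing hX ops ->
  ops `<=` in_closure (@roe_operators R X hX).
Proof.
move=> [opsR _ /opsR[T _ <-]|[_]//].
exact/closure_predP/uniform_roe_of_subproof.
Qed.

(** If at some [x] the rows of all first components were shorter than [(4 * M)^-1], Cauchy-Schwarz
    would bound the sum by 1/4, whereas it lies within 1/2 of 1. *)
Lemma full_lower_bound (R : realType) (X Y : choiceType) (E : eqType) (row : E -> X -> l2 R Y)
    (s : seq (E * E)) : (forall z, exists C, forall x, hnorm (row z x) <= C) ->
  (forall x, modulus (1 - \sum_(p <- s) dot (row p.2 x) (row p.1 x)) <= 2^-1) ->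
  exists2 c : R, 0 < c & forall x, exists2 z, z \in [seq p.1 | p <- s] & c <= hnorm (row z x).
Proof.
move=> /choice[C CP] full.
pose M := 1 + \sum_(p <- s) `|C p.2|.
have M0 : 0 < M by rewrite ltr_pwDl// sumr_ge0.
exists (4 * M)^-1 => [|x]; first by rewrite invr_gt0 mulr_gt0.
apply/not_exists2P => small.
have h p : p \in s -> modulus (dot (row p.2 x) (row p.1 x)) <= `|C p.2| * (4 * M)^-1.
  move=> ps; apply: (le_trans (modulus_dot_le _ _)); apply: ler_pM; rewrite ?hnorm_ge0//.
    exact: le_trans (CP p.2 x) (ler_norm _).
  have [/negP|/negP] := small p.1; first by rewrite (map_f _ ps).
  by rewrite -ltNge => /ltW.
have : modulus (\sum_(p <- s) dot (row p.2 x) (row p.1 x)) <= 4^-1.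
  apply: (le_trans (modulus_sum _ _)).
  apply: (@le_trans _ _ (\sum_(p <- s) `|C p.2| * (4 * M)^-1)).
    by rewrite big_seq [leRHS]big_seq; exact: ler_sum.
  rewrite -mulr_suml ler_pdivrMr ?mulr_gt0// mulKf ?pnatr_eq0//.
  by rewrite /M lerDr.
have := full x; have := modulusD (1 - \sum_(p <- s) dot (row p.2 x) (row p.1 x))
  (\sum_(p <- s) dot (row p.2 x) (row p.1 x)).
by rewrite subrK modulus1; lra.
Qed.

Lemma modulus_dot_basis_le (R : realType) (X : choiceType) (T : l2 R X -> l2 R X) (x : X) :
  bounded_linear T -> modulus (dot (T (basis x)) (basis x)) <= opnorm T.
Proof.
move=> bT; apply: (le_trans (modulus_dot_le _ _)).
by rewrite hnorm_basis mulr1; apply: (le_trans (opnormP _ bT)); rewrite hnorm_basis mulr1.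
Qed.

Lemma Re_dot_basis_le (R : realType) (X : choiceType) (T : l2 R X -> l2 R X) (x : X) :
  bounded_linear T -> complex.Re (dot (T (basis x)) (basis x)) <= opnorm T.
Proof.
move=> bT; apply: le_trans (modulus_dot_basis_le x bT).
exact: le_trans (ler_norm _) (modulus_Re _).
Qed.

Section Rigidity.
Context {R : realType} {X Y : metricType R}.
Context (hX : bounded_geometry X) (hY : bounded_geometry Y).
Context (A B : starAlgType R).
Context (piA : A -> l2 R X -> l2 R X) (iotaA : alg_uniform_roe hX -> A).
Context (piB : B -> l2 R Y -> l2 R Y) (iotaB : alg_uniform_roe hY -> B).
Hypothesis repA : roe_representation piA iotaA.
Hypothesis repB : roe_representation piB iotaB.

Theorem bimodule_rigidity (E : lmodType R[i]) (lact : A -> E -> E) (ract : E -> B -> E)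
    (lip : E -> E -> A) (rip : E -> E -> B) :
  pre_bimodule lact ract lip rip ->
  approximately_full piA lip -> approximately_full piB rip ->
  localizing hX (range piA) -> localizing hY (range piB) ->
  coarsely_equivalent X Y.
Proof.
move=> bim [sA fullA] [sB fullB] locX locY.
(* In the zero bimodule the inner products vanish, so approximate fullness leaves both spaces
   without points. *)
have [[z /eqP z0]|/forallNP all0] := pselect (exists z : E, z <> 0); last first.
  have h (k : R[i]) : k = 0 -> ~ modulus (1 - k) <= 2^-1.
    by move=> ->; rewrite subr0 modulus1; lra.
  have E0 (z : E) : z = 0 by apply: contrapT; exact: all0.
  apply: coarse_empty => [x|y].
    apply: (h _ _ (fullA x)); rewrite big1// => p _.
    by rewrite (E0 p.1) (lip0l bim) -(scale0r (0 : A)) (repZ repA) scale0r dot0l.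
  apply: (h _ _ (fullB y)); rewrite big1// => p _.
  by rewrite (E0 p.1) (rip0l bim) -(scale0r (0 : B)) (repZ repB) scale0r dot0l.
have [x0 [y0 [u [lu ru eu uf]]]] := rank_one_generator repA repB bim z0.
pose col := bim_col (hY := hY) piA iotaB ract lip x0 y0 u.
pose row := bim_row (hX := hX) iotaA piB lact rip x0 y0 u.
have cr z' x y : col z' y x = conjc (row z' x y) by apply: (bim_col_row repA repB bim ru eu uf).
have cB z1 z2 y y' : dot (piB (rip z2 z1) (basis y)) (basis y') = dot (col z1 y) (col z2 y').
  exact: (bim_rip_dot repA repB bim ru eu).
have cA z1 z2 x x' : dot (piA (lip z1 z2) (basis x')) (basis x) = dot (row z2 x') (row z1 x).
  exact: (bim_lip_dot repA repB bim lu uf).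
have cplY (T : alg_uniform_roe hX) (z1 z2 : E) : exists2 b, range piB b & forall y y',
    dot (b (basis y)) (basis y') = dot (roe_op T (col z1 y)) (col z2 y').
  exists (piB (rip z2 (lact (iotaA T) z1))); first by exists (rip z2 (lact (iotaA T) z1)).
  by move=> y y'; rewrite cB /col (bim_col_act iotaB repA bim) (rep_roe repA).
have cplX (T : alg_uniform_roe hY) (z1 z2 : E) : exists2 b, range piA b & forall x x',
    dot (b (basis x)) (basis x') = dot (roe_op T (row z1 x)) (row z2 x').
  (* Rows are stored conjugated, so acting by [b] on the right multiplies them by [star b]; hence
     the extra [star]. *)
  exists (piA (lip z2 (ract z1 (star (iotaB T))))); first by eexists.
  by move=> x x'; rewrite cA /row (bim_row_act iotaA repB bim) starK (rep_roe repB).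
have rowC z' : exists C, forall x, hnorm (row z' x) <= C.
  exists (Num.sqrt (opnorm (piA (lip z' z')))) => x; rewrite ler_wsqrtr// -cA.
  exact: Re_dot_basis_le (rep_bounded repA _).
have colC z' : exists C, forall y, hnorm (col z' y) <= C.
  exists (Num.sqrt (opnorm (piB (rip z' z')))) => y; rewrite ler_wsqrtr// -cB.
  exact: Re_dot_basis_le (rep_bounded repB _).
have [|c1 c10 c1P] := full_lower_bound rowC (s := sA).
  by move=> x; under eq_bigr do rewrite -cA; exact: fullA.
have [|c2 c20 c2P] := full_lower_bound colC (s := sB).
  by move=> y; under eq_bigr do rewrite -cB; exact: fullB.
pose zs := [seq p.1 | p <- sA] ++ [seq p.1 | p <- sB].
pose c := Num.min c1 c2.
apply: (@coarse_of_coupling R X Y hX hY E col row _ _ zs c cr cplY cplX).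
- exact: localizing_closure.
- exact: localizing_closure.
- move=> z'; have [opsR|[pA opsC]] := locY.
    exact: (concentrated_alg cr cplY z' opsR).
  by have [C CP] := rowC z'; exact: (concentrated_A cr cplY pA opsC CP).
- have rc z' y x : row z' x y = conjc (col z' y x) by rewrite cr conjcK.
  move=> z'; have [opsR|[pA opsC]] := locX.
    exact: (concentrated_alg rc cplX z' opsR).
  by have [C CP] := colC z'; exact: (concentrated_A rc cplX pA opsC CP).
- by rewrite lt_min c10.
- move=> x; have [z' zz cz] := c1P x; exists z'; first by rewrite mem_cat zz.
  by rewrite (le_trans _ cz)// ge_min lexx.
- move=> y; have [z' zz cz] := c2P y; exists z'; first by rewrite mem_cat zz orbT.
  by rewrite (le_trans _ cz)// ge_min lexx orbT.
Qed.

End Rigidity.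

Section IsomorphismRigidity.
Context {R : realType} {X Y : metricType R}.
Context (hX : bounded_geometry X) (hY : bounded_geometry Y).
Context (A B : starAlgType R).
Context (piA : A -> l2 R X -> l2 R X) (iotaA : alg_uniform_roe hX -> A).
Context (piB : B -> l2 R Y -> l2 R Y) (iotaB : alg_uniform_roe hY -> B).
Hypothesis repA : roe_representation piA iotaA.
Hypothesis repB : roe_representation piB iotaB.

Lemma isomorphism_rigidity : star_isomorphic A B ->
  localizing hX (range piA) -> localizing hY (range piB) -> coarsely_equivalent X Y.
Proof.
move=> [f [[g fK gK] fM fS]].
have b0 (b : B) : smul (star b) b = 0 -> b = 0.
  move=> bb; apply: (rep_square_diag repB) => y.
  by rewrite bb -(scale0r (0 : B)) (repZ repB) scale0r dot0l.
have bim := isomorphism_pre_bimodule fK gK fM fS b0.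
pose oneA := iotaA (identity_matrix hX); pose oneB := iotaB (identity_matrix hY).
have piA1 : piA oneA = id by rewrite (rep_roe repA) roe_op_identity.
have piB1 : piB oneB = id by rewrite (rep_roe repB) roe_op_identity.
have oneB_mul b : smul oneB b = b by apply: (rep_inj repB); rewrite (rep_mul repB) piB1.
have star1 : star oneB = oneB.
  apply: (rep_inj repB); rewrite piB1; apply: (adjoint_uniq (rep_star repB oneB)).
  by rewrite piB1.
(* [g oneB] is a left unit of [A], and [oneA] is represented by the identity. The single pair
   [(oneB, oneB)] then witnesses fullness on both sides. *)
have piAg : piA (g oneB) = id.
  have : smul (g oneB) oneA = oneA by apply: (can_inj fK); rewrite fM gK oneB_mul.
  by move=> /(congr1 piA); rewrite (rep_mul repA) piA1.
apply: (bimodule_rigidity repA repB bim); exists [:: (oneB, oneB)] => z /=;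
  by rewrite big_seq1 /= star1 oneB_mul ?piAg ?piB1 basis_diag subrr modulus0 invr_ge0.
Qed.

End IsomorphismRigidity.

Section MoritaRigidity.
Context {R : realType} {X : metricType R} (hX : bounded_geometry X).

Lemma closure_op_sum (E : Type) (s : seq E) (h : E -> uniform_roe hX) u v :
  dot (closure_op (\sum_(p <- s) h p) u) v = \sum_(p <- s) dot (closure_op (h p) u) v.
Proof.
apply: (big_morph (fun a : uniform_roe hX => dot (closure_op a u) v)) => [a b|].
  exact: dotDl.
exact: dot0l.
Qed.

(** Fullness approximates the identity matrix in norm, and the operator norm bounds every diagonal
    entry of the difference. *)
Lemma full_approximately_full (E : lmodType R[i]) (ip : E -> E -> uniform_roe hX) :
  full_inner_product ip -> approximately_full (fun a : uniform_roe hX => closure_op a) ip.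
Proof.
move=> full; have half0 : 0 < 2^-1 :> R by rewrite invr_gt0.
have [s sP] := full (uniform_roe_of (identity_matrix hX)) _ half0.
exists s => x; rewrite -closure_op_sum.
have E1 : dot (closure_op (uniform_roe_of (identity_matrix hX)) (basis x)) (basis x) = 1.
  by rewrite [closure_op _]roe_op_identity basis_diag.
rewrite -E1 -dotBl.
set a := _ - _ in sP.
exact: le_trans (modulus_dot_basis_le x (opclosure_bounded a)) sP.
Qed.

Lemma localizing_A : property_A X ->
  localizing hX (range (fun a : uniform_roe hX => closure_op a)).
Proof. by move=> pA; right; split=> // _ [a _ <-]; exact: opclosureP. Qed.

End MoritaRigidity.

Theorem theorem1p4 (R : realType) (X Y : metricType R)
    (hX : bounded_geometry X) (hY : bounded_geometry Y) :
  (star_isomorphic (alg_uniform_roe hX) (alg_uniform_roe hY) ->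
     coarsely_equivalent X Y) /\
  (property_A X -> property_A Y ->
     (morita_equivalent (uniform_roe hX) (uniform_roe hY) ->
        coarsely_equivalent X Y) /\
     (star_isomorphic (uniform_roe hX) (uniform_roe hY) ->
        coarsely_equivalent X Y)).
Proof.
have repX := closure_op_representation hX; have repY := closure_op_representation hY.
split=> [iso|/(localizing_A hX) locX /(localizing_A hY) locY].
  have rX := roe_op_representation hX; have rY := roe_op_representation hY.
  by apply: (isomorphism_rigidity rX rY iso); left.
split=> [[E [lact [ract [lip [rip imp]]]]]|iso].
  apply: (bimodule_rigidity repX repY (imprimitivity_pre_bimodule imp)) => //.
    by have [_ _ lf _ _ _ _ _] := imp; exact: full_approximately_full.
  by have [_ _ _ rf _ _ _ _] := imp; exact: full_approximately_full.
exact: isomorphism_rigidity repX repY iso locX locY.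
Qed.
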